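(* Let $\alpha > -1$, $\sigma>0$ and $1\le p,q \le \infty$. (a) If $\alpha \ge -1/2$, then $\mathbb{J}^{\alpha,\sigma}$ is bounded from $L^p(dw_{\alpha})$ to $L^q(dw_{\alpha})$ if and only if $$\frac{1}{p} - \frac{\sigma}{\alpha+1} \le \frac{1}q \le \frac{1}{p} \quad \text{and} \quad \bigg(\frac{1}p,\frac1{q}\bigg) \notin \bigg\{ \Big(\frac{\sigma}{\alpha+1},0\Big),\Big(1,1-\frac{\sigma}{\alpha+1}\Big)\bigg\}.$$ (b) If $\alpha < -1/2$, then $\mathbb{J}^{\alpha,\sigma}$ is bounded from $L^p(dw_{\alpha})$ to $L^q(dw_{\alpha})$ if and only if $p=q$.
   Context: For $\alpha>-1$ let $dw_\alpha(x)=|x|^{2\alpha+1}dx$ on $\mathbb R$, let $I_\alpha$ denote the modified Bessel function of the first kind of order $\alpha$, and for $t,x,y>0$ let $$W_t^{\alpha}(x,y)=\frac{1}{2t}\exp\Big(-\frac{x^2+y^2}{4t}\Big)(xy)^{-\alpha}I_\alpha\Big(\frac{xy}{2t}\Big),$$ extended to $x=0$ or $y=0$ by taking limits. Define $$\mathbb W_t^{\alpha}(x,y)=\frac12\Big[W_t^{\alpha}(|x|,|y|)+xy\,W_t^{\alpha+1}(|x|,|y|)\Big],\qquad x,y\in\mathbb R,\ t>0,$$ $$\mathbb H^{\alpha,\sigma}(x,y)=\frac1{\Gamma(\sigma)}\int_0^\infty e^{-t}\,\mathbb W_t^{\alpha}(x,y)\,t^{\sigma-1}\,dt,\qquad \mathbb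 J^{\alpha,\sigma}f(x)=\int_{\mathbb R}\mathbb H^{\alpha,\sigma}(x,y)f(y)\,dw_\alpha(y),\qquad x,y\in\mathbb R.$$ Boundedness from $L^p$ to $L^q$ means that for every $f\in L^p$ the integral defining the operator converges for a.e. $x$ and the norm inequality holds with a constant independent of $f$. Convention: $1/\infty=0$. *)

(* Defs.v *)
From HB Require Import structures.
From mathcomp Require Export all_boot all_order all_algebra.
From mathcomp Require Export all_classical all_reals all_analysis.
From mathcomp Require Export measurable_realfun ess_sup_inf.

Set Implicit Arguments.
Unset Strict Implicit.
Unset Printing Implicit Defensive.
Export Order.TTheory GRing.Theory Num.Theory.
Export numFieldNormedType.Exports.

Local Open Scope classical_set_scope.
Local Open Scope ring_scope.

Section power_measure.
Context {R : realType}.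
Variable alpha : R.

(* For alpha < -1/2 the density is infinite at 0, where `^ returns 0; this is
   harmless since {0} is Lebesgue-null. *)
Definition dw (A : set (measurableTypeR R)) : \bar R :=
  (\int[lebesgue_measure]_(x in A) (`|x| `^ (2 * alpha + 1))%:E)%E.

Let dw0 : dw set0 = 0%E.
Proof. by rewrite /dw integral_set0. Qed.

Let dw_ge0 A : (0 <= dw A)%E.
Proof. by apply: integral_ge0 => x _; rewrite lee_fin powR_ge0. Qed.

Let dw_sigma_additive : semi_sigma_additive dw.
Proof.
move=> /= A mA tA mUA.
have mf : measurable_fun (\bigcup_n A n)
    (fun x : measurableTypeR R => (`|x| `^ (2 * alpha + 1))%:E).
  apply/measurable_funTS/measurable_EFinP.
  exact: (measurableT_comp (measurable_powR _)).
have f0 x : (\bigcup_n A n) x -> (0 <= (`|x| `^ (2 * alpha + 1))%:E)%E.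
  by rewrite lee_fin powR_ge0.
rewrite {2}/dw (ge0_integral_bigcup _ mA mf f0 tA).
by apply: is_cvg_ereal_nneg_natsum_cond => n _ _; exact: dw_ge0.
Qed.

HB.instance Definition _ := isMeasure.Build _ _ _
  dw dw0 dw_ge0 dw_sigma_additive.

End power_measure.

Section operators.
Context {R : realType}.
Implicit Types (alpha sigma t x y z : R).

(* Euler's integral; it converges for z > 0, and is only used there. *)
Definition Gamma z : R :=
  \int[lebesgue_measure]_(t in `]0, +oo[) (t `^ (z - 1) * expR (- t)).

(* The power series
     I_alpha(z) = sum_k (z/2)^(2k+alpha) / (k! Gamma(k+alpha+1)),
   for z > 0 and alpha > -1. *)
Definition besselI alpha z : R :=
  limn (series (fun k : nat =>
    (z / 2) `^ (2 * k%:R + alpha) / (k`!%:R * Gamma (k%:R + alpha + 1)))).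

Definition heat_pos alpha t x y : R :=
  (2 * t)^-1 * expR (- ((x ^+ 2 + y ^+ 2) / (4 * t))) *
  (x * y) `^ (- alpha) * besselI alpha (x * y / (2 * t)).

(* Meant for x, y >= 0: on the boundary of the open quadrant the value is the
   limit from inside the quadrant. *)
Definition heat alpha t x y : R :=
  if (0 < x) && (0 < y) then heat_pos alpha t x y
  else lim (heat_pos alpha t z.1 z.2
         @[z --> within [set z : R * R | 0 < z.1 /\ 0 < z.2] (nbhs (x, y))]).

Definition dunkl_heat alpha t x y : R :=
  2^-1 * (heat alpha t `|x| `|y| + x * y * heat (alpha + 1) t `|x| `|y|).

(* Extended-real valued: the integral may be +oo when x = y. *)
Definition potential_kernel alpha sigma x y : \bar R :=
  ((Gamma sigma)^-1%:E * \int[lebesgue_measure]_(t in `]0%R, +oo[)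
     (expR (- t) * dunkl_heat alpha t x y * t `^ (sigma - 1))%:E)%E.

Definition potential alpha sigma (f : R -> R) x : \bar R :=
  (\int[dw alpha]_y (potential_kernel alpha sigma x y * (f y)%:E))%E.

Definition bounded_potential alpha sigma (p q : \bar R) : Prop :=
  exists C : R, forall f : measurableTypeR R -> R, f \in Lfun (dw alpha) p ->
    {ae dw alpha, forall x,
      (dw alpha).-integrable [set: measurableTypeR R]
        (fun y => potential_kernel alpha sigma x y * (f y)%:E)%E} /\
    ('N[dw alpha]_q[potential alpha sigma f] <=
       C%:E * 'N[dw alpha]_p[EFin \o f])%E.

End operators.

(* Main.v *)
From HB Require Import structures.
Require Import Defs.
From mathcomp Require Import ring lra.

(** The operator averages heat operators over the time [t], with weight [t ^ (sigma - 1) e ^ (- t)].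
    Expanding the Bessel function in its power series turns the even heat kernel [W_t(x, y)] into
    an explicit function on the whole line ([heat_kernel], [dunkl_heatE]). The odd part
    [x y W_t^(alpha + 1)(x, y)] is at most a multiple of [W_t(x, y)] ([heat_kernel_odd_le]) and is
    nonnegative for [x, y > 0]. Hence, with [K(x, y)] the integral of
    [t ^ (sigma - 1) e ^ (- t) W_t(x, y)] over [t > 0], the potential kernel is bounded by a
    multiple of [K] everywhere, and bounded below by a multiple of [K] on the open quadrant.

    Sufficiency. [W_t(x, .)] has mass [1] on each half-line ([heat_kernel_mass]), so the marginals
    of [K] are bounded, and the operator is bounded from [Lp] to [Lp] for every [p], whatever
    [alpha]. If [alpha >= - 1 / 2], then also [W_t <= C t ^ (- (alpha + 1))] ([heat_kernel_le]).
    Splitting the time integral at [delta], the early times form a kernel with marginals of order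
    [delta ^ sigma], and the late times map the unit ball of [Lp] to functions bounded by a multiple
    of [delta ^ (sigma - (alpha + 1) / p)]. Optimizing in [delta] gives a weak-type estimate that
    only involves the part of [f] above a certain height ([heat_potential_weak]); for [p > 1] the
    layer cake formula turns it directly into the strong bound, endpoint included
    ([distribution_to_strong]). For [p = 1] or [q = +oo] the strict inequality is what makes a power
    integrable at the end of its range. Exponents in the interior of the region are critical for a
    larger dimension than [alpha + 1], which the factor [e ^ (- t)] permits ([exp_heat_le]).

    Necessity. All tests use intervals in the half-line. Near the origin [K(x, y)] is at least of
    the order of [r ^ (2 sigma - 2 alpha - 2)] for [x, y <= r], and letting [r] tend to [0] gives
    [1 / p - sigma / (alpha + 1) <= 1 / q]; at the two excluded points a factor [ln (1 / r)], or a
    power of it, is left over and contradicts boundedness. Far from the origin, the variance of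
    [W_t(x, .)] shows that for small times, uniformly in [x >= 1], half of its mass lies within
    [1 / 4] of [x] ([heat_kernel_localization]), so the potential of the indicator of a set is
    bounded below well inside this set. Intervals of length comparable to [L] at distance [L], with
    [L] large, then give [1 / q <= 1 / p]. If [alpha < - 1 / 2], the measure of [[L, L + 1]] tends
    to [0] as [L] grows, and these intervals give [1 / p <= 1 / q]. *)

Set Implicit Arguments.
Unset Strict Implicit.
Unset Printing Implicit Defensive.

Local Open Scope classical_set_scope.
Local Open Scope ring_scope.

(** * Monotonicity of integrals *)

(** For nonnegative integrands the integral is a supremum over simple functions below, hence
    monotone; this applies to potentials before anything is known of their measurability. *)
Lemma le_integral_nonneg d (T : measurableType d) (R : realType)
    (mu : {measure set T -> \bar R}) (D : set T) (f g : T -> \bar R) :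
  (forall x, D x -> (0 <= f x)%E) -> (forall x, D x -> (f x <= g x)%E) ->
  (\int[mu]_(x in D) f x <= \int[mu]_(x in D) g x)%E.
Proof.
move=> f0 fg; rewrite [leLHS]integral_mkcond [leRHS]integral_mkcond.
have fD0 x : (0 <= (f \_ D) x)%E by apply: erestrict_ge0.
have fgD x : ((f \_ D) x <= (g \_ D) x)%E by apply: lee_restrict.
rewrite !ge0_integralTE//; last by move=> x; exact: le_trans (fD0 x) (fgD x).
apply: ereal_sup_le => _ /= [h hf <-].
by exists h => // x; exact: le_trans (hf x) (fgD x).
Qed.

Lemma le_integral_nonnegS d (T : measurableType d) (R : realType)
    (mu : {measure set T -> \bar R}) (A B : set T) (f g : T -> \bar R) :
  A `<=` B -> (forall x, B x -> (0 <= g x)%E) ->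
  (forall x, A x -> (0 <= f x <= g x)%E) ->
  (\int[mu]_(x in A) f x <= \int[mu]_(x in B) g x)%E.
Proof.
move=> AB g0 fg; rewrite [leLHS]integral_mkcond [leRHS]integral_mkcond.
apply: le_integral_nonneg => x _; rewrite !patchE.
  by case: ifPn => // /set_mem /fg /andP[].
case: ifPn => [/set_mem Ax|_].
  by rewrite mem_set; [case/andP: (fg _ Ax)|exact: AB].
by case: ifPn => // /set_mem; exact: g0.
Qed.

(** * Integrals of powers and exponentials *)

Section power_integrals.
Context {R : realType}.
Implicit Types a b r s t x y : R.
Local Notation leb := (@lebesgue_measure R).

Lemma is_derive_powR r x : 0 < x -> is_derive x 1 (fun y => y `^ r) (r * x `^ (r - 1)).
Proof.
move=> x0; have xI : x \in `]0, +oo[ by rewrite in_itv/= x0.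
apply: DeriveDef; first exact: derivable_powR.
by rewrite -derive1E powR_derive1.
Qed.

Lemma continuous_powR r x : 0 < x -> {for x, continuous (fun y => y `^ r)}.
Proof.
move=> x0; apply/differentiable_continuous/derivable1_diffP.
by have := is_derive_powR r x0; case.
Qed.

Lemma measurable_powRl (D : set (measurableTypeR R)) r :
  measurable_fun D (fun y : measurableTypeR R => y `^ r).
Proof. by apply: measurable_funTS; exact: measurable_powR. Qed.

Lemma powRD_gt0 x r s : 0 < x -> x `^ (r + s) = x `^ r * x `^ s.
Proof. by move=> x0; rewrite powRD// (gt_eqF x0) implybT. Qed.

Lemma ler_powR_neg r x y : r <= 0 -> 0 < x -> x <= y -> y `^ r <= x `^ r.
Proof.
move=> r0 x0 xy; have y0 : 0 < y by rewrite (lt_le_trans x0).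
rewrite -(opprK r) (powRN y (- r)) (powRN x (- r)) lef_pV2 ?posrE ?powR_gt0//.
by apply: ge0_ler_powR; rewrite ?oppr_ge0 ?nnegrE// ltW.
Qed.

Lemma integral_powR_cc r a b : r != 0 -> 0 < a -> a < b ->
  (\int[leb]_(y in `[a, b]) (y `^ (r - 1))%:E = ((b `^ r - a `^ r) / r)%:E)%E.
Proof.
move=> r0 a0 ab.
have dF x : 0 < x -> is_derive x 1 (fun y => y `^ r / r) (x `^ (r - 1)).
  move=> x0; have H := is_deriveZ r^-1 (is_derive_powR r x0).
  rewrite (_ : (fun y => y `^ r / r) = r^-1 \*: (fun y => y `^ r)).
    by apply: (is_derive_eq H); rewrite /GRing.scale/= mulrA mulVf// mul1r.
  by apply/funext => y /=; rewrite mulrC.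
have cF x : 0 < x -> {for x, continuous (fun y => y `^ r / r)}.
  by move=> x0; apply/differentiable_continuous/derivable1_diffP; have := dF _ x0; case.
rewrite (@continuous_FTC2 _ _ (fun y => y `^ r / r) _ _ ab).
- by rewrite -EFinB mulrBl.
- apply: continuous_in_subspaceT => x; rewrite inE/= in_itv/= => /andP[ax _].
  exact/continuous_powR/(lt_le_trans a0).
- split.
  + move=> x; rewrite in_itv/= => /andP[ax _].
    by have := dF x (lt_trans a0 ax); case.
  + exact/cvg_at_right_filter/cF.
  + exact/cvg_at_left_filter/cF/(lt_trans a0).
- move=> x; rewrite in_itv/= => /andP[ax _].
  by rewrite derive1E; have := dF x (lt_trans a0 ax) => /@derive_val ->.
Qed.

Lemma integral_powR_0 r a : 0 < r -> 0 <= a ->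
  (\int[leb]_(y in `]0%R, a[) (y `^ (r - 1))%:E = (a `^ r / r)%:E)%E.
Proof.
move=> r0; rewrite le_eqVlt => /predU1P[<-|a0].
  by rewrite set_itvoo0 integral_set0 powR0 ?gt_eqF// mul0r.
pose u (n : nat) := a / n.+2%:R.
have u0 n : 0 < u n by rewrite divr_gt0.
have ua n : u n < a by rewrite ltr_pdivrMr// ltr_pMr// ltr1n.
pose F n : set (measurableTypeR R) := `]u n, a[%classic.
have FU : `]0, a[%classic = \bigcup_n F n.
  apply/seteqP; split => [x /=|x [n _]].
    rewrite in_itv/= => /andP[x0 xa].
    exists (Num.truncn (a / x)) => //; rewrite /F/= in_itv/= xa andbT /u.
    rewrite ltr_pdivrMr// mulrC -ltr_pdivrMr//.
    by rewrite (lt_trans (truncnS_gt _))// ltr_nat.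
  by rewrite /F/= !in_itv/= => /andP[h ->]; rewrite (lt_trans (u0 n) h).
rewrite FU.
have nF : nondecreasing_seq F.
  apply/nondecreasing_seqP => n; rewrite subsetEset => x; rewrite /F/= !in_itv/=.
  move=> /andP[h ->]; rewrite andbT (le_lt_trans _ h)// /u.
  by rewrite ler_pM2l// lef_pV2 ?posrE// ler_nat.
have := @ge0_nondecreasing_set_cvg_integral _ _ _ F (fun y => (y `^ (r - 1))%:E) leb nF
  (fun i => measurable_itv _).
move=> /(_ _ _)/cvg_lim <- //.
- apply/cvg_lim => //.
  under eq_fun => n.
    rewrite -(@integral_itv_bndoo _ _ _ _ true false); last first.
      by apply/measurable_EFinP; exact: measurable_powRl.
    rewrite integral_powR_cc ?gt_eqF//; over.
  apply: cvg_EFin; first exact: nearW.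
  rewrite -[X in X / r]subr0.
  apply: cvgMr_tmp; apply: cvgB; first exact: cvg_cst.
  have uc : u n @[n --> \oo] --> 0.
    rewrite -(mulr0 a); apply: cvgMl_tmp.
    have := @cvg_harmonic R; rewrite -(cvg_shiftS (@harmonic R)); exact.
  have ucvg : u n @[n --> \oo] --> 0^'+.
    by move=> A; rewrite /at_right /within /= => /uc H; apply: (@filterS _ _ _ (fun n => 0 < u n -> A (u n)) _ _ H) => n; apply.
  exact: cvg_comp ucvg (powR_cvg0 r0).
- by move=> i; apply/measurable_EFinP; exact: measurable_powRl.
- by move=> i x _; rewrite lee_fin powR_ge0.
Qed.

Lemma integral_powR_y_le r a : 0 < r -> 0 < a ->
  (\int[leb]_(y in `[a, +oo[) (y `^ (- r - 1))%:E <= (a `^ (- r) / r)%:E)%E.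
Proof.
move=> r0 a0.
pose F n : set (measurableTypeR R) := `[a, a + n.+1%:R]%classic.
have FU : `[a, +oo[%classic = \bigcup_n F n.
  apply/seteqP; split => [x /=|x [n _]].
    rewrite in_itv/= andbT => ax.
    exists (Num.truncn (x - a)) => //; rewrite /F/= in_itv/= ax/=.
    by rewrite -lerBlDl ltW// truncnS_gt.
  by rewrite /F/= !in_itv/= andbT => /andP[].
rewrite FU.
have nF : nondecreasing_seq F.
  apply/nondecreasing_seqP => n; rewrite subsetEset => x; rewrite /F/= !in_itv/=.
  by move=> /andP[-> h]/=; rewrite (le_trans h)// lerD2l ler_nat.
have := @ge0_nondecreasing_set_cvg_integral _ _ _ F (fun y => (y `^ (- r - 1))%:E) leb nF
  (fun i => measurable_itv _).
move=> /(_ _ _) H.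
have {}H : (\int[leb]_(x in F i) (x `^ (- r - 1))%:E)%E @[i --> \oo] -->
    (\int[leb]_(x in \bigcup_i F i) (x `^ (- r - 1))%:E)%E.
  apply: H => [i|i x _]; last by rewrite lee_fin powR_ge0.
  by apply/measurable_EFinP; exact: measurable_powRl.
rewrite -(cvg_lim _ H)//; apply: lime_le; first by apply/cvg_ex; eexists; exact: H.
apply: nearW => n; rewrite /F integral_powR_cc ?oppr_eq0 ?gt_eqF// ?ltrDl//.
rewrite lee_fin invrN mulrN -mulNr opprB ler_pM2r ?invr_gt0//.
by rewrite gerBl powR_ge0.
Qed.

Lemma integral_expRN_y a :
  (\int[leb]_(y in `[a, +oo[) (expR (- y))%:E = (expR (- a))%:E)%E.
Proof.
have dF (x : R) : is_derive x 1 (fun y => - expR (- y)) (expR (- x)).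
  by apply: is_derive_eq; rewrite ?scalerN ?scaler1 ?mulrN1 ?opprK.
rewrite (@ge0_continuous_FTC2y _ (fun y => expR (- y)) (fun y => - expR (- y)) a 0).
- by rewrite -EFinB sub0r opprK.
- by move=> x _; exact: expR_ge0.
- apply: continuous_subspaceT => x.
  by apply: continuous_comp; [exact: opp_continuous|exact: continuous_expR].
- rewrite -oppr0; apply: cvgN; exact: cvgr_expR.
- by move=> x _; have := dF x; case.
- apply: cvg_at_right_filter; apply: cvgN.
  by apply: continuous_comp; [exact: opp_continuous|exact: continuous_expR].
- by move=> x _; rewrite derive1E; have := dF x => /@derive_val ->.
Qed.

End power_integrals.

(** * The Gamma function and Gaussian moments *)

Lemma integral_if d (T : measurableType d) (R : realType)
    (mu : {measure set T -> \bar R}) (D : set T) (b : pred T) (f : T -> \bar R) :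
  (forall x, b x <-> D x) ->
  (\int[mu]_x (if b x then f x else 0) = \int[mu]_(x in D) f x)%E.
Proof.
move=> bD; rewrite [RHS]integral_mkcond; apply: eq_integral => x _.
rewrite patchE; case: ifPn => [/bD Dx|/negP bx]; first by rewrite mem_set.
by rewrite memNset// => /bD.
Qed.

Section Gamma.
Context {R : realType}.
Implicit Types c m r s t u v x y : R.
Local Notation leb := (@lebesgue_measure R).

Lemma measurable_expRN (D : set (measurableTypeR R)) :
  measurable_fun D (fun y : measurableTypeR R => expR (- y)).
Proof.
apply: measurable_funTS; apply: (measurableT_comp (@measurable_expR R)).
exact: measurable_funN.
Qed.

(** Exchange of integrations after writing [expR (- (y `^ m / c))] as the integral of
    [expR (- v)] over [v > y `^ m / c]. This does the work of a substitution and of an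
    integration by parts at once: [m = 1] gives the recursion of [Gamma], [m = 2] the Gaussian
    moments. *)
Lemma integral_expRN_powR r m c : 0 < r -> 0 < m -> 0 < c ->
  (\int[leb]_(y in `]0%R, +oo[) (y `^ (r - 1) * expR (- (y `^ m / c)))%:E =
   \int[leb]_(v in `]0%R, +oo[) ((c * v) `^ (r / m) / r * expR (- v))%:E)%E.
Proof.
move=> r0 m0 c0.
pose b (z : measurableTypeR R * measurableTypeR R) :=
  [&& 0 < z.1, 0 < z.2 & z.1 `^ m < c * z.2].
pose phi (z : measurableTypeR R * measurableTypeR R) : \bar R :=
  if b z then (z.1 `^ (r - 1) * expR (- z.2))%:E else 0%E.
have m1 : measurable_fun setT (fun z : measurableTypeR R * measurableTypeR R => z.1).
  exact: measurable_fst.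
have m2 : measurable_fun setT (fun z : measurableTypeR R * measurableTypeR R => z.2).
  exact: measurable_snd.
have mphi : measurable_fun setT phi.
  apply: measurable_fun_ifT => //.
    apply: measurable_and; first exact: measurable_fun_ltr.
    apply: measurable_and; first exact: measurable_fun_ltr.
    apply: measurable_fun_ltr.
      exact: (measurableT_comp (measurable_powR _)).
    exact: measurable_funM.
  apply/measurable_EFinP; apply: measurable_funM.
    exact: (measurableT_comp (measurable_powR _)).
  apply: (measurableT_comp (@measurable_expR R)).
  exact: measurable_funN.
have phi0 z : (0 <= phi z)%E.
  by rewrite /phi; case: ifPn => // _; rewrite lee_fin mulr_ge0 ?powR_ge0 ?expR_ge0.
have := @fubini_tonelli _ _ _ _ R leb leb phi mphi phi0.
have -> : (\int[leb]_x \int[leb]_y phi (x, y) =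
  \int[leb]_(y in `]0%R, +oo[) (y `^ (r - 1) * expR (- (y `^ m / c)))%:E)%E.
  rewrite -(@integral_if _ _ R leb `]0, +oo[ (fun x => 0 < x)); last first.
    by move=> x; rewrite /= in_itv/= andbT.
  apply: eq_integral => y _; rewrite /phi /b/=.
  have [y0|y0] := ltP 0 y; last first.
    by rewrite integral0_eq.
  rewrite (@integral_if _ _ R leb `]y `^ m / c, +oo[); last first.
    move=> v; rewrite /= in_itv/= andbT ltr_pdivrMr// (mulrC v).
    split => [/andP[]//|h]; rewrite h andbT.
    by rewrite -(pmulr_rgt0 _ c0) (le_lt_trans _ h)// powR_ge0.
  under eq_integral do rewrite EFinM.
  rewrite ge0_integralZl//; last 2 first.
  - by apply/measurable_EFinP; exact: measurable_expRN.
  - by rewrite lee_fin powR_ge0.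
  rewrite integral_itv_obnd_cbnd.
    by rewrite integral_expRN_y -EFinM.
  by apply/measurable_EFinP; exact: measurable_expRN.
move=> ->.
rewrite -(@integral_if _ _ R leb `]0, +oo[ (fun x => 0 < x)); last first.
  by move=> x; rewrite /= in_itv/= andbT.
apply: eq_integral => v _; rewrite /phi /b/=.
have [v0|v0] := ltP 0 v; last first.
  by rewrite integral0_eq// => x _; rewrite andbF.
have cv0 : 0 < c * v by rewrite mulr_gt0.
rewrite (@integral_if _ _ R leb `]0, (c * v) `^ m^-1[); last first.
  move=> x; rewrite /= in_itv/=.
  split => /andP[x0 h]; rewrite x0/=.
    have := @gt0_ltr_powR _ m^-1 _ (x `^ m) (c * v).
    by rewrite invr_gt0 => /(_ m0 (powR_ge0 _ _) (ltW cv0) h); rewrite -powRrM divff ?gt_eqF// powRr1// ltW.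
  have := @gt0_ltr_powR _ m m0 x ((c * v) `^ m^-1) (ltW x0) (powR_ge0 _ _) h.
  by rewrite -powRrM mulVf ?gt_eqF// powRr1// ltW.
under eq_integral do rewrite EFinM.
rewrite ge0_integralZr//; last 2 first.
- by apply/measurable_EFinP; exact: measurable_powRl.
- by move=> *; rewrite lee_fin powR_ge0.
rewrite integral_powR_0// ?powR_ge0// -EFinM -powRrM.
by rewrite (mulrC m^-1).
Qed.

(** From [u <= exp u] at [u = t / m], raised to the power [m]. *)
Lemma expRN_le_powR m t : 0 < m -> 0 < t -> expR (- t) <= m `^ m * t `^ (- m).
Proof.
move=> m0 t0.
have tm0 : 0 < t / m by rewrite divr_gt0.
have -> : m `^ m * t `^ (- m) = ((t / m) `^ m)^-1.
  rewrite powRM ?invr_ge0 ?ltW// -(powR_inv1 (ltW m0)) -powRrM mulN1r.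
  by rewrite !powRN invfM invrK mulrC.
rewrite expRN lef_pV2 ?posrE ?expR_gt0 ?powR_gt0//.
have -> : expR t = expR (t / m) `^ m.
  by rewrite -expRM divfK// gt_eqF.
apply: ge0_ler_powR; rewrite ?nnegrE ?expR_ge0 ?ltW//.
by rewrite (lt_le_trans _ (expR_ge1Dx _))// ltrDr.
Qed.

Lemma integral_Gamma_lty s : 0 < s ->
  (\int[leb]_(t in `]0%R, +oo[) (t `^ (s - 1) * expR (- t))%:E < +oo)%E.
Proof.
move=> s0.
have s10 : 0 < s + 1 by rewrite addr_gt0.
pose C := (s + 1) `^ (s + 1).
have C0 : 0 < C by rewrite powR_gt0.
have mG (D : set (measurableTypeR R)) :
    measurable_fun D (fun t : measurableTypeR R => (t `^ (s - 1) * expR (- t))%:E).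
  apply/measurable_EFinP; apply: measurable_funM; first exact: measurable_powRl.
  exact: measurable_expRN.
have -> : `]0, +oo[%classic = `]0%R, 1%R[%classic `|` `[1%R, +oo[%classic :> set R.
  apply/seteqP; split => [x|x []]/=; rewrite !in_itv/= ?andbT.
  - by move=> x0; have [x1|x1] := ltP x 1; [left; rewrite x0|right].
  - by move=> /andP[].
  - exact: lt_le_trans.
rewrite ge0_integral_setU//=; last 2 first.
- by move=> t _; rewrite lee_fin mulr_ge0 ?powR_ge0 ?expR_ge0.
- rewrite disj_set2E; apply/eqP/seteqP; split => // x []/=.
  by rewrite !in_itv/= andbT => /andP[_ x1]; rewrite leNgt x1.
apply: lte_add_pinfty.
  apply: (@le_lt_trans _ _ (\int[leb]_(t in `]0%R, 1%R[) (t `^ (s - 1))%:E)%E).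
    apply: le_integral_nonneg => t; rewrite /= in_itv/= => /andP[t0 _].
      by rewrite lee_fin mulr_ge0 ?powR_ge0 ?expR_ge0.
    by rewrite lee_fin ler_piMr ?powR_ge0// expR_le1 oppr_le0 ltW.
  by rewrite integral_powR_0// ltry.
apply: (@le_lt_trans _ _ (\int[leb]_(t in `[1%R, +oo[) (C%:E * (t `^ (- 1 - 1))%:E))%E).
  apply: le_integral_nonneg => t; rewrite /= in_itv/= andbT => t1.
    by rewrite lee_fin mulr_ge0 ?powR_ge0 ?expR_ge0.
  have t0 : 0 < t by rewrite (lt_le_trans _ t1).
  rewrite -EFinM lee_fin.
  apply: (le_trans (ler_wpM2l (powR_ge0 _ _) (expRN_le_powR s10 t0))).
  rewrite mulrCA -powRD_gt0//.
  by rewrite (_ : s - 1 + - (s + 1) = -1 - 1)//; ring.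
rewrite ge0_integralZl; [|by []|by apply/measurable_EFinP; exact: measurable_powRl
  |by move=> t _; rewrite lee_fin powR_ge0|by rewrite lee_fin ltW].
apply: lte_mul_pinfty; [by rewrite lee_fin ltW|by []|].
by apply: (le_lt_trans (integral_powR_y_le _ _)) => //; rewrite ltry.
Qed.

Lemma Gamma_integral s : 0 < s ->
  ((Gamma s)%:E = \int[leb]_(t in `]0%R, +oo[) (t `^ (s - 1) * expR (- t))%:E)%E.
Proof.
move=> s0; rewrite /Gamma /Rintegral fineK// ge0_fin_numE ?integral_Gamma_lty//.
by apply: integral_ge0 => t _; rewrite lee_fin mulr_ge0 ?powR_ge0 ?expR_ge0.
Qed.

Lemma Gamma_gt0 s : 0 < s -> 0 < Gamma s.
Proof.
move=> s0; rewrite -lte_fin Gamma_integral//.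
apply: (@lt_le_trans _ _ (\int[leb]_(t in `]0%R, 1%R[) ((expR (- 1))%:E * (t `^ (s - 1))%:E))%E).
  rewrite ge0_integralZl; [|by []|by apply/measurable_EFinP; exact: measurable_powRl
    |by move=> t _; rewrite lee_fin powR_ge0|by rewrite lee_fin expR_ge0].
  rewrite integral_powR_0// -EFinM lte_fin mulr_gt0 ?expR_gt0//.
  by rewrite powR1 divr_gt0.
apply: le_integral_nonnegS.
- by move=> t; rewrite /= !in_itv/= andbT => /andP[].
- by move=> t _; rewrite lee_fin mulr_ge0 ?powR_ge0 ?expR_ge0.
move=> t; rewrite /= in_itv/= => /andP[t0 t1].
rewrite -EFinM !lee_fin mulr_ge0 ?powR_ge0 ?expR_ge0//= mulrC.
by rewrite ler_wpM2l ?powR_ge0// ler_expR lerN2 ltW.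
Qed.

Lemma GammaD1 s : 0 < s -> Gamma (s + 1) = s * Gamma s.
Proof.
move=> s0; have := @integral_expRN_powR s 1 1 s0 ltr01 ltr01.
have -> : (\int[leb]_(y in `]0%R, +oo[) (y `^ (s - 1) * expR (- (y `^ 1 / 1)))%:E =
    (Gamma s)%:E)%E.
  rewrite Gamma_integral//; apply: eq_integral => y.
  by rewrite inE/= in_itv/= andbT => y0; rewrite powRr1 ?ltW// divr1.
have -> : (\int[leb]_(v in `]0%R, +oo[) ((1 * v) `^ (s / 1) / s * expR (- v))%:E =
    (s^-1 * Gamma (s + 1))%:E)%E.
  rewrite EFinM Gamma_integral ?addr_gt0// -ge0_integralZl//.
  - apply: eq_integral => y _; rewrite mul1r divr1 addrK -EFinM.
    by congr EFin; ring.
  - apply/measurable_EFinP; apply: measurable_funM; first exact: measurable_powRl.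
    exact: measurable_expRN.
  - by move=> t _; rewrite lee_fin mulr_ge0 ?powR_ge0 ?expR_ge0.
  - by rewrite lee_fin invr_ge0 ltW.
by move=> [->]; rewrite mulrA divff ?gt_eqF// mul1r.
Qed.

Lemma integral_gaussian_moment s c : 0 < s -> 0 < c ->
  (\int[leb]_(y in `]0%R, +oo[) (y `^ (2 * s - 1) * expR (- (y ^+ 2 / c)))%:E =
   (c `^ s / 2 * Gamma s)%:E)%E.
Proof.
move=> s0 c0; have s20 : 0 < 2 * s by rewrite mulr_gt0.
transitivity (\int[leb]_(y in `]0%R, +oo[) (y `^ (2 * s - 1) * expR (- (y `^ 2 / c)))%:E)%E.
  apply: eq_integral => y; rewrite inE/= in_itv/= andbT => y0.
  by rewrite powR_mulrn// ltW.
rewrite integral_expRN_powR//.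
have -> : c `^ s / 2 * Gamma s = (c `^ s / (2 * s)) * Gamma (s + 1).
  by rewrite GammaD1//; field; rewrite gt_eqF.
rewrite EFinM Gamma_integral ?addr_gt0// -ge0_integralZl//.
- apply: eq_integral => v; rewrite inE/= in_itv/= andbT => v0.
  rewrite -EFinM; congr EFin.
  rewrite (_ : 2 * s / 2 = s); last by field.
  by rewrite powRM ?ltW// addrK; ring.
- apply/measurable_EFinP; apply: measurable_funM; first exact: measurable_powRl.
  exact: measurable_expRN.
- by move=> t _; rewrite lee_fin mulr_ge0 ?powR_ge0 ?expR_ge0.
- by rewrite lee_fin divr_ge0 ?powR_ge0// ltW.
Qed.

End Gamma.

(** * The power series of the Bessel function *)

Section bessel_series.
Context {R : realType}.
Implicit Types a t w x y : R.

Definition bessel_coeff a (k : nat) : R := (k`!%:R * Gamma (k%:R + a + 1))^-1.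

Definition bessel_term a w : R^nat := fun k => bessel_coeff a k * w ^+ (2 * k).

(** This is [w ^ (- a) * I_a (2 w)], the entire function that is left when the power of [w] is
    divided out of the Bessel function. *)
Definition bessel_series a w : R := limn (series (bessel_term a w)).

Lemma kDa1_gt0 a k : -1 < a -> 0 < k%:R + a + 1.
Proof. by move=> a1; rewrite -addrA ltr_wpDl// -ltrBlDr sub0r. Qed.

Lemma bessel_coeff_gt0 a k : -1 < a -> 0 < bessel_coeff a k.
Proof.
move=> a1; rewrite invr_gt0 mulr_gt0 ?ltr0n ?fact_gt0//.
by rewrite Gamma_gt0// kDa1_gt0.
Qed.

Lemma bessel_coeff_ge0 a k : -1 < a -> 0 <= bessel_coeff a k.
Proof. by move=> a1; rewrite ltW// bessel_coeff_gt0. Qed.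

Lemma bessel_coeffS a k : -1 < a ->
  bessel_coeff a k = k.+1%:R * (k%:R + a + 1) * bessel_coeff a k.+1.
Proof.
move=> a1; have h := kDa1_gt0 k a1; rewrite /bessel_coeff.
have -> : k.+1%:R + a + 1 = (k%:R + a + 1) + 1 by rewrite -natr1; ring.
rewrite (GammaD1 h) factS natrM; field.
by rewrite !gt_eqF ?Gamma_gt0 ?ltr0n ?fact_gt0//.
Qed.

Lemma bessel_coeff_shift a k : -1 < a ->
  bessel_coeff a k = (k%:R + a + 1) * bessel_coeff (a + 1) k.
Proof.
move=> a1; have h := kDa1_gt0 k a1; rewrite /bessel_coeff.
have -> : k%:R + (a + 1) + 1 = (k%:R + a + 1) + 1 by ring.
rewrite (GammaD1 h); field.
by rewrite !gt_eqF ?Gamma_gt0 ?ltr0n ?fact_gt0//.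
Qed.

Lemma bessel_coeff_shiftS a k : -1 < a ->
  bessel_coeff (a + 1) k = k.+1%:R * bessel_coeff a k.+1.
Proof.
move=> a1; have h := kDa1_gt0 k a1.
apply: (mulfI (lt0r_neq0 h)); rewrite -bessel_coeff_shift//.
by rewrite (bessel_coeffS k a1); ring.
Qed.

Lemma bessel_term_ge0 a w k : -1 < a -> 0 <= bessel_term a w k.
Proof.
move=> a1; rewrite /bessel_term mulr_ge0 ?bessel_coeff_ge0//.
by rewrite exprM exprn_ge0// sqr_ge0.
Qed.

(** Since [k + a + 1 >= a + 1], the coefficients decay at least as fast as those of an
    exponential series. *)
Lemma bessel_term_le a w k : -1 < a ->
  bessel_term a w k <= bessel_coeff a 0 * exp_coeff (w ^+ 2 / (a + 1)) k.
Proof.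
move=> a1; have a10 : 0 < a + 1 by rewrite -ltrBlDr sub0r.
have H : bessel_coeff a k <= bessel_coeff a 0 * ((a + 1) ^- k / k`!%:R).
  elim: k => [|k IH]; first by rewrite expr0 fact0 !(invr1, mulr1).
  have E := bessel_coeffS k a1.
  have h := kDa1_gt0 k a1.
  have d0 : 0 < k.+1%:R * (k%:R + a + 1) by rewrite mulr_gt0.
  have -> : bessel_coeff a k.+1 = bessel_coeff a k / (k.+1%:R * (k%:R + a + 1)).
    by rewrite E; field; rewrite !gt_eqF.
  rewrite ler_pdivrMr//; apply: (le_trans IH).
  rewrite -mulrA ler_pM2l ?bessel_coeff_gt0// factS natrM exprSr.
  rewrite -[leLHS]mulr1.
  have -> : ((a + 1) ^+ k * (a + 1))^-1 / (k.+1%:R * k`!%:R) * (k.+1%:R * (k%:R + a + 1))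
     = (a + 1) ^- k / k`!%:R * ((k%:R + a + 1) / (a + 1)).
    by field; rewrite !gt_eqF ?ltr0n ?fact_gt0 ?exprn_gt0.
  rewrite ler_wpM2l//; last first.
    by rewrite ler_pdivlMr// mul1r -addrA lerDr.
  by rewrite mulr_ge0 ?invr_ge0 ?exprn_ge0// ltW.
rewrite /bessel_term /exp_coeff/= (le_trans (ler_wpM2r _ H))//.
  by rewrite exprM exprn_ge0// sqr_ge0.
by rewrite expr_div_n -exprM le_eqVlt; apply/orP; left; apply/eqP; ring.
Qed.

Lemma cvg_bessel_series a w : -1 < a -> cvgn (series (bessel_term a w)).
Proof.
move=> a1; have a10 : 0 < a + 1 by rewrite -ltrBlDr sub0r.
apply: (@series_le_cvg _ _ (bessel_coeff a 0 *: exp_coeff (w ^+ 2 / (a + 1)))).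
- by move=> n; exact: bessel_term_ge0.
- move=> n; rewrite mulr_ge0 ?bessel_coeff_ge0//.
  by rewrite exp_coeff_ge0// divr_ge0 ?sqr_ge0// ltW.
- by move=> n; exact: bessel_term_le.
- by apply: is_cvg_seriesZ; exact: is_cvg_series_exp_coeff.
Qed.

Lemma bessel_seriesE a w : -1 < a ->
  ((bessel_series a w)%:E = \sum_(k <oo) (bessel_term a w k)%:E)%E.
Proof.
move=> a1; rewrite /bessel_series -EFin_lim; last exact: cvg_bessel_series.
by congr (limn _); apply/funext => n; rewrite /= sumEFin.
Qed.

Lemma bessel_series_ge_sum a w n : -1 < a ->
  series (bessel_term a w) n <= bessel_series a w.
Proof.
move=> a1; apply: nondecreasing_cvgn_le; last exact: cvg_bessel_series.
by apply/nondecreasing_seqP => k; rewrite seriesSr lerDl bessel_term_ge0.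
Qed.

Lemma bessel_series_le_bound a w M : -1 < a ->
  (forall n, series (bessel_term a w) n <= M) -> bessel_series a w <= M.
Proof.
by move=> a1 H; apply: limr_le; [exact: cvg_bessel_series|exact: nearW].
Qed.

Lemma bessel_series_ge0 a w : -1 < a -> 0 <= bessel_series a w.
Proof.
move=> a1; apply: le_trans (bessel_series_ge_sum w 0 a1).
by rewrite /series/= big_nil.
Qed.

Lemma bessel_series_ge_coeff0 a w : -1 < a -> bessel_coeff a 0 <= bessel_series a w.
Proof.
move=> a1; apply: le_trans (bessel_series_ge_sum w 1 a1).
by rewrite /series/= big_nat1 /bessel_term muln0 expr0 mulr1.
Qed.

(** The partial sums of [u] and [v] at [n + 1] pair with that of [z] at [n], because the terms
    of [z] enter with a delay of one. *)
Lemma lim_series_rec (u v z : R^nat) (c d : R) :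
  cvgn (series u) -> cvgn (series v) -> cvgn (series z) ->
  u 0%N = c * v 0%N -> (forall k, u k.+1 = c * v k.+1 + d * z k) ->
  limn (series u) = c * limn (series v) + d * limn (series z).
Proof.
move=> cu cv cz u0 uS.
have E n : series u n.+1 = c * series v n.+1 + d * series z n.
  elim: n => [|n IH].
    by rewrite !seriesSr /series/= !big_nil mulr0 addr0 !add0r.
  by rewrite seriesSr IH uS [series v n.+2]seriesSr [series z n.+1]seriesSr; ring.
suff L : series u n.+1 @[n --> \oo] --> c * limn (series v) + d * limn (series z).
  by apply: cvg_lim => //; rewrite -(cvg_shiftS (series u)).
rewrite (_ : (fun n => series u n.+1) = (fun n => c * series v n.+1 + d * series z n)); last first.
  by apply/funext => n; exact: E.
apply: cvgD; last exact: cvgMl_tmp.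
by apply: cvgMl_tmp; rewrite (cvg_shiftS (series v)).
Qed.

(** The three-term recursion of the Bessel functions, compared coefficient by coefficient. *)
Lemma bessel_series_rec a w : -1 < a ->
  bessel_series a w = (a + 1) * bessel_series (a + 1) w + w ^+ 2 * bessel_series (a + 2) w.
Proof.
move=> a1.
have a1' : -1 < a + 1 by rewrite (lt_trans a1)// ltrDl.
have -> : a + 2 = a + 1 + 1 by rewrite -addrA.
have a2' : -1 < a + 1 + 1 by rewrite (lt_trans a1')// ltrDl.
apply: lim_series_rec; do ?exact: cvg_bessel_series.
  by rewrite /bessel_term muln0 expr0 !mulr1 bessel_coeff_shift// add0r.
move=> k; rewrite /bessel_term (bessel_coeff_shift _ a1) (bessel_coeff_shiftS _ a1').
rewrite (_ : (2 * k.+1 = 2 * k + 2)%N); last by rewrite mulnS addnC.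
rewrite exprD -natr1; move: (bessel_coeff _ _) (w ^+ (2 * k)) => B W; ring.
Qed.

(** The shifted series [u k.+1] has at most the sum of [u], so that averaging [C * u] with it
    costs the factor [(C + 1) / 2]. *)
Lemma lim_series_avg_le (u v : R^nat) (c C : R) :
  cvgn (series v) -> cvgn (series u) -> (forall k, 0 <= u k) -> 0 <= C ->
  (forall k, c * v k <= 2^-1 * (C * u k + u k.+1)) ->
  c * limn (series v) <= 2^-1 * (C + 1) * limn (series u).
Proof.
move=> cv cu u0 C0 key.
have H n : series u n <= limn (series u).
  apply: nondecreasing_cvgn_le => //.
  by apply/nondecreasing_seqP => k; rewrite seriesSr lerDl.
rewrite -[leLHS]/(c *: limn (series v)) -lim_seriesZ//.
apply: limr_le; first exact: is_cvg_seriesZ.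
apply: nearW => n.
apply: (@le_trans _ _ (2^-1 * (C * series u n + series u n.+1))); last first.
  by rewrite -mulrA ler_pM2l ?invr_gt0// mulrDl mul1r lerD// ler_wpM2l.
elim: n => [|n IH].
  by rewrite seriesSr /series/= !big_nil mulr0 add0r add0r mulr_ge0 ?invr_ge0.
rewrite seriesSr [series u n.+2]seriesSr [in C * _]seriesSr.
apply: (le_trans (lerD IH (key n))).
by rewrite le_eqVlt; apply/orP; left; apply/eqP; ring.
Qed.

(** The odd part is dominated by the even part: termwise arithmetic-geometric mean with
    weights [k + 1] and [1 / (k + 1)], which match the ratios of consecutive coefficients. *)
Lemma bessel_series_odd_le a w : -1 < a ->
  `|w| * bessel_series (a + 1) w <= (1 + (a + 1)^-1) * bessel_series a w.
Proof.
move=> a1; have a10 : 0 < a + 1 by rewrite -ltrBlDr sub0r.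
have a1' : -1 < a + 1 by rewrite (lt_trans a1)// ltrDl.
pose C := 1 + (a + 1)^-1; rewrite -/C.
have C1 : 1 <= C by rewrite lerDl invr_ge0 ltW.
have key k : `|w| * bessel_term (a + 1) w k <=
    2^-1 * (C * bessel_term a w k + bessel_term a w k.+1).
  have h := kDa1_gt0 k a1.
  have k1 : 0 < k.+1%:R :> R by [].
  have b0 := bessel_coeff_gt0 k a1'.
  have nw2 : `|w| ^+ 2 = w ^+ 2 by rewrite real_normK// num_real.
  have E1 : bessel_term a w k = (k%:R + a + 1) * bessel_coeff (a + 1) k * `|w| ^+ (2 * k).
    by rewrite /bessel_term (bessel_coeff_shift _ a1) !exprM nw2.
  have E2 : bessel_term a w k.+1 = bessel_coeff (a + 1) k / k.+1%:R * `|w| ^+ (2 * k) * `|w| ^+ 2.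
    rewrite /bessel_term (bessel_coeff_shiftS _ a1).
    rewrite (_ : (2 * k.+1 = 2 * k + 2)%N); last by rewrite mulnS addnC.
    rewrite exprD [w ^+ (2 * k)]exprM [`|w| ^+ (2 * k)]exprM !nw2.
    by field; rewrite gt_eqF.
  have E3 : bessel_term (a + 1) w k = bessel_coeff (a + 1) k * `|w| ^+ (2 * k).
    by rewrite /bessel_term !exprM nw2.
  rewrite E1 E2 E3; set W := `|w| ^+ (2 * k); set B := bessel_coeff _ _.
  have BW : 0 <= B * W by rewrite mulr_ge0 ?exprn_ge0// ltW.
  rewrite [leLHS](_ : _ = B * W * `|w|); last by ring.
  rewrite [leRHS](_ : _ = B * W * (2^-1 * (C * (k%:R + a + 1) + `|w| ^+ 2 / k.+1%:R))); last by ring.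
  rewrite ler_wpM2l//.
  have Ck : k.+1%:R <= C * (k%:R + a + 1).
    rewrite /C mulrDl mul1r -natr1.
    have : 1 <= (a + 1)^-1 * (k%:R + a + 1).
      by rewrite mulrC ler_pdivlMr// mul1r -addrA lerDr.
    move: (_^-1 * _) => u u1; rewrite -(addrA k%:R a 1) -addrA lerD2l (le_trans u1)// lerDr; exact: ltW.
  rewrite mulrC ler_pdivlMr//.
  apply: (@le_trans _ _ (k.+1%:R + `|w| ^+ 2 / k.+1%:R)); last by rewrite lerD2r.
  rewrite -subr_ge0.
  rewrite (_ : _ - _ = (k.+1%:R - `|w|) ^+ 2 / k.+1%:R); last by field; rewrite gt_eqF.
  by rewrite divr_ge0 ?sqr_ge0.
have := lim_series_avg_le (cvg_bessel_series a1') (cvg_bessel_series a1)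
  (fun k => bessel_term_ge0 w k a1) (le_trans ler01 C1) key.
move=> /le_trans; apply; rewrite ler_wpM2r ?bessel_series_ge0//.
by rewrite mulrC ler_pdivrMr// mulr_natr mulr2n lerD2l.
Qed.

(** For [-1/2 <= a] the coefficients are dominated by those of [cosh (2 w)]. *)
Lemma bessel_series_le_exp a w : - 2^-1 <= a ->
  bessel_series a w <= bessel_coeff a 0 * expR (2 * `|w|).
Proof.
move=> a2; have a1 : -1 < a by apply: lt_le_trans a2; lra.
have H k : bessel_coeff a k <= bessel_coeff a 0 * (2 ^+ (2 * k) / (2 * k)`!%:R).
  elim: k => [|k IH]; first by rewrite muln0 expr0 fact0 divr1 mulr1.
  have E := bessel_coeffS k a1.
  have h := kDa1_gt0 k a1.
  have d0 : 0 < k.+1%:R * (k%:R + a + 1) by rewrite mulr_gt0.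
  have -> : bessel_coeff a k.+1 = bessel_coeff a k / (k.+1%:R * (k%:R + a + 1)).
    by rewrite E; field; rewrite !gt_eqF.
  rewrite ler_pdivrMr//; apply: (le_trans IH).
  rewrite -mulrA ler_pM2l ?bessel_coeff_gt0//.
  rewrite (_ : (2 * k.+1 = (2 * k).+2)%N); last by rewrite mulnS.
  rewrite !factS !natrM !exprSr.
  have k0 : 0 <= k%:R :> R by [].
  have e1 : (2 * k).+2%:R = 2 * k%:R + 2 :> R by rewrite -[in LHS]natr1 ?(natr1, natrM); ring.
  have e2 : (2 * k).+1%:R = 2 * k%:R + 1 :> R by rewrite -[in LHS]natr1 ?(natr1, natrM); ring.
  rewrite e1 e2 -(natr1 k).
  have -> : 2 ^+ (2 * k) * 2 * 2 / ((2 * k%:R + 2) * ((2 * k%:R + 1) * (2 * k)`!%:R)) *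
      ((k%:R + 1) * (k%:R + a + 1)) =
    2 ^+ (2 * k) / (2 * k)`!%:R * ((2 * k%:R + 2 * a + 2) / (2 * k%:R + 1)) :> R.
    by field; rewrite !gt_eqF ?ltr0n ?fact_gt0// -natrM ?natr1 -?natrD ltr0n.
  have k2 : 0 < 2 * k%:R + 1 :> R by rewrite ltr_wpDl// mulr_ge0.
  rewrite -[leLHS]mulr1; apply: ler_wpM2l; first by rewrite divr_ge0 ?exprn_ge0.
  by rewrite ler_pdivlMr// mul1r; clear -a2 k0; lra.
apply: bessel_series_le_bound => // n.
have even_le m : \sum_(0 <= k < m) exp_coeff (2 * `|w|) (2 * k)%N <=
    series (exp_coeff (2 * `|w|)) (2 * m)%N.
  elim: m => [|m IH]; first by rewrite muln0 /series/= !big_nil.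
  rewrite (_ : (2 * m.+1 = (2 * m).+2)%N); last by rewrite mulnS.
  rewrite big_nat_recr//= !seriesSr -addrA lerD//.
  by rewrite lerDl exp_coeff_ge0// mulr_ge0.
apply: (@le_trans _ _ (bessel_coeff a 0 * \sum_(0 <= k < n) exp_coeff (2 * `|w|) (2 * k)%N)).
  rewrite /series/= big_distrr/=; apply: ler_sum => k _.
  rewrite /bessel_term (le_trans (ler_wpM2r _ (H k)))//.
    by rewrite exprM exprn_ge0// sqr_ge0.
  rewrite /exp_coeff/= exprMn [`|w| ^+ _]exprM real_normK ?num_real// -exprM.
  by rewrite le_eqVlt; apply/orP; left; apply/eqP; ring.
rewrite ler_pM2l ?bessel_coeff_gt0//; apply: (le_trans (even_le n)).
apply: nondecreasing_cvgn_le; last exact: is_cvg_series_exp_coeff.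
by apply/nondecreasing_seqP => k; rewrite seriesSr lerDl exp_coeff_ge0// mulr_ge0.
Qed.

Lemma measurable_bessel_series a : -1 < a ->
  measurable_fun [set: measurableTypeR R] (fun w : measurableTypeR R => bessel_series a w).
Proof.
move=> a1; apply: (@measurable_fun_cvg _ _ _ _ (fun n w => series (bessel_term a w) n)).
  move=> n; apply: measurable_sum => k.
  by apply: measurable_funM; [exact: measurable_cst|exact: measurable_funX].
by move=> w _; exact: cvg_bessel_series.
Qed.

End bessel_series.

(** * The heat kernel *)

Section heat_kernel.
Context {R : realType}.
Implicit Types a t w x y : R.
Local Notation leb := (@lebesgue_measure R).

(** The even heat kernel after cancelling the powers of [x * y], so that a single formula covers
    all real [x] and [y]. It agrees with [heat] off the axes, which is all that matters since
    the axes are null. *)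
Definition heat_kernel a t x y : R :=
  (2 * t)^-1 * (4 * t) `^ (- a) * expR (- ((x ^+ 2 + y ^+ 2) / (4 * t))) *
  bessel_series a (x * y / (4 * t)).

(** The value of the kernel at [t = 1] and [x = y = 0]. *)
Definition heat_const a : R := 2^-1 * 4 `^ (- a) * bessel_coeff a 0.

Lemma heat_const_gt0 a : -1 < a -> 0 < heat_const a.
Proof. by move=> a1; rewrite /heat_const mulr_gt0 ?bessel_coeff_gt0// mulr_gt0 ?powR_gt0. Qed.

Lemma heat_kernel_ge0 a t x y : -1 < a -> 0 < t -> 0 <= heat_kernel a t x y.
Proof.
move=> a1 t0; rewrite /heat_kernel !mulr_ge0 ?invr_ge0 ?mulr_ge0 ?powR_ge0 ?expR_ge0//.
- exact: ltW.
- exact: bessel_series_ge0.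
Qed.

Lemma heat_kernelC a t x y : heat_kernel a t x y = heat_kernel a t y x.
Proof. by rewrite /heat_kernel (addrC (x ^+ 2)) (mulrC x). Qed.

Lemma bessel_series_norm a w : bessel_series a `|w| = bessel_series a w.
Proof.
congr (limn (series _)); apply/funext => k.
by rewrite /bessel_term !exprM real_normK// num_real.
Qed.

Lemma heat_kernel_norm a t x y : 0 < t ->
  heat_kernel a t `|x| `|y| = heat_kernel a t x y.
Proof.
move=> t0; rewrite /heat_kernel !real_normK ?num_real//.
rewrite -[in RHS]bessel_series_norm normrM normrM normfV.
by rewrite (gtr0_norm (_ : 0 < 4 * t))// mulr_gt0.
Qed.

Lemma heat_kernelNr a t x y : 0 < t -> heat_kernel a t x (- y) = heat_kernel a t x y.
Proof. by move=> t0; rewrite -(heat_kernel_norm a x (- y) t0) normrN heat_kernel_norm. Qed.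

Lemma heat_posE a t x y : -1 < a -> 0 < t -> 0 < x -> 0 < y ->
  heat_pos a t x y = heat_kernel a t x y.
Proof.
move=> a1 t0 x0 y0; rewrite /heat_pos /heat_kernel.
have t40 : 0 < 4 * t by rewrite mulr_gt0.
pose w := x * y / (4 * t).
have w0 : 0 < w by rewrite divr_gt0// mulr_gt0.
have -> : besselI a (x * y / (2 * t)) = w `^ a * bessel_series a w.
  rewrite /besselI /bessel_series -[RHS]/(w `^ a *: limn (series (bessel_term a w))).
  rewrite -lim_seriesZ; last exact: cvg_bessel_series.
  congr (limn (series _)); apply/funext => k /=.
  rewrite (_ : x * y / (2 * t) / 2 = w); last by rewrite /w; field; rewrite gt_eqF.
  rewrite powRD_gt0// /bessel_term /bessel_coeff -natrM powR_mulrn ?ltW//.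
  rewrite -[RHS]/(w `^ a * ((k`!%:R * Gamma (k%:R + a + 1))^-1 * w ^+ (2 * k))).
  by move: (_^-1) (w ^+ _) => u v; ring.
have -> : w `^ a = (x * y) `^ a * (4 * t) `^ (- a).
  rewrite -(mulN1r a) powRrM (powR_inv1 (ltW t40)) -powRM//.
    by rewrite mulr_ge0// ltW.
  by rewrite invr_ge0 ltW.
have xy0 : 0 < x * y by rewrite mulr_gt0.
have -> : (x * y) `^ a = ((x * y) `^ (- a))^-1 by rewrite powRN invrK.
by field; rewrite !gt_eqF ?powR_gt0.
Qed.

Lemma heatE a t x y : -1 < a -> 0 < t -> x != 0 -> y != 0 ->
  heat a t `|x| `|y| = heat_kernel a t x y.
Proof.
move=> a1 t0 x0 y0; rewrite /heat !normr_gt0 x0 y0/=.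
by rewrite heat_posE ?normr_gt0// heat_kernel_norm.
Qed.

Lemma dunkl_heatE a t x y : -1 < a -> 0 < t -> x != 0 -> y != 0 ->
  dunkl_heat a t x y = 2^-1 * (heat_kernel a t x y + x * y * heat_kernel (a + 1) t x y).
Proof.
move=> a1 t0 x0 y0; rewrite /dunkl_heat !heatE//.
by rewrite (lt_trans a1)// ltrDl.
Qed.

Lemma heat_kernel_constE a t : 0 < t ->
  (2 * t)^-1 * (4 * t) `^ (- a) * bessel_coeff a 0 = heat_const a * t `^ (- (a + 1)).
Proof.
move=> t0; rewrite /heat_const powRM ?ltW// (opprD a 1) (powRD_gt0 _ _ t0) (powR_inv1 (ltW t0)).
by field; rewrite gt_eqF.
Qed.

(** The terms of the series are nonnegative; keep the first one. *)
Lemma heat_kernel_ge a t x y : -1 < a -> 0 < t ->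
  heat_const a * t `^ (- (a + 1)) * expR (- ((x ^+ 2 + y ^+ 2) / (4 * t))) <=
  heat_kernel a t x y.
Proof.
move=> a1 t0; rewrite -heat_kernel_constE// /heat_kernel mulrAC ler_wpM2l//.
  by rewrite !mulr_ge0 ?invr_ge0 ?mulr_ge0 ?powR_ge0 ?expR_ge0// ltW.
exact: bessel_series_ge_coeff0.
Qed.

(** The growth [expR (`|x * y| / (2 * t))] of the series is absorbed by the Gaussian factor,
    which leaves [expR (- ((`|x| - `|y|) ^+ 2 / (4 * t))) <= 1]. *)
Lemma heat_kernel_le a t x y : - 2^-1 <= a -> 0 < t ->
  heat_kernel a t x y <= heat_const a * t `^ (- (a + 1)).
Proof.
move=> a2 t0; rewrite -heat_kernel_constE// /heat_kernel.
have t40 : 0 < 4 * t by rewrite mulr_gt0.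
set w := x * y / (4 * t); rewrite -!mulrA.
apply: ler_wpM2l; first by rewrite invr_ge0 mulr_ge0// ltW.
apply: ler_wpM2l; first exact: powR_ge0.
apply: (le_trans (ler_wpM2l (expR_ge0 _) (bessel_series_le_exp w a2))).
rewrite mulrCA -expRD ler_piMr//.
  by apply: bessel_coeff_ge0; apply: lt_le_trans a2; lra.
rewrite expR_le1 /w normrM normfV (gtr0_norm t40) addrC subr_le0.
rewrite mulrA ler_pM2r ?invr_gt0// normrM -subr_ge0.
rewrite -(real_normK (num_real x)) -(real_normK (num_real y)).
rewrite (_ : _ - _ = (`|x| - `|y|) ^+ 2) ?sqr_ge0//; ring.
Qed.

Lemma heat_kernel_odd_le a t x y : -1 < a -> 0 < t ->
  `|x * y * heat_kernel (a + 1) t x y| <= (1 + (a + 1)^-1) * heat_kernel a t x y.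
Proof.
move=> a1 t0; have a1' : -1 < a + 1 by rewrite (lt_trans a1)// ltrDl.
have t40 : 0 < 4 * t by rewrite mulr_gt0.
have := bessel_series_odd_le (x * y / (4 * t)) a1.
rewrite [`|x * y * _|]normrM (ger0_norm (heat_kernel_ge0 _ _ a1' t0)) /heat_kernel.
rewrite (opprD a 1) (powRD_gt0 _ _ t40) (powR_inv1 (ltW t40)).
set w := x * y / (4 * t) => H.
have -> : `|x * y| = `|w| * (4 * t).
  by rewrite /w [in RHS]normrM normfV (gtr0_norm t40) divfK// gt_eqF.
set e := expR _; set c := (4 * t) `^ (- a).
rewrite [leLHS](_ : _ = (2 * t)^-1 * c * e * (`|w| * bessel_series (a + 1) w)); last first.
  by field; rewrite gt_eqF.
rewrite [leRHS]mulrCA ler_wpM2l//.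
by rewrite !mulr_ge0 ?invr_ge0 ?mulr_ge0 ?powR_ge0 ?expR_ge0// ltW.
Qed.

Lemma dunkl_heat_le a t x y : -1 < a -> 0 < t -> x != 0 -> y != 0 ->
  `|dunkl_heat a t x y| <= (1 + (a + 1)^-1) * heat_kernel a t x y.
Proof.
move=> a1 t0 x0 y0; rewrite dunkl_heatE// normrM gtr0_norm ?invr_gt0//.
have h0 := heat_kernel_ge0 x y a1 t0.
have := heat_kernel_odd_le x y a1 t0.
have := ler_normD (heat_kernel a t x y) (x * y * heat_kernel (a + 1) t x y).
rewrite (ger0_norm h0).
have c0 : 0 < (a + 1)^-1 by rewrite invr_gt0 -ltrBlDr sub0r.
have : 0 <= (a + 1)^-1 * heat_kernel a t x y by rewrite mulr_ge0// ltW.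
rewrite mulrDl mul1r; lra.
Qed.

(** On the open quadrant the odd part is nonnegative too. *)
Lemma dunkl_heat_ge a t x y : -1 < a -> 0 < t -> 0 < x -> 0 < y ->
  2^-1 * heat_kernel a t x y <= dunkl_heat a t x y.
Proof.
move=> a1 t0 x0 y0; have a1' : -1 < a + 1 by rewrite (lt_trans a1)// ltrDl.
rewrite dunkl_heatE ?gt_eqF// ler_pM2l ?invr_gt0// lerDl.
by apply: mulr_ge0; [apply: mulr_ge0; exact: ltW|exact: heat_kernel_ge0].
Qed.

Lemma heat_kernel_rec a t x y : -1 < a -> 0 < t ->
  heat_kernel a t x y = 4 * t * (a + 1) * heat_kernel (a + 1) t x y +
    x ^+ 2 * y ^+ 2 * heat_kernel (a + 2) t x y.
Proof.
move=> a1 t0; have t40 : 0 < 4 * t by rewrite mulr_gt0.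
rewrite /heat_kernel (bessel_series_rec _ a1) (opprD a 1) (opprD a 2) !(powRD_gt0 _ _ t40).
have e2 : (4 * t) `^ (- 2) = ((4 * t) ^+ 2)^-1 by exact: (powR_invn 2 (ltW t40)).
rewrite e2 (powR_inv1 (ltW t40)).
move: (bessel_series _ _) (bessel_series _ _) (expR _) ((4 * t) `^ _) => B1 B2 e c.
by field; rewrite gt_eqF.
Qed.

Lemma measurable_inv (D : set (measurableTypeR R)) :
  measurable_fun D (fun x : measurableTypeR R => x^-1).
Proof.
rewrite (_ : (fun _ => _) = (fun x => x * (x ^+ 2) `^ (-1))).
  apply: measurable_funM => //.
  apply: (measurableT_comp (measurable_powR _)).
  exact: measurable_funX.
apply/funext => x; rewrite powR_inv1 ?sqr_ge0//.
have [->|x0] := eqVneq x 0; first by rewrite invr0 mul0r.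
by field.
Qed.

Lemma measurable_heat_kernel d (T : measurableType d) (f g h : T -> R) a : -1 < a ->
  measurable_fun setT f -> measurable_fun setT g -> measurable_fun setT h ->
  measurable_fun setT (fun z => heat_kernel a (f z) (g z) (h z)).
Proof.
move=> a1 mf mg mh.
have m4 : measurable_fun setT (fun z => 4 * f z) by exact: measurable_funM.
have m4i : measurable_fun setT (fun z => (4 * f z)^-1).
  exact: (measurableT_comp (@measurable_inv setT)).
apply: measurable_funM; last first.
  apply: (measurableT_comp (measurable_bessel_series a1)).
  by apply: measurable_funM => //; exact: measurable_funM.
apply: measurable_funM; last first.
  apply: (measurableT_comp (@measurable_expR R)); apply: measurable_funN.
  by apply: measurable_funM => //; apply: measurable_funD; exact: measurable_funX.
apply: measurable_funM.
  by apply: (measurableT_comp (@measurable_inv setT)); exact: measurable_funM.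
exact: (measurableT_comp (measurable_powR _)).
Qed.

Lemma measurable_heat_kernelr (D : set (measurableTypeR R)) a t x : -1 < a ->
  measurable_fun D (fun y : measurableTypeR R => heat_kernel a t x y).
Proof. by move=> a1; apply: measurable_funTS; exact: measurable_heat_kernel. Qed.

(** Termwise integration: the [k]-th Gaussian moment cancels the Gamma factor of the [k]-th
    coefficient and leaves the exponential series of [x ^+ 2 / (4 * t)]. *)
Lemma heat_kernel_mass a t x : -1 < a -> 0 < t ->
  (\int[leb]_(y in `]0%R, +oo[) (heat_kernel a t x y * y `^ (2 * a + 1))%:E = 1)%E.
Proof.
move=> a1 t0; have t40 : 0 < 4 * t by rewrite mulr_gt0.
pose c := (2 * t)^-1 * (4 * t) `^ (- a) * expR (- (x ^+ 2 / (4 * t))).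
have c0 : 0 <= c by rewrite !mulr_ge0 ?invr_ge0 ?powR_ge0 ?expR_ge0 ?mulr_ge0// ltW.
pose u := x ^+ 2 / (4 * t).
have u0 : 0 <= u by rewrite divr_ge0 ?sqr_ge0// ltW.
pose p (y : measurableTypeR R) := c * (y `^ (2 * a + 1) * expR (- (y ^+ 2 / (4 * t)))).
have p0 y : 0 <= p y.
  by apply: mulr_ge0 => //; rewrite mulr_ge0 ?powR_ge0 ?expR_ge0.
have mp (D : set (measurableTypeR R)) : measurable_fun D p.
  apply: measurable_funTS; apply: measurable_funM => //.
  apply: measurable_funM; first exact: measurable_powR.
  apply: (measurableT_comp (@measurable_expR R)); apply: measurable_funN.
  by apply: measurable_funM => //; exact: measurable_funX.
transitivity (\int[leb]_(y in `]0%R, +oo[)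
    \sum_(k <oo) ((p y)%:E * (bessel_term a (x * y / (4 * t)) k)%:E))%E.
  apply: eq_integral => y _; rewrite nneseriesZl; last first.
    by move=> k _; rewrite lee_fin bessel_term_ge0.
  rewrite -bessel_seriesE// -EFinM; congr EFin; rewrite /p /c /heat_kernel.
  rewrite (mulrDl (x ^+ 2)) opprD expRD.
  move: (bessel_series _ _) (expR _) (expR _) (y `^ _) ((4 * t) `^ _) => *; ring.
rewrite integral_nneseries//; last 2 first.
- move=> k; apply/measurable_EFinP; apply: measurable_funM => //.
  rewrite /bessel_term; apply: measurable_funM; first exact: measurable_cst.
  apply: measurable_funX; apply: measurable_funM; last exact: measurable_cst.
  by apply: measurable_funM; [exact: measurable_cst|exact: measurable_id].
- by move=> k y _; rewrite -EFinM lee_fin mulr_ge0// bessel_term_ge0.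
transitivity (\sum_(k <oo) ((expR (- u))%:E * (exp_coeff u k)%:E))%E.
  apply: eq_eseriesr => k _.
  have ka := kDa1_gt0 k a1.
  pose d := c * bessel_coeff a k * (x / (4 * t)) ^+ (2 * k).
  transitivity (\int[leb]_(y in `]0%R, +oo[)
      (d%:E * (y `^ (2 * (k%:R + a + 1) - 1) * expR (- (y ^+ 2 / (4 * t))))%:E))%E.
    apply: eq_integral => y; rewrite inE/= in_itv/= andbT => y0.
    rewrite -!EFinM; congr EFin; rewrite /p /d /bessel_term.
    rewrite (_ : 2 * (k%:R + a + 1) - 1 = (2 * k)%:R + (2 * a + 1)); last first.
      by rewrite natrM; ring.
    rewrite (powRD_gt0 (2 * k)%:R _ y0) powR_mulrn ?ltW//.
    rewrite (_ : x * y / (4 * t) = x / (4 * t) * y); last by ring.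
    rewrite [(x / (4 * t) * y) ^+ _]exprMn.
    move: (y ^+ _) (y `^ _) (expR _) ((x / _) ^+ _) => *; ring.
  have d0 : 0 <= d.
    apply: mulr_ge0; first by apply: mulr_ge0 => //; exact: bessel_coeff_ge0.
    by rewrite exprM exprn_ge0// sqr_ge0.
  rewrite ge0_integralZl; [|by []| | |by rewrite lee_fin]; last 2 first.
  - apply/measurable_EFinP; apply: measurable_funM; first exact: measurable_powRl.
    apply: measurable_funTS.
    apply: (measurableT_comp (@measurable_expR R)); apply: measurable_funN.
    by apply: measurable_funM => //; exact: measurable_funX.
  - by move=> y _; rewrite lee_fin mulr_ge0 ?powR_ge0 ?expR_ge0.
  rewrite integral_gaussian_moment// -!EFinM; congr EFin.
  rewrite /d /c /bessel_coeff /exp_coeff/= /u -/u.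
  rewrite (_ : k%:R + a + 1 = a + (k.+1)%:R) in ka *; last by rewrite -natr1; ring.
  rewrite (powRD_gt0 _ _ t40) powRN powR_mulrn ?ltW// exprS.
  have G0 := Gamma_gt0 ka.
  rewrite !expr_div_n [(4 * t) ^+ (2 * k)]exprM [x ^+ (2 * k)]exprM.
  rewrite [((4 * t) ^+ 2) ^+ k]exprAC expr2.
  have pa := powR_gt0 a t40.
  have pk : 0 < (4 * t) ^+ k by rewrite exprn_gt0.
  have kf : 0 < k`!%:R :> R by rewrite ltr0n fact_gt0.
  move: (Gamma _) G0 (expR _) ((4 * t) `^ a) pa ((4 * t) ^+ k) pk (k`!%:R) kf ((x ^+ 2) ^+ k).
  move=> G G0 e q q0 r r0 f f0 v; field.
  by rewrite !gt_eqF.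
rewrite nneseriesZl; last by move=> k _; rewrite lee_fin exp_coeff_ge0.
have -> : (\sum_(k <oo) (exp_coeff u k)%:E = (expR u)%:E)%E.
  rewrite /expR -EFin_lim; last exact: is_cvg_series_exp_coeff.
  by congr (limn _); apply/funext => n; rewrite /= sumEFin.
by rewrite -EFinM -expRD addNr expR0.
Qed.

Lemma measurable_heat_kernel_weight (D : set (measurableTypeR R)) a t x b : -1 < a ->
  measurable_fun D (fun y : measurableTypeR R => heat_kernel a t x y * y `^ b).
Proof.
move=> a1; apply: measurable_funM; first exact: measurable_heat_kernelr.
exact: measurable_powRl.
Qed.

(** The recursion trades two powers of [y] for a higher order, so that the second and fourth
    moments reduce to masses of kernels of orders [a + 1] to [a + 4]. *)
Lemma heat_kernel_moment_rec a t x b : -1 < a -> 0 < t ->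
  (\int[leb]_(y in `]0%R, +oo[) (heat_kernel a t x y * y `^ b)%:E =
   (4 * t * (a + 1))%:E *
     \int[leb]_(y in `]0%R, +oo[) (heat_kernel (a + 1) t x y * y `^ b)%:E +
   (x ^+ 2)%:E *
     \int[leb]_(y in `]0%R, +oo[) (heat_kernel (a + 2) t x y * y `^ (b + 2))%:E)%E.
Proof.
move=> a1 t0; have a10 : 0 < a + 1 by rewrite -ltrBlDr sub0r.
have a1' : -1 < a + 1 by rewrite (lt_trans a1)// ltrDl.
have a2' : -1 < a + 2 by rewrite (lt_trans a1)// ltrDl.
have c0 : 0 <= 4 * t * (a + 1) by rewrite !mulr_ge0// ltW.
have m' (c b' : R) : -1 < c -> measurable_fun (`]0%R, +oo[%classic : set (measurableTypeR R))
    (fun y : measurableTypeR R => (heat_kernel c t x y * y `^ b')%:E).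
  by move=> c1; apply/measurable_EFinP; exact: measurable_heat_kernel_weight.
have h0 (c b' y : R) : -1 < c -> (0 <= (heat_kernel c t x y * y `^ b')%:E)%E.
  by move=> c1; rewrite lee_fin mulr_ge0 ?powR_ge0 ?heat_kernel_ge0.
rewrite -ge0_integralZl; [|by []|exact: m'|by move=> y _; exact: h0|by rewrite lee_fin].
rewrite -[X in (_ + X)%E]ge0_integralZl; [|by []|exact: m'|by move=> y _; exact: h0
  |by rewrite lee_fin sqr_ge0].
rewrite -ge0_integralD//; last 4 first.
- by move=> y _; rewrite mule_ge0 ?lee_fin ?h0// mulr_ge0 ?powR_ge0 ?heat_kernel_ge0.
- by apply: measurable_funeM; exact: m'.
- by move=> y _; rewrite mule_ge0 ?lee_fin ?sqr_ge0 ?h0// mulr_ge0 ?powR_ge0 ?heat_kernel_ge0.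
- by apply: measurable_funeM; exact: m'.
apply: eq_integral => y; rewrite inE/= in_itv/= andbT => y0.
rewrite -!EFinM -EFinD; congr EFin.
rewrite (heat_kernel_rec x y a1 t0) (powRD_gt0 _ _ y0) (powR_mulrn 2 (ltW y0)).
by move: (heat_kernel _ _ _ _) (heat_kernel _ _ _ _) (y `^ b) => u v z; ring.
Qed.

Lemma heat_kernel_moment2 a t x : -1 < a -> 0 < t ->
  (\int[leb]_(y in `]0%R, +oo[) (heat_kernel a t x y * y `^ (2 * a + 3))%:E =
   (4 * t * (a + 1) + x ^+ 2)%:E)%E.
Proof.
move=> a1 t0.
have a1' : -1 < a + 1 by rewrite (lt_trans a1)// ltrDl.
have a2' : -1 < a + 2 by rewrite (lt_trans a1)// ltrDl.
rewrite heat_kernel_moment_rec//.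
rewrite (_ : 2 * a + 3 + 2 = 2 * (a + 2) + 1); last by ring.
rewrite (_ : 2 * a + 3 = 2 * (a + 1) + 1); last by ring.
by rewrite !heat_kernel_mass// !mule1 -EFinD.
Qed.

Lemma heat_kernel_moment4 a t x : -1 < a -> 0 < t ->
  (\int[leb]_(y in `]0%R, +oo[) (heat_kernel a t x y * y `^ (2 * a + 5))%:E =
   (4 * t * (a + 1) * (4 * t * (a + 2) + x ^+ 2) +
    x ^+ 2 * (4 * t * (a + 3) + x ^+ 2))%:E)%E.
Proof.
move=> a1 t0.
have a1' : -1 < a + 1 by rewrite (lt_trans a1)// ltrDl.
have a2' : -1 < a + 2 by rewrite (lt_trans a1)// ltrDl.
rewrite heat_kernel_moment_rec//.
rewrite (_ : 2 * a + 5 + 2 = 2 * (a + 2) + 3); last by ring.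
rewrite (_ : 2 * a + 5 = 2 * (a + 1) + 3); last by ring.
rewrite !heat_kernel_moment2// -!EFinM -EFinD; congr EFin.
by ring.
Qed.

(** The terms in [x ^+ 4] cancel: this is what makes the kernel concentrate at [y = x]. *)
Lemma heat_kernel_variance a t x : -1 < a -> 0 < t ->
  (\int[leb]_(y in `]0%R, +oo[)
     ((y ^+ 2 - x ^+ 2) ^+ 2 * (heat_kernel a t x y * y `^ (2 * a + 1)))%:E =
   (8 * t * x ^+ 2 + 16 * t ^+ 2 * (a + 1) * (a + 2))%:E)%E.
Proof.
move=> a1 t0.
set V := (\int[leb]_(y in _) _)%E.
have m' (b' : R) : measurable_fun (`]0%R, +oo[%classic : set (measurableTypeR R))
    (fun y : measurableTypeR R => (heat_kernel a t x y * y `^ b')%:E).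
  by apply/measurable_EFinP; exact: measurable_heat_kernel_weight.
have h0 (b' y : R) : 0 <= heat_kernel a t x y * y `^ b'.
  by rewrite mulr_ge0 ?powR_ge0 ?heat_kernel_ge0.
have x40 : (0 <= (x ^+ 4)%:E)%E by rewrite lee_fin (exprM x 2 2) sqr_ge0.
have x20 : (0 <= (2 * x ^+ 2)%:E)%E by rewrite lee_fin mulr_ge0// sqr_ge0.
have mV : measurable_fun (`]0%R, +oo[%classic : set (measurableTypeR R)) (fun y : measurableTypeR R =>
    ((y ^+ 2 - x ^+ 2) ^+ 2 * (heat_kernel a t x y * y `^ (2 * a + 1)))%:E).
  apply/measurable_EFinP; apply: measurable_funM; last exact: measurable_heat_kernel_weight.
  apply: measurable_funX; apply: measurable_funB; last exact: measurable_cst.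
  exact: measurable_funX.
have E : (V + (2 * x ^+ 2)%:E * (4 * t * (a + 1) + x ^+ 2)%:E =
  (4 * t * (a + 1) * (4 * t * (a + 2) + x ^+ 2) +
    x ^+ 2 * (4 * t * (a + 3) + x ^+ 2))%:E + (x ^+ 4)%:E * 1)%E.
  rewrite -(heat_kernel_mass x a1 t0) -(heat_kernel_moment2 x a1 t0) -(heat_kernel_moment4 x a1 t0) /V.
  rewrite -ge0_integralZl; [|by []|exact: m'|by move=> y _; rewrite lee_fin|by []].
  rewrite -[X in (_ = _ + X)%E]ge0_integralZl; [|by []|exact: m'|by move=> y _; rewrite lee_fin|by []].
  rewrite -ge0_integralD; [|by []| | | |]; last 4 first.
  - by move=> y _; rewrite lee_fin mulr_ge0 ?sqr_ge0.
  - exact: mV.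
  - by move=> y _; rewrite mule_ge0// lee_fin.
  - by apply: measurable_funeM; exact: m'.
  rewrite -ge0_integralD; [|by []| | | |]; last 4 first.
  - by move=> y _; rewrite lee_fin.
  - exact: m'.
  - by move=> y _; rewrite mule_ge0// lee_fin.
  - by apply: measurable_funeM; exact: m'.
  apply: eq_integral => y; rewrite inE/= in_itv/= andbT => y0.
  rewrite -!EFinM -!EFinD; congr EFin.
  rewrite (_ : 2 * a + 5 = 2 * a + 1 + 4%:R); last by ring.
  rewrite (_ : 2 * a + 3 = 2 * a + 1 + 2%:R); last by ring.
  rewrite !(powRD_gt0 (2 * a + 1) _ y0) !powR_mulrn ?ltW//.
  by move: (heat_kernel _ _ _ _) (y `^ _) => u v; ring.
have Vge0 : (0 <= V)%E.
  by apply: integral_ge0 => y _; rewrite lee_fin mulr_ge0 ?sqr_ge0.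
move: V E Vge0 {mV} => [v||]//; rewrite mule1 -EFinM -!EFinD => -[E] _; congr EFin.
move: E => /(congr1 (fun z => z - 2 * x ^+ 2 * (4 * t * (a + 1) + x ^+ 2))).
by rewrite addrK => ->; ring.
Qed.

(** Chebyshev's inequality for the variance: for small times at least half of the mass
    stays within distance [1/4]; the point is that the time does not depend on [x]. *)
Lemma heat_kernel_localization a : -1 < a -> exists2 t0 : R, 0 < t0 &
  forall t x, 0 < t -> t <= t0 -> 1 <= x ->
    ((2^-1)%R%:E <= \int[leb]_(y in `](x - 4^-1)%R, (x + 4^-1)%R[)
      (heat_kernel a t x y * y `^ (2 * a + 1))%:E)%E.
Proof.
move=> a1; have a10 : 0 < a + 1 by rewrite -ltrBlDr sub0r.
have a20 : 0 < a + 2 by rewrite (lt_trans a10)// ltrD2l ltr1n.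
pose s := (a + 1) * (a + 2); have s0 : 0 < s by rewrite mulr_gt0.
have h512 : 0 < 512 :> R by rewrite ltr0n.
have d0 : 0 < 512 * (1 + s) by apply: mulr_gt0; [exact: h512|exact: addr_gt0].
(* By Chebyshev the mass lost is at most [128 * t + 256 * t ^+ 2 * s] when [x >= 1]. *)
exists (512 * (1 + s))^-1 => [|t x t0 tt x1]; first by rewrite invr_gt0.
have x0 : 0 < x by rewrite (lt_le_trans _ x1).
have ts : 512 * t * (1 + s) <= 1.
  by move: tt; rewrite -(ler_pM2l d0) (mulfV (lt0r_neq0 d0)) mulrAC.
pose K (y : measurableTypeR R) := heat_kernel a t x y * y `^ (2 * a + 1).
have K0 y : 0 <= K y by rewrite /K mulr_ge0 ?powR_ge0 ?heat_kernel_ge0.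
have mK (D : set (measurableTypeR R)) : measurable_fun D K by exact: measurable_heat_kernel_weight.
pose b (y : measurableTypeR R) := (x - 4^-1 < y) && (y < x + 4^-1).
have -> : (\int[leb]_(y in `](x - 4^-1)%R, (x + 4^-1)%R[) (K y)%:E =
    \int[leb]_(y in `]0%R, +oo[) (if b y then K y else 0)%:E)%E.
  rewrite [LHS]integral_mkcond [RHS]integral_mkcond; apply: eq_integral => y _.
  rewrite !patchE /b; case: ifPn => [|/negP].
    rewrite inE/= in_itv/= => /andP[h1 h2]; rewrite h1 h2 mem_set//= in_itv/= andbT.
    by rewrite (le_lt_trans _ h1)// subr_ge0 (le_trans _ x1)// invf_le1// ler1n.
  rewrite inE/= in_itv/= => /negP/negbTE ->.
  by case: ifPn.
set I := (\int[leb]_(y in _) _)%E.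
have mV : measurable_fun (`]0%R, +oo[%classic : set (measurableTypeR R)) (fun y : measurableTypeR R =>
    ((y ^+ 2 - x ^+ 2) ^+ 2 * K y)%:E).
  apply/measurable_EFinP; apply: measurable_funM => //.
  apply: measurable_funX; apply: measurable_funB; last exact: measurable_cst.
  exact: measurable_funX.
have mI : measurable_fun (`]0%R, +oo[%classic : set (measurableTypeR R)) (fun y : measurableTypeR R => (if b y then K y else 0)%:E).
  apply/measurable_EFinP; apply: measurable_funTS; apply: measurable_fun_ifT => //.
  by apply: measurable_and; apply: measurable_fun_ltr.
(* If [`|y - x| >= 1 / 4] then [(y ^+ 2 - x ^+ 2) ^+ 2 >= x ^+ 2 / 16]. *)
have H : (1 <= I + (16 / x ^+ 2)%:E * (8 * t * x ^+ 2 + 16 * t ^+ 2 * (a + 1) * (a + 2))%:E)%E.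
  have c0 : 0 <= 16 / x ^+ 2 by rewrite divr_ge0// sqr_ge0.
  rewrite -[X in (X <= _)%E](heat_kernel_mass x a1 t0) -heat_kernel_variance// /I.
  rewrite -ge0_integralZl; [|by []|exact: mV| |by rewrite lee_fin]; last first.
    by move=> y _; rewrite lee_fin; apply: mulr_ge0; [exact: sqr_ge0|exact: K0].
  rewrite -ge0_integralD; [|by []| | | |]; last 4 first.
  - by move=> y _; rewrite lee_fin; case: ifP => // _; exact: K0.
  - exact: mI.
  - move=> y _; apply: mule_ge0; first by rewrite lee_fin.
    by rewrite lee_fin; apply: mulr_ge0; [exact: sqr_ge0|exact: K0].
  - by apply: measurable_funeM; exact: mV.
  apply: le_integral_nonneg => y; first by move=> _; rewrite lee_fin; exact: K0.
  rewrite /= in_itv/= andbT => y0; rewrite -EFinM -EFinD lee_fin -/(K y).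
  case: ifPn => [_|nb]; first by rewrite lerDl mulr_ge0// mulr_ge0 ?sqr_ge0 ?K0.
  rewrite add0r mulrA ler_peMl// mulrAC ler_pdivlMr ?exprn_gt0// mul1r.
  have e : (y ^+ 2 - x ^+ 2) ^+ 2 = ((y - x) ^+ 2) * (y + x) ^+ 2 by ring.
  rewrite e mulrA -[leLHS]mul1r ler_pM ?sqr_ge0//; last first.
    by rewrite ler_pXn2r// ?nnegrE ?lerDr ?addr_ge0 // ltW.
  have -> : 16 * (y - x) ^+ 2 = (4 * `|y - x|) ^+ 2.
    by rewrite exprMn real_normK ?num_real//; ring.
  rewrite -[leLHS](expr1n _ 2) ler_pXn2r ?nnegrE ?mulr_ge0//.
  rewrite -ler_pdivrMl// mulr1; move: nb; rewrite /b -ltr_distl.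
  by rewrite -leNgt distrC.
have small : 16 / x ^+ 2 * (8 * t * x ^+ 2 + 16 * t ^+ 2 * (a + 1) * (a + 2)) <= 2^-1.
  have -> : 16 / x ^+ 2 * (8 * t * x ^+ 2 + 16 * t ^+ 2 * (a + 1) * (a + 2)) =
      128 * t + 256 * t ^+ 2 * s * (x ^+ 2)^-1 by rewrite /s; field; rewrite gt_eqF.
  have t2 : 256 * t ^+ 2 * s * (x ^+ 2)^-1 <= 256 * t ^+ 2 * s.
    apply: ler_piMr; last by rewrite invf_le1 ?exprn_gt0// exprn_ege1.
    by apply: mulr_ge0; [apply: mulr_ge0; [rewrite ler0n|exact: sqr_ge0]|exact: ltW].
  have ts0 : 0 < t * s by rewrite mulr_gt0.
  have t1 : 512 * t <= 1.
    apply: le_trans ts; apply: ler_peMr; last by rewrite lerDl ltW.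
    by apply: mulr_ge0; [exact: ltW|exact: ltW].
  have t4 : 512 * (t * s) <= 1.
    apply: le_trans ts; rewrite mulrDr mulr1 mulrA lerDr.
    by apply: mulr_ge0; exact: ltW.
  have t3 : 256 * t ^+ 2 * s <= t / 2.
    rewrite [leLHS](_ : _ = t / 2 * (512 * (t * s))); last by field.
    by apply: ler_piMr => //; rewrite divr_ge0// ltW.
  move: (_ * (x ^+ 2)^-1) t2 => w2 t2; move: (256 * t ^+ 2 * s) t2 t3 => w1 t2 t3.
  by clear -t1 t0 t2 t3; lra.
move: H; rewrite -EFinM; case: I => [i||]; rewrite ?leey//.
- rewrite -EFinD !lee_fin => H; move: small H; move: (16 / _ * _) => z; lra.
Qed.

End heat_kernel.

(** * Tonelli's theorem and the layer cake formula *)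

Lemma measurable_partial1 d1 d2 d3 (T1 : measurableType d1) (T2 : measurableType d2)
    (T3 : measurableType d3) (f : T1 * T2 -> T3) x :
  measurable_fun [set: T1 * T2] f -> measurable_fun [set: T2] (fun y => f (x, y)).
Proof. by move=> mf; apply: (measurableT_comp mf); exact: measurable_pair1. Qed.

Lemma measurable_partial2 d1 d2 d3 (T1 : measurableType d1) (T2 : measurableType d2)
    (T3 : measurableType d3) (f : T1 * T2 -> T3) y :
  measurable_fun [set: T1 * T2] f -> measurable_fun [set: T1] (fun x => f (x, y)).
Proof. by move=> mf; apply: (measurableT_comp mf); exact: measurable_pair2. Qed.

Section parametric_integral.
Context {d1 d2} {T1 : measurableType d1} {T2 : measurableType d2} {R : realType}.
Variables (m1 : {sigma_finite_measure set T1 -> \bar R}).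
Variables (m2 : {sigma_finite_measure set T2 -> \bar R}).
Variables (D : set T2) (g : T1 * T2 -> \bar R).
Hypotheses (mD : measurable D) (mg : measurable_fun [set: T1 * T2] g).
Hypothesis g0 : forall x y, D y -> (0 <= g (x, y))%E.

Let gD (z : T1 * T2) : \bar R := (if z.2 \in D then g z else 0)%E.

Let mgD : measurable_fun [set: T1 * T2] gD.
Proof.
apply: measurable_fun_ifT => //.
have -> : (fun z : T1 * T2 => z.2 \in D) = (fun y => y \in D) \o snd by [].
apply: measurableT_comp; last exact: measurable_snd.
apply: (@measurable_fun_bool _ _ _ _ true) => //.
by rewrite setTI (_ : _ @^-1` _ = D)//; apply/seteqP; split => y /=; [move/set_mem|move/mem_set].
Qed.

Let gD0 z : (0 <= gD z)%E.
Proof. by rewrite /gD; case: ifPn => // /set_mem; case: z => x y /=; exact: g0. Qed.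

Let gDE x : (\int[m2]_(y in D) g (x, y) = \int[m2]_y gD (x, y))%E.
Proof. by rewrite integral_mkcond; apply: eq_integral => y _; rewrite patchE. Qed.

Lemma measurable_integral_param :
  measurable_fun [set: T1] (fun x => \int[m2]_(y in D) g (x, y))%E.
Proof.
under eq_fun do rewrite gDE.
exact: (@measurable_fun_fubini_tonelli_F _ _ _ _ _ m2 gD mgD gD0).
Qed.

Lemma tonelli_restrict :
  (\int[m1]_x \int[m2]_(y in D) g (x, y) = \int[m2]_(y in D) \int[m1]_x g (x, y))%E.
Proof.
under eq_integral do rewrite gDE.
rewrite (@fubini_tonelli _ _ _ _ _ m1 m2 gD)// [RHS]integral_mkcond.
apply: eq_integral => y _; rewrite patchE /gD/=; case: ifPn => // _.
by rewrite integral0_eq.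
Qed.

End parametric_integral.

Section layer_cake.
Context {d} {X : measurableType d} {R : realType}.
Variable mu : {sigma_finite_measure set X -> \bar R}.
Implicit Types (F : X -> \bar R) (f : X -> R) (p q l : R).
Local Notation leb := (@lebesgue_measure R).
Local Notation halfline := (`]0%R, +oo[%classic : set (measurableTypeR R)).

Lemma poweR_layer q (e : \bar R) : 0 < q -> (0 <= e)%E ->
  (e `^ q = \int[leb]_(l in halfline) (if l%:E < e then (q * l `^ (q - 1))%:E else 0))%E.
Proof.
move=> q0 e0.
have I a : 0 <= a -> (\int[leb]_(l in `]0%R, a[) (q * l `^ (q - 1))%:E = (a `^ q)%:E)%E.
  move=> a0; under eq_integral do rewrite EFinM.
  rewrite ge0_integralZl; [|by []|by apply/measurable_EFinP; exact: measurable_powRl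
    |by move=> l _; rewrite lee_fin powR_ge0|by rewrite lee_fin ltW].
  by rewrite integral_powR_0// -EFinM mulrC divfK// gt_eqF.
move: e e0 => [r r0|_|//].
  rewrite poweR_EFin -I//.
  rewrite [LHS]integral_mkcond [RHS]integral_mkcond; apply: eq_integral => l _.
  rewrite !patchE !mem_setE !in_itv/= andbT lte_fin.
  by case: (0 < l) => //=.
rewrite poweRyr ?gt_eqF//; apply/esym/eqyP => a a0.
have b0 : 0 <= a `^ q^-1 by exact: powR_ge0.
rewrite (_ : a%:E = (\int[leb]_(l in `]0%R, (a `^ q^-1)%R[) (q * l `^ (q - 1))%:E)%E); last first.
  by rewrite I// -powRrM mulVf ?gt_eqF// powRr1// ltW.
apply: le_integral_nonnegS.
- by move=> l; rewrite /= !in_itv/= andbT => /andP[].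
- by move=> l _; rewrite ltry lee_fin mulr_ge0 ?powR_ge0// ltW.
- by move=> l _; rewrite ltry lexx andbT lee_fin mulr_ge0 ?powR_ge0// ltW.
Qed.

Lemma measurable_lt_param F : measurable_fun [set: X] F ->
  measurable_fun [set: X * measurableTypeR R] (fun z => z.2%:E < F z.1)%E.
Proof.
move=> mF; apply: measurable_fun_lte.
  by apply/measurable_EFinP; exact: measurable_snd.
by apply: (measurableT_comp mF); exact: measurable_fst.
Qed.

Lemma measurable_distribution F : measurable_fun [set: X] F ->
  measurable_fun [set: measurableTypeR R] (fun l => mu [set x | l%:E < F x]%E).
Proof.
move=> mF.
pose g (z : X * measurableTypeR R) : \bar R := if (z.2%:E < F z.1)%E then 1%E else 0%E.
have mg : measurable_fun setT g.
  by apply: measurable_fun_ifT => //; exact: measurable_lt_param.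
have g0 z : (0 <= g z)%E by rewrite /g; case: ifP.
have := @measurable_fun_fubini_tonelli_G _ _ _ _ _ mu g mg g0.
congr (measurable_fun _ _); apply/funext => l; rewrite /fubini_G /g/=.
rewrite (@integral_if _ _ _ mu [set x | l%:E < F x]%E (fun x => l%:E < F x)%E (fun=> _))//.
rewrite integral_cst ?mul1e//.
by rewrite -[X in measurable X]setTI; apply: emeasurable_fun_o_infty.
Qed.

Lemma layer_cake F q : 0 < q -> measurable_fun [set: X] F -> (forall x, 0 <= F x)%E ->
  (\int[mu]_x (F x `^ q) =
   \int[leb]_(l in halfline) ((q * l `^ (q - 1))%:E * mu [set x | l%:E < F x]))%E.
Proof.
move=> q0 mF F0.
pose g (z : X * measurableTypeR R) : \bar R :=
  (if z.2%:E < F z.1 then (q * z.2 `^ (q - 1))%:E else 0)%E.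
have mg : measurable_fun setT g.
  apply: measurable_fun_ifT => //; first exact: measurable_lt_param.
  apply/measurable_EFinP; apply: measurable_funM => //.
  by apply: (measurableT_comp (measurable_powR _)); exact: measurable_snd.
have g0 x l : halfline l -> (0 <= g (x, l))%E.
  by move=> _; rewrite /g/=; case: ifP => // _; rewrite lee_fin mulr_ge0 ?powR_ge0// ltW.
transitivity (\int[mu]_x \int[leb]_(l in halfline) g (x, l))%E.
  by apply: eq_integral => x _; rewrite poweR_layer.
rewrite tonelli_restrict//; apply: eq_integral => l _.
rewrite /g/= (@integral_if _ _ _ mu [set x | l%:E < F x]%E (fun x => l%:E < F x)%E (fun=> _))//.
rewrite integral_cst//.
by rewrite -[X in measurable X]setTI; apply: emeasurable_fun_o_infty.
Qed.

(** The interpolation step behind the strong bounds with [p > 1]: the hypothesis is a weak-type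
    estimate that only sees the part of [f] above a height [s l], and integrating it
    against [q * l ^ (q - 1)] with Tonelli's theorem leaves, for each [x], the integral of a
    power of [l] up to the height where [s l = f x], which is a multiple of [f x ^ p]. *)
Lemma distribution_to_strong F f p q (c M : R) : 1 < p -> 0 < q -> 0 < c -> 0 <= M ->
  measurable_fun [set: X] F -> (forall x, 0 <= F x)%E ->
  measurable_fun [set: X] f -> (forall x, 0 <= f x) ->
  (forall l, 0 < l -> (mu [set x | l%:E < F x] <=
    (M / (c * l `^ (q / p)))%:E * \int[mu]_x (if c * l `^ (q / p) < f x then f x else 0)%:E)%E) ->
  (\int[mu]_x (F x `^ q) <= (M * c `^ (- p) * (p / (p - 1)))%:E * \int[mu]_x (f x `^ p)%:E)%E.
Proof.
move=> p1 q0 c0 M0 mF F0 mf f0 wt.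
have p0 : 0 < p by rewrite (lt_trans _ p1).
have p10 : 0 < p - 1 by rewrite subr_gt0.
rewrite layer_cake//.
pose s l := c * l `^ (q / p).
pose psi (z : X * measurableTypeR R) : \bar R :=
  if s z.2 < f z.1 then (q * z.2 `^ (q - 1) * (M / s z.2) * f z.1)%:E else 0%E.
have ms : measurable_fun [set: X * measurableTypeR R] (fun z => s z.2).
  apply: measurable_funM => //.
  by apply: (measurableT_comp (measurable_powR _)); exact: measurable_snd.
have mpsi : measurable_fun setT psi.
  apply: measurable_fun_ifT => //.
    apply: measurable_fun_ltr => //.
    by apply: (measurableT_comp mf); exact: measurable_fst.
  apply/measurable_EFinP; apply: measurable_funM.
    apply: measurable_funM.
      apply: measurable_funM => //.
      by apply: (measurableT_comp (measurable_powR _)); exact: measurable_snd.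
    apply: measurable_funM => //.
    rewrite (_ : (fun _ => _) = (fun z : X * measurableTypeR R => s z.2 `^ (-1))); last first.
      by apply/funext => z; rewrite powR_inv1// mulr_ge0 ?powR_ge0// ltW.
    exact: (measurableT_comp (measurable_powR _)).
  by apply: (measurableT_comp mf); exact: measurable_fst.
have psi0 x l : halfline l -> (0 <= psi (x, l))%E.
  rewrite /psi/= in_itv/= andbT => l0; case: ifP => // _.
  by rewrite lee_fin !mulr_ge0 ?powR_ge0 ?invr_ge0 ?mulr_ge0 ?powR_ge0// ltW.
apply: (@le_trans _ _ (\int[leb]_(l in halfline) \int[mu]_x psi (x, l))%E).
  apply: le_integral_nonneg => l; rewrite /= in_itv/= andbT => l0.
    by rewrite mule_ge0// lee_fin mulr_ge0 ?powR_ge0// ltW.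
  have a0 : (0 <= (q * l `^ (q - 1))%:E)%E by rewrite lee_fin mulr_ge0 ?powR_ge0// ltW.
  apply: (le_trans (lee_wpmul2l a0 (wt l l0))).
  rewrite muleA -EFinM -ge0_integralZl; [|exact: measurableT| | |]; last 3 first.
  - apply/measurable_EFinP; apply: measurable_fun_ifT => //.
    by apply: measurable_fun_ltr.
  - by move=> x _; rewrite lee_fin; case: ifP.
  - by rewrite lee_fin !mulr_ge0 ?powR_ge0 ?invr_ge0 ?mulr_ge0 ?powR_ge0// ltW.
  rewrite le_eqVlt; apply/orP; left; apply/eqP.
  apply: eq_integral => x _; rewrite /psi/= -/(s l).
  by case: ifP => _; rewrite -EFinM// mulr0.
rewrite -tonelli_restrict// -ge0_integralZl; [|exact: measurableT| | |]; last 3 first.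
- by apply/measurable_EFinP; exact: (measurableT_comp (measurable_powR _)).
- by move=> x _; rewrite lee_fin powR_ge0.
- by rewrite lee_fin !mulr_ge0 ?powR_ge0 ?invr_ge0// ltW.
apply: le_integral_nonneg => x _; first by apply: integral_ge0 => l; exact: psi0.
have [fx0|fx0] := leP (f x) 0.
  rewrite integral0_eq.
    by rewrite -EFinM lee_fin !mulr_ge0 ?powR_ge0 ?invr_ge0// ltW.
  move=> l /=; rewrite in_itv/= andbT => l0; rewrite /psi/=.
  by rewrite ltNge (le_trans fx0)//= /s mulr_ge0 ?powR_ge0// ltW.
pose b := (f x / c) `^ (p / q).
have fc0 : 0 < f x / c by rewrite divr_gt0.
have E : (\int[leb]_(l in halfline) psi (x, l) =
    \int[leb]_(l in `]0%R, b[) ((q * (M / c) * f x)%:E * (l `^ (q - q / p - 1))%:E))%E.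
  rewrite [LHS]integral_mkcond [RHS]integral_mkcond; apply: eq_integral => l _.
  rewrite !patchE !mem_setE !in_itv/= andbT /psi/=.
  have [l0|l0] := ltP 0 l => //=.
  have -> : (s l < f x) = (l < b).
    rewrite /s mulrC -ltr_pdivlMr// /b; apply/idP/idP => h.
      have pq : 0 < p / q by rewrite divr_gt0.
      have := gt0_ltr_powR pq (powR_ge0 _ _) (ltW fc0) h.
      by rewrite -powRrM (_ : q / p * (p / q) = 1) ?powRr1 ?ltW//; field; rewrite !gt_eqF.
    have qp : 0 < q / p by rewrite divr_gt0.
    have := gt0_ltr_powR qp (ltW l0) (powR_ge0 _ _) h.
    by rewrite -powRrM (_ : p / q * (q / p) = 1) ?powRr1 ?ltW//; field; rewrite !gt_eqF.
  case: ifP => // _; rewrite -EFinM; congr EFin; rewrite /s.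
  rewrite (_ : q - q / p - 1 = (q - 1) + (- (q / p))); last by ring.
  by rewrite (powRD_gt0 (q - 1) _ l0) powRN; field; rewrite !gt_eqF// powR_gt0.
have qqp : q - q / p = q * ((p - 1) / p) by field; rewrite gt_eqF.
have qqp0 : 0 < q - q / p by rewrite qqp !mulr_gt0 ?invr_gt0.
rewrite E ge0_integralZl; [|by []|by apply/measurable_EFinP; exact: measurable_powRl
    |by move=> l _; rewrite lee_fin powR_ge0
    |by rewrite lee_fin !mulr_ge0 ?invr_ge0// ltW].
rewrite integral_powR_0 ?powR_ge0// -!EFinM lee_fin le_eqVlt; apply/orP; left; apply/eqP.
rewrite /b -powRrM (_ : p / q * (q - q / p) = p - 1); last by field; rewrite !gt_eqF.
have cE : c `^ (- p) = c^-1 * c^-1 `^ (p - 1).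
  by rewrite mulr_powRB1 ?invr_ge0 ?ltW// -(powR_inv1 (ltW c0)) -powRrM mulN1r.
rewrite cE -[f x `^ p]mulr_powRB1 ?(ltW fx0)// powRM ?(ltW fx0) ?invr_ge0 ?(ltW c0)// qqp.
by field; rewrite !gt_eqF.
Qed.

End layer_cake.

(** * The power measure *)

Section density.
Context {R : realType} (alpha : R).
Local Notation w x := (`|x| `^ (2 * alpha + 1)).
Local Notation leb := (@lebesgue_measure R).

Lemma measurable_density : measurable_fun [set: measurableTypeR R]
  (fun x : measurableTypeR R => w x).
Proof. exact: (measurableT_comp (measurable_powR _)). Qed.

Lemma dw_set1 a : dw alpha [set a] = 0%E.
Proof. by rewrite /dw/= integral_set1. Qed.

(** Off the origin the density is bounded on bounded annuli, and the origin is null. *)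
Lemma sigma_finite_dw : sigma_finite [set: measurableTypeR R] (dw alpha).
Proof.
pose B n : set (measurableTypeR R) := [set x | n.+1%:R^-1 <= `|x| <= n.+1%:R].
pose A n : set (measurableTypeR R) := [set 0] `|` B n.
have mB n : measurable (B n).
  rewrite (_ : B n =
     (fun x : measurableTypeR R => `|x|) @^-1` `[n.+1%:R^-1, n.+1%:R]%classic).
    rewrite -[X in measurable X]setTI.
    have mn : measurable_fun [set: measurableTypeR R] (@Num.norm _ R : measurableTypeR R -> measurableTypeR R) by [].
    exact: mn.
  by apply/seteqP; split => x /=; rewrite in_itv.
exists A.
  apply/esym; rewrite -subTset => x _.
  have [->|x0] := eqVneq x 0; first by exists 0%N => //; left.
  have x1 : 0 < `|x| by rewrite normr_gt0.
  pose m := maxn (Num.truncn `|x|) (Num.truncn `|x|^-1); exists m => //; right; rewrite /B /=.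
  have h1 : `|x| <= m.+1%:R.
    by rewrite (le_trans (ltW (truncnS_gt _)))// ler_nat ltnS leq_maxl.
  have h2 : `|x|^-1 <= m.+1%:R.
    by rewrite (le_trans (ltW (truncnS_gt _)))// ler_nat ltnS leq_maxr.
  by rewrite h1 andbT -[leRHS]invrK lef_pV2// ?posrE ?invr_gt0.
move=> n; split; first exact: measurableU.
apply: (@le_lt_trans _ _ (dw alpha [set 0%R] + dw alpha (B n))%E).
  exact: measureU2.
rewrite dw_set1 add0e /dw/=.
apply: (@le_lt_trans _ _ (\int[leb]_(x in B n)
   (n.+1%:R `^ `|2 * alpha + 1|)%:E)%E).
  apply: le_integral_nonneg => x; first by rewrite lee_fin powR_ge0.
  move=> /= /andP[h1 h2]; rewrite lee_fin.
  have x1 : 0 < `|x| by rewrite (lt_le_trans _ h1).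
  have [a0|a0] := leP 0 (2 * alpha + 1).
    by rewrite (ger0_norm a0); apply: ge0_ler_powR; rewrite // nnegrE.
  have -> : `|x| `^ (2 * alpha + 1) = `|x|^-1 `^ (- (2 * alpha + 1)).
    by rewrite -powR_inv1// -powRrM mulN1r opprK.
  rewrite (ltr0_norm a0); apply: ge0_ler_powR.
  - by rewrite oppr_ge0 ltW.
  - by rewrite nnegrE invr_ge0.
  - by rewrite nnegrE.
  - by rewrite -[leRHS]invrK lef_pV2// posrE invr_gt0.
rewrite integral_cst//=; apply: lte_mul_pinfty; [by rewrite lee_fin powR_ge0|by []|].
apply: (@le_lt_trans _ _ (leb `[- n.+1%:R, n.+1%:R]%classic)).
  apply: le_measure; [by rewrite inE; exact: mB|by rewrite inE|].
  by move=> x /= /andP[_]; rewrite ler_norml in_itv.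
by rewrite lebesgue_measure_itv/=; case: ifPn => // _; rewrite -EFinB ltry.
Qed.

HB.instance Definition _ := @Measure_isSigmaFinite.Build _ _ _ (dw alpha) sigma_finite_dw.

(** Comparing the layer cake formulas of both sides reduces the identity to superlevel sets,
    where it defines the measure. *)
Lemma integral_dw (f : measurableTypeR R -> \bar R) (E : set (measurableTypeR R)) :
  measurable E -> measurable_fun E f -> (forall x, E x -> (0 <= f x)%E) ->
  (\int[dw alpha]_(x in E) f x = \int[leb]_(x in E) (f x * (w x)%:E))%E.
Proof.
move=> mE mf f0; rewrite [LHS]integral_mkcond [RHS]integral_mkcond.
set F := f \_ E.
have mF : measurable_fun [set: measurableTypeR R] F by apply/(measurable_restrictT _ _).1.
have F0 x : (0 <= F x)%E by exact: erestrict_ge0.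
transitivity (\int[dw alpha]_x (F x `^ 1))%E.
  by apply: eq_integral => x _; rewrite poweRe1.
rewrite layer_cake//.
pose g (z : measurableTypeR R * measurableTypeR R) : \bar R :=
  (if z.2%:E < F z.1 then (w z.1)%:E else 0)%E.
have mg : measurable_fun setT g.
  apply: measurable_fun_ifT => //; first exact: measurable_lt_param.
  by apply/measurable_EFinP; apply: (measurableT_comp measurable_density); exact: measurable_fst.
have g0 x l : (0 <= g (x, l))%E by rewrite /g/=; case: ifP => // _; rewrite lee_fin powR_ge0.
transitivity (\int[leb]_x \int[leb]_(l in `]0%R, +oo[) g (x, l))%E; last first.
  apply: eq_integral => x _.
  transitivity (F x * (w x)%:E)%E; last first.
    by rewrite /F !patchE; case: ifPn => // _; rewrite mul0e.
  rewrite -[F x](@poweRe1 R) ?F0// poweR_layer// muleC -ge0_integralZl//.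
  - apply: eq_integral => l _; rewrite /g/=; case: ifP => _; last by rewrite mule0.
    by rewrite subrr powRr0 mulr1 mule1.
  - apply: measurable_funTS; apply: measurable_fun_ifT => //.
      exact: (measurable_partial1 x (measurable_lt_param mF)).
    by apply/measurable_EFinP; apply: measurable_funM => //; exact: measurable_powRl.
  - by move=> l _; case: ifP => // _; rewrite lee_fin mul1r powR_ge0.
rewrite tonelli_restrict//; apply: eq_integral => l _.
rewrite subrr powRr0 mulr1 mul1e /g/=.
by rewrite (@integral_if _ _ _ leb [set x | l%:E < F x]%E (fun x => l%:E < F x)%E).
Qed.

End density.

(** * Integral operators with nonnegative kernels *)

Section kernel_operator.
Context {d} {X : measurableType d} {R : realType}.
Variable mu : {sigma_finite_measure set X -> \bar R}.
Implicit Types (k : X * X -> \bar R) (f g : X -> R) (p q l A : R).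

Definition kernel_op k f (x : X) : \bar R := (\int[mu]_y (k (x, y) * (f y)%:E))%E.

Section one_kernel.
Variables (k : X * X -> \bar R) (f : X -> R).
Hypotheses (mk : measurable_fun [set: X * X] k) (k0 : forall z, (0 <= k z)%E).
Hypotheses (mf : measurable_fun [set: X] f) (f0 : forall x, 0 <= f x).

Let mkf : measurable_fun [set: X * X] (fun z => k z * (f z.2)%:E)%E.
Proof.
apply: emeasurable_funM => //; apply/measurable_EFinP.
by apply: (measurableT_comp mf); exact: measurable_snd.
Qed.

Let kf0 z : (0 <= k z * (f z.2)%:E)%E.
Proof. by rewrite mule_ge0// lee_fin. Qed.

Lemma measurable_section x : measurable_fun [set: X] (fun y => k (x, y)).
Proof. exact: measurable_partial1. Qed.

Lemma measurable_section_mul x : measurable_fun [set: X] (fun y => k (x, y) * (f y)%:E)%E.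
Proof.
apply: emeasurable_funM; first exact: measurable_section.
exact/measurable_EFinP.
Qed.

Lemma kernel_op_ge0 x : (0 <= kernel_op k f x)%E.
Proof. by apply: integral_ge0 => y _; exact: (kf0 (x, y)). Qed.

Lemma measurable_kernel_op : measurable_fun [set: X] (kernel_op k f).
Proof. exact: (@measurable_fun_fubini_tonelli_F _ _ _ _ _ mu _ mkf kf0). Qed.

Lemma kernel_op_L1 A : 0 <= A ->
  (forall y, \int[mu]_x k (x, y) <= A%:E)%E ->
  (\int[mu]_x kernel_op k f x <= A%:E * \int[mu]_x (f x)%:E)%E.
Proof.
move=> A0 kA; rewrite /kernel_op.
rewrite (@fubini_tonelli _ _ _ _ _ mu mu (fun z => k z * (f z.2)%:E)%E mkf kf0)/=.
have mfE : measurable_fun [set: X] (fun x => (f x)%:E) by exact/measurable_EFinP.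
rewrite -ge0_integralZl; [|exact: measurableT|exact: mfE|by move=> x _; rewrite lee_fin
  |by rewrite lee_fin].
apply: le_integral_nonneg => y _; first by apply: integral_ge0 => x _; exact: (kf0 (x, y)).
rewrite ge0_integralZr; [|exact: measurableT| |by []|by rewrite lee_fin]; last first.
  exact: measurable_partial2.
by rewrite lee_wpmul2r// lee_fin.
Qed.

Lemma kernel_op_Linfty A (s : R) x : 0 <= s ->
  (forall y, f y <= s) -> (\int[mu]_y k (x, y) <= A%:E)%E ->
  (kernel_op k f x <= (A * s)%:E)%E.
Proof.
move=> s0 fs kA; rewrite EFinM.
apply: (@le_trans _ _ (\int[mu]_y (k (x, y) * s%:E))%E).
  apply: le_integral_nonneg => y _; first exact: (kf0 (x, y)).
  by rewrite lee_wpmul2l// lee_fin.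
rewrite ge0_integralZr; [|exact: measurableT|exact: measurable_section|by []|by rewrite lee_fin].
by rewrite lee_wpmul2r// lee_fin.
Qed.

End one_kernel.

Lemma kernel_op_le k k1 k2 f x :
  measurable_fun [set: X * X] k1 -> measurable_fun [set: X * X] k2 ->
  measurable_fun [set: X] f ->
  (forall z, 0 <= k z)%E -> (forall z, 0 <= k1 z)%E -> (forall z, 0 <= k2 z)%E ->
  (forall x, 0 <= f x) -> (forall z, k z <= k1 z + k2 z)%E ->
  (kernel_op k f x <= kernel_op k1 f x + kernel_op k2 f x)%E.
Proof.
move=> mk1 mk2 mf k0 k10 k20 f0 kk; rewrite /kernel_op -ge0_integralD//; last 4 first.
- by move=> y _; rewrite mule_ge0// lee_fin.
- exact: measurable_section_mul.
- by move=> y _; rewrite mule_ge0// lee_fin.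
- exact: measurable_section_mul.
apply: le_integral_nonneg => y _; first by rewrite mule_ge0// lee_fin.
by rewrite -ge0_muleDl// lee_wpmul2r// lee_fin.
Qed.

Lemma kernel_op_addr k f g x : measurable_fun [set: X * X] k ->
  measurable_fun [set: X] f -> measurable_fun [set: X] g -> (forall z, 0 <= k z)%E ->
  (forall x, 0 <= f x) -> (forall x, 0 <= g x) ->
  (kernel_op k (fun y => f y + g y)%R x = kernel_op k f x + kernel_op k g x)%E.
Proof.
move=> mk mf mg k0 f0 g0; rewrite /kernel_op -ge0_integralD//; last 4 first.
- by move=> y _; rewrite mule_ge0// lee_fin.
- exact: measurable_section_mul.
- by move=> y _; rewrite mule_ge0// lee_fin.
- exact: measurable_section_mul.
by apply: eq_integral => y _; rewrite EFinD ge0_muleDr// lee_fin.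
Qed.

Lemma kernel_op_scale k f (c : R) x : measurable_fun [set: X * X] k ->
  measurable_fun [set: X] f -> (forall z, 0 <= k z)%E -> (forall x, 0 <= f x) -> 0 <= c ->
  (kernel_op k (fun y => c * f y)%R x = c%:E * kernel_op k f x)%E.
Proof.
move=> mk mf k0 f0 c0; rewrite /kernel_op -ge0_integralZl; [|exact: measurableT| | |].
- by apply: eq_integral => y _; rewrite EFinM muleCA.
- exact: measurable_section_mul.
- by move=> y _; rewrite mule_ge0// lee_fin.
- by rewrite lee_fin.
Qed.

(** Where the operator exceeds [l], a third of [l] must come from [k1] acting on the part of
    [f] above [s = l / (3 * A)]: that operator maps [f <= s] to values at most [A * s], and [k2]
    contributes at most [l / 3]. Markov's inequality finishes. *)
Lemma kernel_op_weak k k1 k2 f l A :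
  measurable_fun [set: X * X] k -> measurable_fun [set: X * X] k1 ->
  measurable_fun [set: X * X] k2 -> measurable_fun [set: X] f ->
  (forall z, 0 <= k z)%E -> (forall z, 0 <= k1 z)%E -> (forall z, 0 <= k2 z)%E ->
  (forall x, 0 <= f x) -> (forall z, k z <= k1 z + k2 z)%E -> 0 < A -> 0 < l ->
  (forall x, \int[mu]_y k1 (x, y) <= A%:E)%E ->
  (forall y, \int[mu]_x k1 (x, y) <= A%:E)%E ->
  (forall x, kernel_op k2 f x <= (l / 3)%:E)%E ->
  (mu [set x | l%:E < kernel_op k f x] <=
    (1 / (l / (3 * A)))%:E * \int[mu]_x (if (l / (3 * A) < f x)%R then f x else 0)%:E)%E.
Proof.
move=> mk mk1 mk2 mf k0 k10 k20 f0 kk A0 l0 A1 A2 T2.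
pose s := l / (3 * A); rewrite -/s.
have s0 : 0 < s by rewrite divr_gt0// mulr_gt0.
pose g x := if s < f x then f x else 0.
pose h x := if s < f x then 0 else f x.
have mg : measurable_fun [set: X] g.
  by apply: measurable_fun_ifT => //; exact: measurable_fun_ltr.
have mh : measurable_fun [set: X] h.
  by apply: measurable_fun_ifT => //; exact: measurable_fun_ltr.
have g0 x : 0 <= g x by rewrite /g; case: ifP.
have h0 x : 0 <= h x by rewrite /h; case: ifP.
have hs x : h x <= s by rewrite /h; case: ifPn => [_|]; [exact: ltW|rewrite -leNgt].
have fgh : f = (fun x => g x + h x).
  by apply/funext => x; rewrite /g /h; case: ifP => _; rewrite ?addr0 ?add0r.
have l30 : 0 < l / 3 by rewrite divr_gt0.
have sub x : (l%:E < kernel_op k f x)%E -> ((l / 3)%:E <= kernel_op k1 g x)%E.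
  move=> lT; rewrite leNgt; apply/negP => Tg.
  suff : (kernel_op k f x <= l%:E)%E by rewrite leNgt lT.
  apply: (le_trans (kernel_op_le x mk1 mk2 mf k0 k10 k20 f0 kk)).
  have Th : (kernel_op k1 h x <= (l / 3)%:E)%E.
    have -> : l / 3 = A * s by rewrite /s; field; rewrite gt_eqF.
    by apply: kernel_op_Linfty => //; exact: ltW.
  rewrite {1}fgh kernel_op_addr//.
  apply: (le_trans (leeD (leeD (ltW Tg) Th) (T2 x))).
  by rewrite -!EFinD lee_fin le_eqVlt; apply/orP; left; apply/eqP; field.
have mT := measurable_kernel_op mk k0 mf f0.
have mTg := measurable_kernel_op mk1 k10 mg g0.
have mS : measurable [set x | l%:E < kernel_op k f x]%E.
  by rewrite -[X in measurable X]setTI; apply: emeasurable_fun_o_infty.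
apply: (@le_trans _ _ (mu [set x | (l / 3)%:E <= kernel_op k1 g x]%E)).
  apply: le_measure; rewrite ?inE//.
  by rewrite -[X in measurable X]setTI; apply: emeasurable_fun_c_infty.
have := le_integral_abse mu measurableT mTg l30.
have -> : [set x | ((l / 3)%:E <= `|kernel_op k1 g x|)%E] = [set x | (l / 3)%:E <= kernel_op k1 g x]%E.
  by apply/seteqP; split => x /=; rewrite gee0_abs// kernel_op_ge0.
under eq_integral do rewrite gee0_abs ?kernel_op_ge0//.
rewrite setTI => H.
have {}H := le_trans H (kernel_op_L1 mk1 k10 mg g0 (ltW A0) A2).
move: H; rewrite -lee_pdivlMl// muleA -EFinM (_ : (l / 3)^-1 * A = 1 / s)//.
by rewrite /s; field; rewrite !gt_eqF.
Qed.

End kernel_operator.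

(** * Potentials of families of kernels with a bound in time *)

Section subordinated_kernel.
Context {d} {X : measurableType d} {R : realType}.
Variable mu : {sigma_finite_measure set X -> \bar R}.
Variables (h : R -> X -> X -> R) (sigma M : R).
Local Notation leb := (@lebesgue_measure R).
Local Notation halfline := (`]0%R, +oo[%classic : set (measurableTypeR R)).
Implicit Types (f : X -> R) (p q l t : R) (E : set (measurableTypeR R)).

Hypothesis mh : measurable_fun [set: (X * X) * measurableTypeR R]
  (fun w => h w.2 w.1.1 w.1.2).
Hypothesis h0 : forall t x y, 0 < t -> 0 <= h t x y.
Hypothesis hM1 : forall t x, 0 < t -> (\int[mu]_y (h t x y)%:E <= M%:E)%E.
Hypothesis hM2 : forall t y, 0 < t -> (\int[mu]_x (h t x y)%:E <= M%:E)%E.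
Hypotheses (M0 : 0 < M) (sigma0 : 0 < sigma).

(** The share of the times in [E] in the subordinated kernel, not normalized by
    [Gamma sigma]. *)
Definition time_kernel E (z : X * X) : \bar R :=
  (\int[leb]_(t in E) (t `^ (sigma - 1) * expR (- t) * h t z.1 z.2)%:E)%E.

Let mg : measurable_fun [set: (X * X) * measurableTypeR R]
  (fun w => (w.2 `^ (sigma - 1) * expR (- w.2) * h w.2 w.1.1 w.1.2)%:E).
Proof.
apply/measurable_EFinP; apply: measurable_funM => //; apply: measurable_funM.
  by apply: (measurableT_comp (measurable_powR _)); exact: measurable_snd.
apply: (measurableT_comp (@measurable_expR R)); apply: measurable_funN.
exact: measurable_snd.
Qed.

Let g0 t x y : 0 < t -> 0 <= t `^ (sigma - 1) * expR (- t) * h t x y.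
Proof. by move=> t0; rewrite mulr_ge0 ?h0// mulr_ge0 ?powR_ge0 ?expR_ge0. Qed.

Let w0 t : 0 <= t `^ (sigma - 1) * expR (- t).
Proof. by rewrite mulr_ge0 ?powR_ge0 ?expR_ge0. Qed.

Let mw E : measurable_fun E (fun t : measurableTypeR R => (t `^ (sigma - 1) * expR (- t))%:E).
Proof.
apply/measurable_EFinP; apply: measurable_funM; first exact: measurable_powRl.
exact: measurable_expRN.
Qed.

Lemma time_kernel_ge0 E z : E `<=` halfline -> (0 <= time_kernel E z)%E.
Proof.
move=> E0; apply: integral_ge0 => t /E0; rewrite /= in_itv/= andbT => t0.
by rewrite lee_fin g0.
Qed.

Lemma measurable_time_kernel E : measurable E -> E `<=` halfline ->
  measurable_fun [set: X * X] (time_kernel E).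
Proof.
move=> mE E0; apply: (measurable_integral_param leb mE mg) => z t /E0.
by rewrite /= in_itv/= andbT => t0; rewrite lee_fin g0.
Qed.

Lemma time_kernel_split (delta : R) z : 0 < delta ->
  (time_kernel halfline z =
   time_kernel `]0%R, delta[ z + time_kernel `[delta, +oo[ z)%E.
Proof.
move=> d0; rewrite /time_kernel.
have E : halfline = `]0%R, delta[%classic `|` `[delta, +oo[%classic :> set R.
  apply/seteqP; split => [x|x []]/=; rewrite !in_itv/= ?andbT.
  - by move=> x0; have [x1|x1] := ltP x delta; [left; rewrite x0|right].
  - by move=> /andP[].
  - exact: lt_le_trans.
rewrite E ge0_integral_setU//=.
- apply: measurable_funTS; case: z => x y.
  exact: (measurable_partial1 (x, y) mg).
- move=> t; rewrite /= !in_itv/= andbT => -[/andP[t0 _]|dt]; rewrite lee_fin g0//.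
  exact: lt_le_trans dt.
- rewrite disj_set2E; apply/eqP/seteqP; split => // x []/=.
  by rewrite !in_itv/= andbT => /andP[_ x1]; rewrite leNgt x1.
Qed.

Lemma measurable_slice_y x : measurable_fun [set: X * measurableTypeR R]
  (fun w => h w.2 x w.1).
Proof.
have mp : measurable_fun [set: X * measurableTypeR R]
    (fun w : X * measurableTypeR R => ((x, w.1), w.2) : (X * X) * measurableTypeR R).
  apply: measurable_fun_pair; last exact: measurable_snd.
  by apply: measurable_fun_pair; [exact: measurable_cst|exact: measurable_fst].
exact: (measurableT_comp mh mp).
Qed.

Lemma measurable_slice_x y : measurable_fun [set: X * measurableTypeR R]
  (fun w => h w.2 w.1 y).
Proof.
have mp : measurable_fun [set: X * measurableTypeR R]
    (fun w : X * measurableTypeR R => ((w.1, y), w.2) : (X * X) * measurableTypeR R).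
  apply: measurable_fun_pair; last exact: measurable_snd.
  by apply: measurable_fun_pair; [exact: measurable_fst|exact: measurable_cst].
exact: (measurableT_comp mh mp).
Qed.

Lemma time_integral_fubini E (k : R -> X -> R) (F : X -> R) :
  measurable E -> E `<=` halfline ->
  measurable_fun [set: X * measurableTypeR R] (fun w => k w.2 w.1) ->
  (forall t y, 0 < t -> 0 <= k t y) ->
  measurable_fun [set: X] F -> (forall y, 0 <= F y) ->
  (\int[mu]_y ((\int[leb]_(t in E) (t `^ (sigma - 1) * expR (- t) * k t y)%:E) * (F y)%:E) =
   \int[leb]_(t in E) ((t `^ (sigma - 1) * expR (- t))%:E * \int[mu]_y (k t y * F y)%:E))%E.
Proof.
move=> mE E0 mk k0 mF F0.
have Et t : E t -> 0 < t by move=> /E0; rewrite /= in_itv/= andbT.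
pose G (w : X * measurableTypeR R) : \bar R :=
  (w.2 `^ (sigma - 1) * expR (- w.2) * (k w.2 w.1 * F w.1))%:E.
have mwk : measurable_fun [set: X * measurableTypeR R]
    (fun w => w.2 `^ (sigma - 1) * expR (- w.2)).
  apply: measurable_funM.
    by apply: (measurableT_comp (measurable_powR _)); exact: measurable_snd.
  apply: (measurableT_comp (@measurable_expR R)); apply: measurable_funN.
  exact: measurable_snd.
have mG : measurable_fun setT G.
  apply/measurable_EFinP; apply: measurable_funM => //; apply: measurable_funM => //.
  by apply: (measurableT_comp mF); exact: measurable_fst.
have G0 y t : E t -> (0 <= G (y, t))%E.
  by move=> /Et t0; rewrite lee_fin /= mulr_ge0// mulr_ge0// k0.
transitivity (\int[mu]_y \int[leb]_(t in E) G (y, t))%E.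
  apply: eq_integral => y _; rewrite -ge0_integralZr; [|by []| | |by rewrite lee_fin].
  - by apply: eq_integral => t _; rewrite -EFinM /G/= mulrA.
  - apply/measurable_funTS/measurable_EFinP; apply: measurable_funM.
      exact: (measurable_partial1 y mwk).
    exact: (measurable_partial1 y mk).
  - by move=> t /Et t0; rewrite lee_fin mulr_ge0// k0.
rewrite tonelli_restrict//; apply: eq_integral => t /set_mem /Et t0.
rewrite -ge0_integralZl; [by []|exact: measurableT| | |by rewrite lee_fin].
  apply/measurable_EFinP; apply: measurable_funM => //.
  exact: (measurable_partial2 t mk).
by move=> y _; rewrite lee_fin mulr_ge0// k0.
Qed.

Lemma time_kernel_marginal E (k : R -> X -> R) :
  measurable E -> E `<=` halfline ->
  measurable_fun [set: X * measurableTypeR R] (fun w => k w.2 w.1) ->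
  (forall t y, 0 < t -> 0 <= k t y) ->
  (forall t, 0 < t -> (\int[mu]_y (k t y)%:E <= M%:E)%E) ->
  (\int[mu]_y (\int[leb]_(t in E) (t `^ (sigma - 1) * expR (- t) * k t y)%:E) <=
   M%:E * \int[leb]_(t in E) (t `^ (sigma - 1) * expR (- t))%:E)%E.
Proof.
move=> mE E0 mk k0 kM.
have Et t : E t -> 0 < t by move=> /E0; rewrite /= in_itv/= andbT.
have := @time_integral_fubini E k (fun=> 1) mE E0 mk k0 (@measurable_cst _ _ _ _ _ _) (fun=> ler01).
under eq_integral do rewrite mule1.
move=> ->; rewrite -ge0_integralZl; [|by []|exact: mw|by move=> t _; rewrite lee_fin
  |by rewrite lee_fin ltW].
apply: le_integral_nonneg => t /Et t0.
  rewrite mule_ge0 ?lee_fin//; apply: integral_ge0 => y _.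
  by rewrite lee_fin mulr1 k0.
rewrite muleC; apply: lee_wpmul2r; first by rewrite lee_fin.
by under eq_integral do rewrite mulr1; exact: kM.
Qed.

Lemma time_kernel_marginal_y E x (A : R) : measurable E -> E `<=` halfline ->
  (\int[leb]_(t in E) (t `^ (sigma - 1) * expR (- t))%:E <= A%:E)%E ->
  (\int[mu]_y time_kernel E (x, y) <= (M * A)%:E)%E.
Proof.
move=> mE E0 HA; rewrite EFinM.
apply: le_trans (lee_wpmul2l _ HA); last by rewrite lee_fin ltW.
apply: (@time_kernel_marginal E (fun t y => h t x y)) => //.
- exact: measurable_slice_y.
- by move=> t y; exact: h0.
- by move=> t; exact: hM1.
Qed.

Lemma time_kernel_marginal_x E y (A : R) : measurable E -> E `<=` halfline ->
  (\int[leb]_(t in E) (t `^ (sigma - 1) * expR (- t))%:E <= A%:E)%E ->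
  (\int[mu]_x time_kernel E (x, y) <= (M * A)%:E)%E.
Proof.
move=> mE E0 HA; rewrite EFinM.
apply: le_trans (lee_wpmul2l _ HA); last by rewrite lee_fin ltW.
apply: (@time_kernel_marginal E (fun t x => h t x y)) => //.
- exact: measurable_slice_x.
- by move=> t x; exact: h0.
- by move=> t; exact: hM2.
Qed.

Lemma kernel_op_time E f x : measurable E -> E `<=` halfline ->
  measurable_fun [set: X] f -> (forall y, 0 <= f y) ->
  (kernel_op mu (time_kernel E) f x =
   \int[leb]_(t in E) ((t `^ (sigma - 1) * expR (- t))%:E * \int[mu]_y (h t x y * f y)%:E))%E.
Proof.
move=> mE E0 mf f0; rewrite -(@time_integral_fubini E (fun t y => h t x y) f)//.
- exact: measurable_slice_y.
- by move=> t y; exact: h0.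
Qed.

(** Interpolation between [L1] and [Linfty] without Hoelder's inequality: from
    [f <= a + a ^ (1 - p) * f ^ p] with [a = S ^ (1 / p)]. *)
Lemma averaging_le (k : X -> R) f (S p : R) : measurable_fun [set: X] k ->
  (forall y, 0 <= k y) -> (\int[mu]_y (k y)%:E <= M%:E)%E -> (forall y, k y <= S) -> 0 < S ->
  1 <= p -> measurable_fun [set: X] f -> (forall y, 0 <= f y) ->
  (\int[mu]_y (f y `^ p)%:E <= 1)%E ->
  (\int[mu]_y (k y * f y)%:E <= ((M + 1) * S `^ p^-1)%:E)%E.
Proof.
move=> mk k0 kM kS S0 p1 mf f0 fp.
have p0 : 0 < p by rewrite (lt_le_trans _ p1).
pose a := S `^ p^-1; have a0 : 0 < a by rewrite powR_gt0.
have aE : a `^ (1 - p) * S = a.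
  rewrite /a -powRrM (_ : p^-1 * (1 - p) = p^-1 - 1); last by field; rewrite gt_eqF.
  by rewrite -{2}(powRr1 (ltW S0)) -powRD_gt0// subrK.
apply: (@le_trans _ _ (\int[mu]_y (a%:E * (k y)%:E + a%:E * (f y `^ p)%:E))%E).
  apply: le_integral_nonneg => y _; first by rewrite lee_fin mulr_ge0.
  rewrite -!EFinM -EFinD lee_fin.
  have [fa|fa] := leP (f y) a.
    apply: (@le_trans _ _ (a * k y)); first by rewrite mulrC ler_wpM2r.
    by rewrite lerDl mulr_ge0 ?powR_ge0// ltW.
  apply: (@le_trans _ _ (a * f y `^ p)); last by rewrite lerDr mulr_ge0// ltW.
  have fy0 : 0 < f y by rewrite (lt_trans a0).
  apply: (@le_trans _ _ (S * f y)); first by rewrite ler_wpM2r.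
  have -> : a * f y `^ p = S * f y * (a `^ (1 - p) * f y `^ (p - 1)).
    by rewrite -(mulr_powRB1 (ltW fy0) p0) -[X in X * _]aE; ring.
  apply: ler_peMr; first by rewrite mulr_ge0// ltW.
  rewrite -(opprB p 1) powRN mulrC ler_pdivlMr ?powR_gt0// mul1r.
  apply: ge0_ler_powR; rewrite ?nnegrE ?subr_ge0//; exact: ltW.
have mfp : measurable_fun [set: X] (fun y => (f y `^ p)%:E).
  by apply/measurable_EFinP; exact: (measurableT_comp (measurable_powR _)).
have mkE : measurable_fun [set: X] (fun y => (k y)%:E) by exact/measurable_EFinP.
rewrite ge0_integralD; [|exact: measurableT| | | |]; last 4 first.
- by move=> y _; rewrite mule_ge0 ?lee_fin// ltW.
- exact: measurable_funeM.
- by move=> y _; rewrite mule_ge0 ?lee_fin ?powR_ge0// ltW.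
- exact: measurable_funeM.
rewrite ge0_integralZl; [|exact: measurableT|by []|by move=> y _; rewrite lee_fin|by rewrite lee_fin ltW].
rewrite ge0_integralZl; [|exact: measurableT|by []|by move=> y _; rewrite lee_fin powR_ge0|by rewrite lee_fin ltW].
have -> : ((M + 1) * a)%:E = (a%:E * M%:E + a%:E * 1)%E.
  by rewrite -!EFinM -EFinD; congr EFin; ring.
by apply: leeD; rewrite lee_pmul2l// lte_fin.
Qed.

Definition heat_potential f := kernel_op mu (time_kernel halfline) f.

Let mhl : measurable halfline. Proof. by []. Qed.

Lemma measurable_heat_potential f : measurable_fun [set: X] f -> (forall y, 0 <= f y) ->
  measurable_fun [set: X] (heat_potential f).
Proof.
move=> mf f0; apply: measurable_kernel_op => //; first exact: measurable_time_kernel.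
by move=> z; exact: time_kernel_ge0.
Qed.

Lemma heat_potential_ge0 f x : (forall y, 0 <= f y) -> (0 <= heat_potential f x)%E.
Proof.
by move=> f0; apply: kernel_op_ge0 => // z; exact: time_kernel_ge0.
Qed.

Let A := M * Gamma sigma.
Let A0 : 0 < A. Proof. by rewrite mulr_gt0 ?Gamma_gt0. Qed.

Lemma heat_potential_marginal_y x : (\int[mu]_y time_kernel halfline (x, y) <= A%:E)%E.
Proof. by apply: time_kernel_marginal_y => //; rewrite Gamma_integral. Qed.

Lemma heat_potential_marginal_x y : (\int[mu]_x time_kernel halfline (x, y) <= A%:E)%E.
Proof. by apply: time_kernel_marginal_x => //; rewrite Gamma_integral. Qed.

Lemma heat_potential_L1 f : measurable_fun [set: X] f -> (forall y, 0 <= f y) ->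
  (\int[mu]_x heat_potential f x <= A%:E * \int[mu]_x (f x)%:E)%E.
Proof.
move=> mf f0; apply: kernel_op_L1 => //; first exact: measurable_time_kernel.
- by move=> z; exact: time_kernel_ge0.
- exact: ltW.
- exact: heat_potential_marginal_x.
Qed.

(** Interpolation between the bounds of the two marginals: the whole kernel plays the role of
    [k1] in [kernel_op_weak], with [k2 = 0]. *)
Lemma heat_potential_Lp f p : 1 < p -> measurable_fun [set: X] f -> (forall y, 0 <= f y) ->
  (\int[mu]_x (heat_potential f x `^ p) <=
   ((3 * A) `^ p * (p / (p - 1)))%:E * \int[mu]_x (f x `^ p)%:E)%E.
Proof.
move=> p1 mf f0; have p0 : 0 < p by rewrite (lt_trans _ p1).
have A30 : 0 < 3 * A by rewrite mulr_gt0.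
have := @distribution_to_strong _ _ _ mu (heat_potential f) f p p (3 * A)^-1 1 p1 p0.
rewrite mul1r.
have -> : (3 * A)^-1 `^ (- p) = (3 * A) `^ p.
  by rewrite -(powR_inv1 (ltW A30)) -powRrM mulN1r opprK.
apply => //.
- by rewrite invr_gt0.
- exact: measurable_heat_potential.
- by move=> x; exact: heat_potential_ge0.
move=> l l0; rewrite (divff (lt0r_neq0 p0)) (powRr1 (ltW l0)) (mulrC _ l).
have mk := measurable_time_kernel mhl (@subset_refl _ halfline).
apply: (@kernel_op_weak _ _ _ mu _ (time_kernel halfline) (cst 0%E)) => //.
- by move=> z; exact: time_kernel_ge0.
- by move=> z; exact: time_kernel_ge0.
- by move=> z; rewrite adde0.
- exact: heat_potential_marginal_y.
- exact: heat_potential_marginal_x.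
- move=> x; rewrite /kernel_op; under eq_integral do rewrite mul0e.
  by rewrite integral0 lee_fin divr_ge0// ltW.
Qed.

Variables (C D : R).
Hypotheses (C0 : 0 < C) (D0 : 0 < D).
Hypothesis hC : forall t x y, 0 < t -> h t x y <= C * t `^ (- D).

(** At time [t] the heat operator maps the unit ball of [Lp] to functions bounded by a multiple
    of [t `^ (- (D / p))], which [t `^ (sigma - 1)] makes integrable at [0]. *)
Lemma heat_potential_Linfty f p x : 1 <= p -> D / p < sigma ->
  measurable_fun [set: X] f -> (forall y, 0 <= f y) ->
  (\int[mu]_y (f y `^ p)%:E <= 1)%E ->
  (heat_potential f x <= ((M + 1) * C `^ p^-1 * Gamma (sigma - D / p))%:E)%E.
Proof.
move=> p1 Dp mf f0 fp; have p0 : 0 < p by rewrite (lt_le_trans _ p1).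
have s0 : 0 < sigma - D / p by rewrite subr_gt0.
have c0 : 0 <= (M + 1) * C `^ p^-1 by rewrite mulr_ge0 ?powR_ge0// addr_ge0// ltW.
rewrite /heat_potential kernel_op_time// EFinM Gamma_integral//.
rewrite -ge0_integralZl; [|by []| | |by rewrite lee_fin]; last 2 first.
- apply/measurable_EFinP; apply: measurable_funM; first exact: measurable_powRl.
  exact: measurable_expRN.
- by move=> t _; rewrite lee_fin mulr_ge0 ?powR_ge0 ?expR_ge0.
apply: le_integral_nonneg => t; rewrite /= in_itv/= andbT => t0.
  rewrite mule_ge0 ?lee_fin//; apply: integral_ge0 => y _.
  by rewrite lee_fin mulr_ge0 ?h0.
have S0 : 0 < C * t `^ (- D) by rewrite mulr_gt0 ?powR_gt0.
have mk : measurable_fun [set: X] (h t x).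
  exact: (measurable_partial2 t (measurable_slice_y x)).
have H := averaging_le mk (fun y => h0 x y t0) (hM1 x t0) (fun y => hC x y t0) S0 p1 mf f0 fp.
apply: (le_trans (lee_wpmul2l _ H)); first by rewrite lee_fin.
rewrite -!EFinM lee_fin le_eqVlt; apply/orP; left; apply/eqP.
rewrite powRM ?powR_ge0 ?(ltW C0)// -powRrM.
rewrite (_ : sigma - D / p - 1 = sigma - 1 + (- D * p^-1)); last by ring.
by rewrite (powRD_gt0 (sigma - 1) (- D * p^-1) t0); ring.
Qed.

(** The exponential factor lets the dimension be increased: [e^-t h] is bounded by a multiple
    of [t ^ -d] for every [d >= D]. *)
Lemma exp_heat_le (dd : R) : D <= dd -> exists2 C' : R, 0 < C' &
  forall t x y, 0 < t -> expR (- t) * h t x y <= C' * t `^ (- dd).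
Proof.
rewrite le_eqVlt => /predU1P[<-|Dd].
  exists C => // t x y t0; apply: le_trans (hC x y t0).
  by rewrite ler_piMl ?h0// expR_le1 oppr_le0 ltW.
have m0 : 0 < dd - D by rewrite subr_gt0.
exists ((dd - D) `^ (dd - D) * C) => [|t x y t0]; first by rewrite mulr_gt0 ?powR_gt0.
apply: (@le_trans _ _ ((dd - D) `^ (dd - D) * t `^ (- (dd - D)) * (C * t `^ (- D)))).
  by apply: ler_pM; rewrite ?expR_ge0 ?h0 ?hC ?expRN_le_powR.
rewrite (_ : - dd = - (dd - D) + (- D)); last by ring.
by rewrite (powRD_gt0 (- (dd - D)) _ t0) le_eqVlt; apply/orP; left; apply/eqP; ring.
Qed.

(** Times before [delta] give the kernel with marginals of order [delta ^ sigma], later times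
    a function bounded by a multiple of [delta ^ (sigma - d / p)]; [delta] is chosen so that
    the latter is [l / 3]. *)
Lemma heat_potential_weak p (dd : R) : 1 <= p -> D <= dd -> sigma < dd / p ->
  exists2 c : R, 0 < c & forall f, measurable_fun [set: X] f -> (forall y, 0 <= f y) ->
    (\int[mu]_y (f y `^ p)%:E <= 1)%E -> forall l, 0 < l ->
    (mu [set x | l%:E < heat_potential f x] <=
     (1 / (c * l `^ (1 + sigma / (dd / p - sigma))))%:E *
      \int[mu]_x (if c * l `^ (1 + sigma / (dd / p - sigma)) < f x then f x else 0)%:E)%E.
Proof.
move=> p1 Dd sd; have p0 : 0 < p by rewrite (lt_le_trans _ p1).
have [C' C'0 hC'] := exp_heat_le Dd.
set e := dd / p - sigma; have e0 : 0 < e by rewrite subr_gt0.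
pose B := (M + 1) * C' `^ p^-1 / e.
have B0 : 0 < B by rewrite divr_gt0// mulr_gt0 ?powR_gt0// addr_gt0.
have B30 : 0 < 3 * B by rewrite mulr_gt0.
pose c := sigma / (3 * M) * (3 * B) `^ (- (sigma / e)).
have c0 : 0 < c by rewrite mulr_gt0 ?powR_gt0// divr_gt0// mulr_gt0.
exists c => // f mf f0 fp l l0.
pose delta := (3 * B / l) `^ e^-1.
have Bl0 : 0 < 3 * B / l by rewrite divr_gt0.
have d0 : 0 < delta by rewrite powR_gt0.
have de : delta `^ (- e) = l / (3 * B).
  rewrite /delta -powRrM mulrN mulVf ?gt_eqF// powR_inv1 ?ltW//.
  by field; rewrite !gt_eqF.
pose A1 := M * (delta `^ sigma / sigma).
have A10 : 0 < A1 by rewrite mulr_gt0// divr_gt0// powR_gt0.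
have sE : c * l `^ (1 + sigma / e) = l / (3 * A1).
  have ds : delta `^ sigma = (3 * B) `^ (sigma / e) * l `^ (- (sigma / e)).
    rewrite /delta -powRrM (mulrC e^-1) powRM ?invr_ge0 ?(ltW l0) ?(ltW B30)//.
    by rewrite -(powR_inv1 (ltW l0)) -powRrM mulN1r.
  rewrite /A1 ds /c !powRN (powRD_gt0 _ _ l0) powRr1 ?(ltW l0)//.
  by field; rewrite !gt_eqF ?powR_gt0.
rewrite sE.
have E1 : `]0%R, delta[%classic `<=` halfline.
  by move=> t; rewrite /= !in_itv/= andbT => /andP[].
have E2 : `[delta, +oo[%classic `<=` halfline.
  by move=> t; rewrite /= !in_itv/= !andbT; exact: lt_le_trans.
have mE1 : measurable (`]0%R, delta[%classic : set (measurableTypeR R)) by [].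
have mE2 : measurable (`[delta, +oo[%classic : set (measurableTypeR R)) by [].
have H1 : (\int[leb]_(t in `]0%R, delta[) (t `^ (sigma - 1) * expR (- t))%:E <=
    (delta `^ sigma / sigma)%:E)%E.
  rewrite -(integral_powR_0 sigma0 (ltW d0)); apply: le_integral_nonneg => t.
    by move=> _; rewrite lee_fin.
  rewrite /= in_itv/= => /andP[t0 _]; rewrite lee_fin ler_piMr ?powR_ge0//.
  by rewrite expR_le1 oppr_le0 ltW.
apply: (@kernel_op_weak _ _ _ mu _ (time_kernel `]0%R, delta[) (time_kernel `[delta, +oo[)) => //.
- exact: measurable_time_kernel.
- exact: measurable_time_kernel.
- exact: measurable_time_kernel.
- by move=> z; exact: time_kernel_ge0.
- by move=> z; exact: time_kernel_ge0.
- by move=> z; exact: time_kernel_ge0.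
- by move=> z; rewrite -time_kernel_split.
- by move=> x; exact: time_kernel_marginal_y.
- by move=> y; exact: time_kernel_marginal_x.
move=> x; rewrite kernel_op_time//.
have -> : l / 3 = (M + 1) * C' `^ p^-1 * (delta `^ (- e) / e).
  rewrite de /B; field.
  by rewrite !gt_eqF ?powR_gt0// addr_gt0.
rewrite EFinM.
have b0 : 0 <= (M + 1) * C' `^ p^-1 by rewrite mulr_ge0 ?powR_ge0// addr_ge0// ltW.
apply: le_trans (lee_wpmul2l _ (integral_powR_y_le e0 d0)); last by rewrite lee_fin.
rewrite -ge0_integralZl; [|by []| | |by rewrite lee_fin]; last 2 first.
- by apply/measurable_EFinP; exact: measurable_powRl.
- by move=> t _; rewrite lee_fin powR_ge0.
apply: le_integral_nonneg => t; rewrite /= in_itv/= andbT => td.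
  rewrite mule_ge0 ?lee_fin//; apply: integral_ge0 => y _.
  by rewrite lee_fin mulr_ge0 ?h0// (lt_le_trans d0).
have t0 : 0 < t by exact: lt_le_trans td.
have S0 : 0 < C' * t `^ (- dd) by rewrite mulr_gt0 ?powR_gt0.
pose k y := expR (- t) * h t x y.
have mht : measurable_fun [set: X] (h t x).
  exact: (measurable_partial2 t (measurable_slice_y x)).
have mk : measurable_fun [set: X] k by exact: measurable_funM.
have k0 y : 0 <= k y by rewrite mulr_ge0 ?expR_ge0 ?h0.
have kM : (\int[mu]_y (k y)%:E <= M%:E)%E.
  apply: le_trans (hM1 x t0); apply: le_integral_nonneg => y _; first by rewrite lee_fin.
  by rewrite lee_fin /k ler_piMl ?h0// expR_le1 oppr_le0 ltW.
have H := averaging_le mk k0 kM (fun y => hC' t x y t0) S0 p1 mf f0 fp.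
rewrite EFinM -muleA.
have -> : ((expR (- t))%:E * \int[mu]_y (h t x y * f y)%:E = \int[mu]_y (k y * f y)%:E)%E.
  rewrite -ge0_integralZl; [|exact: measurableT| | |by rewrite lee_fin expR_ge0].
  - by apply: eq_integral => y _; rewrite -EFinM mulrA.
  - by apply/measurable_EFinP; exact: measurable_funM.
  - by move=> y _; rewrite lee_fin mulr_ge0 ?h0.
apply: (le_trans (lee_wpmul2l _ H)); first by rewrite lee_fin powR_ge0.
rewrite -!EFinM lee_fin le_eqVlt; apply/orP; left; apply/eqP.
rewrite powRM ?powR_ge0 ?(ltW C'0)// -powRrM.
rewrite (_ : - e - 1 = sigma - 1 + (- dd * p^-1)); last by rewrite /e; ring.
by rewrite (powRD_gt0 (sigma - 1) (- dd * p^-1) t0); ring.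
Qed.

(** The dimension is raised to the value for which [q] is the critical exponent of [p]. *)
Lemma heat_potential_LpLq p q : 1 < p -> p < q -> p^-1 - sigma / D <= q^-1 ->
  exists2 K : R, 0 <= K & forall f, measurable_fun [set: X] f -> (forall y, 0 <= f y) ->
    (\int[mu]_y (f y `^ p)%:E <= 1)%E -> (\int[mu]_x (heat_potential f x `^ q) <= K%:E)%E.
Proof.
move=> p1 pq pqD; have p0 : 0 < p by rewrite (lt_trans _ p1).
have q0 : 0 < q by rewrite (lt_trans p0).
have th0 : 0 < p^-1 - q^-1 by rewrite subr_gt0 ltf_pV2 ?posrE.
pose dd := sigma / (p^-1 - q^-1).
have Dd : D <= dd.
  rewrite /dd ler_pdivlMr// mulrC -ler_pdivlMr//.
  by rewrite lerBlDr addrC -lerBlDr.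
have sd : sigma < dd / p.
  rewrite /dd mulrAC ltr_pdivlMr// ltr_pM2l// gtrBl invr_gt0//.
have [c c0 H] := heat_potential_weak (ltW p1) Dd sd.
have ex : 1 + sigma / (dd / p - sigma) = q / p.
  have -> : dd / p - sigma = sigma * q^-1 / (p^-1 - q^-1).
    rewrite /dd; set th := p^-1 - q^-1 in th0 *.
    rewrite (_ : q^-1 = p^-1 - th); last by rewrite /th; ring.
    by field; rewrite !gt_eqF.
  have -> : sigma / (sigma * q^-1 / (p^-1 - q^-1)) = (p^-1 - q^-1) * q.
    by move: (p^-1 - q^-1) th0 => th th0; field; rewrite !gt_eqF.
  by field; rewrite !gt_eqF.
have K0 : 0 <= 1 * c `^ (- p) * (p / (p - 1)).
  by rewrite mulr_ge0 ?mulr_ge0 ?powR_ge0// ?invr_ge0 ?subr_ge0 ltW.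
exists (1 * c `^ (- p) * (p / (p - 1))) => // f mf f0 fp.
have := @distribution_to_strong _ _ _ mu (heat_potential f) f p q c 1 p1 q0 c0 ler01
  (measurable_heat_potential mf f0) (fun x => heat_potential_ge0 x f0) mf f0.
rewrite -ex => /(_ (H f mf f0 fp)) /le_trans; apply.
by rewrite -[leRHS]mule1; apply: lee_wpmul2l => //; rewrite lee_fin.
Qed.

(** At [p = 1] the weak bound for an exponent above [q] controls the large values of the
    potential, and the [L1] bound controls the small ones. *)
Lemma heat_potential_L1Lq q : 1 < q -> 1 - sigma / D < q^-1 ->
  exists2 K : R, 0 <= K & forall f, measurable_fun [set: X] f -> (forall y, 0 <= f y) ->
    (\int[mu]_y (f y)%:E <= 1)%E -> (\int[mu]_x (heat_potential f x `^ q) <= K%:E)%E.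
Proof.
move=> q1 qD; have q0 : 0 < q by rewrite (lt_trans _ q1).
pose th := Num.min (sigma / D) ((1 + (1 - q^-1)) / 2).
have qi1 : q^-1 < 1 by rewrite invf_lt1.
have qi0 : 0 < q^-1 by rewrite invr_gt0.
have th1 : 1 - q^-1 < th by rewrite lt_min; apply/andP; split; lra.
have th2 : th < 1 by rewrite /th gt_min; apply/orP; right; lra.
have th0 : 0 < th by lra.
have th3 : th <= sigma / D by rewrite ge_min lexx.
pose dd := sigma / th.
have Dd : D <= dd by rewrite /dd ler_pdivlMr// mulrC -ler_pdivlMr.
have sd : sigma < dd / 1 by rewrite divr1 /dd ltr_pdivlMr// gtr_pMr.
have [c c0 H] := heat_potential_weak (lexx 1) Dd sd.
have ex : 1 + sigma / (dd / 1 - sigma) = (1 - th)^-1.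
  have th10 : 0 < 1 - th by rewrite subr_gt0.
  have -> : dd / 1 - sigma = sigma * (1 - th) / th.
    by rewrite /dd; move: (th) th0 => t t0; field; rewrite gt_eqF.
  by move: (th) th0 th10 => t t0 t1; field; rewrite !gt_eqF.
pose r := (1 - th)^-1.
have rq : 0 < r - q.
  rewrite subr_gt0 /r -[ltLHS]invrK ltf_pV2 ?posrE ?invr_gt0//; lra.
have qc0 : 0 <= q / c by apply: divr_ge0; exact: ltW.
have K0 : 0 <= q * A + q / c / (r - q).
  apply: addr_ge0; first by apply: mulr_ge0; exact: ltW.
  by apply: divr_ge0; [apply: divr_ge0|]; exact: ltW.
exists (q * A + q / c / (r - q)) => // f mf f0 fp.
have mT := measurable_heat_potential mf f0.
have T0 x := heat_potential_ge0 x f0.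
rewrite layer_cake//.
pose m l := mu [set x | l%:E < heat_potential f x]%E.
have m0 l : (0 <= m l)%E by exact: measure_ge0.
have wl l : 0 < l -> (m l <= (c^-1 * l `^ (- r))%:E)%E.
  move=> l0; have := H f mf f0 _ l l0; rewrite ex -/r.
  under eq_integral do rewrite powRr1//.
  move=> /(_ fp) /le_trans; apply.
  rewrite mul1r invfM -powRN -[leRHS]mule1; apply: lee_wpmul2l.
    by rewrite lee_fin mulr_ge0 ?powR_ge0// invr_ge0 ltW.
  by apply: le_trans fp; apply: le_integral_nonneg => x _; rewrite lee_fin; case: ifP.
have mm : measurable_fun halfline m.
  by apply: measurable_funTS; exact: measurable_distribution.
have L1 : (\int[leb]_(l in halfline) m l <= A%:E)%E.
  have -> : (\int[leb]_(l in halfline) m l = \int[mu]_x heat_potential f x)%E.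
    have := layer_cake mu ltr01 mT T0.
    under eq_integral do rewrite poweRe1//.
    move=> ->; apply: eq_integral => l _; by rewrite subrr powRr0 mul1r mul1e.
  apply: (le_trans (heat_potential_L1 mf f0)).
  by rewrite -[leRHS]mule1; apply: lee_wpmul2l => //; rewrite lee_fin ltW.
pose tail (l : measurableTypeR R) : \bar R :=
  if 1 <= l then (q / c * l `^ (- (r - q) - 1))%:E else 0%E.
have tail0 l : (0 <= tail l)%E.
  rewrite /tail; case: ifP => // _.
  by rewrite lee_fin mulr_ge0 ?powR_ge0.
have mtail : measurable_fun halfline tail.
  apply: measurable_funTS; apply: measurable_fun_ifT => //; last first.
    by apply/measurable_EFinP; apply: measurable_funM => //; exact: measurable_powR.
  by apply: measurable_fun_ler.
apply: (@le_trans _ _ (\int[leb]_(l in halfline) (q%:E * m l + tail l))%E).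
  apply: le_integral_nonneg => l; rewrite /= in_itv/= andbT => l0.
    by rewrite mule_ge0// lee_fin mulr_ge0 ?powR_ge0// ltW.
  rewrite -/(m l) /tail; case: ifPn => [l1|]; last first.
    rewrite -ltNge adde0 => l1; apply: lee_wpmul2r => //; rewrite lee_fin.
    apply: ler_piMr; first exact: ltW.
    have := @ge0_ler_powR _ (q - 1) _ l 1; rewrite powR1; apply; rewrite ?nnegrE//.
    - by rewrite subr_ge0 ltW.
    - exact: ltW.
    - exact: ltW.
  apply: (@le_trans _ _ (q / c * l `^ (- (r - q) - 1))%:E); last first.
    by rewrite leeDr// mule_ge0// lee_fin ltW.
  have ql : (0 <= (q * l `^ (q - 1))%:E)%E by rewrite lee_fin mulr_ge0 ?powR_ge0// ltW.
  apply: (le_trans (lee_wpmul2l ql (wl l l0))).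
  rewrite -EFinM lee_fin (_ : - (r - q) - 1 = (q - 1) + - r); last by ring.
  by rewrite (powRD_gt0 (q - 1) (- r) l0) le_eqVlt; apply/orP; left; apply/eqP; ring.
rewrite ge0_integralD; [|by []| | | |]; last 4 first.
- by move=> l _; rewrite mule_ge0// lee_fin ltW.
- exact: measurable_funeM.
- by move=> l _.
- exact: mtail.
rewrite ge0_integralZl; [|by []|exact: mm|by move=> l _|by rewrite lee_fin ltW].
rewrite EFinD; apply: leeD.
  by rewrite EFinM; apply: lee_wpmul2l => //; rewrite lee_fin ltW.
apply: (@le_trans _ _ (\int[leb]_(l in `[1%R, +oo[) ((q / c)%:E * (l `^ (- (r - q) - 1))%:E))%E).
  rewrite [leLHS]integral_mkcond [leRHS]integral_mkcond.
  apply: le_integral_nonneg => l _; rewrite !patchE !mem_setE !in_itv/= !andbT.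
    by case: ifP.
  rewrite /tail; case: (ltP 0 l) => l0.
    by case: ifP => _; rewrite ?EFinM.
  by case: ifP => //; rewrite -EFinM lee_fin mulr_ge0 ?powR_ge0.
rewrite ge0_integralZl; [|by []| | |by rewrite lee_fin]; last 2 first.
- by apply/measurable_EFinP; exact: measurable_powRl.
- by move=> l _; rewrite lee_fin powR_ge0.
rewrite [leRHS]EFinM; apply: lee_wpmul2l; first by rewrite lee_fin.
by have := integral_powR_y_le rq ltr01; rewrite powR1 mul1r.
Qed.

End subordinated_kernel.

(** * Reduction of the potential to the even heat kernel *)

Section Lnorm_extra.
Context {d} {T : measurableType d} {R : realType}.
Variable mu : {measure set T -> \bar R}.
Implicit Types (f g : T -> \bar R) (p : \bar R) (c r : R).

(** Meant for a potential [f], which is controlled only off the origin. *)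
Lemma le_Lnorm_off_null f g p (N : set T) : (1 <= p)%E ->
  measurable N -> mu N = 0%E -> measurable_fun [set: T] g ->
  (forall x, ~ N x -> (`|f x| <= `|g x|)%E) -> ('N[mu]_p[f] <= 'N[mu]_p[g])%E.
Proof.
case: p => [r r1|_|//] mN N0 mg fg; rewrite unlock /=.
  have r0 : 0 < r by rewrite -lte_fin (lt_le_trans _ r1).
  have mgr : measurable_fun [set: T] (fun x => (`|g x| `^ r)%E).
    apply: (measurableT_comp (measurable_poweR _)).
    exact: measurableT_comp.
  pose g' x := (if x \in N then +oo else `|g x| `^ r)%E.
  have mg' : measurable_fun [set: T] g'.
    apply: measurable_fun_ifT => //.
    apply: (@measurable_fun_bool _ _ _ _ true) => //.
    by rewrite setTI (_ : _ @^-1` _ = N)//; apply/seteqP; split => y /=; [move/set_mem|move/mem_set].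
  apply: gt0_ler_poweR; rewrite ?invr_ge0 ?(ltW r0)//.
  - by rewrite in_itv/= leey andbT; apply: integral_ge0 => x _; exact: poweR_ge0.
  - by rewrite in_itv/= leey andbT; apply: integral_ge0 => x _; exact: poweR_ge0.
  apply: (@le_trans _ _ (\int[mu]_x g' x)%E).
    apply: le_integral_nonneg => x _; first exact: poweR_ge0.
    rewrite /g'; case: ifPn => [_|/negP xN]; first by rewrite leey.
    apply: gt0_ler_poweR; rewrite ?(ltW r0)//.
    - by rewrite in_itv/= leey andbT abse_ge0.
    - by rewrite in_itv/= leey andbT abse_ge0.
    - by apply: fg => Nx; apply: xN; exact/mem_set.
  rewrite le_eqVlt; apply/orP; left; apply/eqP.
  apply: ge0_ae_eq_integral => //.
  - by move=> x _; rewrite /g'; case: ifP => // _; exact: poweR_ge0.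
  - by move=> x _; exact: poweR_ge0.
  - exists N; split => // x /= H; apply: contrapT => Nx; apply: H => _.
    by rewrite /g' memNset.
case: ifP => // _; apply: le_ess_sup.
exists N; split => // x /= H; apply: contrapT => Nx; apply: H; exact: fg.
Qed.

Lemma Lnorm_scale g p c : 0 < c -> (1 <= p)%E -> measurable_fun [set: T] g ->
  ('N[mu]_p[(fun x => c%:E * g x)] = c%:E * 'N[mu]_p[g])%E.
Proof.
move=> c0; case: p => [r r1|_|//] mg; rewrite unlock /=.
  have r0 : 0 < r by rewrite -lte_fin (lt_le_trans _ r1).
  have mgr : measurable_fun [set: T] (fun x => (`|g x| `^ r)%E).
    apply: (measurableT_comp (measurable_poweR _)).
    exact: measurableT_comp.
  under eq_integral => x _.
    rewrite abseM gee0_abs ?lee_fin ?(ltW c0)// poweRM ?abse_ge0 ?lee_fin ?(ltW c0)//.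
    over.
  rewrite ge0_integralZl; [|exact: measurableT|exact: mgr|by move=> x _; exact: poweR_ge0
    |exact: poweR_ge0].
  rewrite poweRM ?poweR_ge0//; last by apply: integral_ge0 => x _; exact: poweR_ge0.
  by rewrite -poweRrM divff ?gt_eqF// poweRe1 ?lee_fin ?ltW.
case: ifP => [m0|_]; last by rewrite mule0.
rewrite -ess_sup_pZl//; congr (ess_sup mu _); apply/funext => x /=.
by rewrite abseM gee0_abs ?lee_fin ?(ltW c0).
Qed.

Lemma Lnorm_lty_ae g p : (1 <= p)%E -> measurable_fun [set: T] g ->
  (forall x, 0 <= g x)%E -> (0 < mu [set: T])%E -> ('N[mu]_p[g] < +oo)%E ->
  {ae mu, forall x, (g x < +oo)%E}.
Proof.
case: p => [r r1|_|//] mg g0 muT; rewrite unlock /=.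
  have r0 : 0 < r by rewrite -lte_fin (lt_le_trans _ r1).
  move=> /lty_poweRy; rewrite invr_eq0 gt_eqF// => /(_ isT) H.
  have mgr : measurable_fun [set: T] (fun x => (g x `^ r)%E).
    exact: (measurableT_comp (measurable_poweR _)).
  have Hi : mu.-integrable [set: T] (fun x => (g x `^ r)%E).
    apply/integrableP; split => //; apply: le_lt_trans H.
    rewrite le_eqVlt; apply/orP; left; apply/eqP; apply: eq_integral => x _.
    by rewrite gee0_abs ?poweR_ge0// gee0_abs.
  have := integrable_ae measurableT Hi; apply: filterS => x /(_ I) H1.
  apply: (@lty_poweRy _ _ r); rewrite ?gt_eqF//.
  by rewrite ltey_eq H1.
rewrite muT => H; have := ess_sup_ge mu (abse \o g); apply: filterS => x /= Hx.
by rewrite -(gee0_abs (g0 x)); exact: le_lt_trans H.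
Qed.

End Lnorm_extra.

Section operator_bound.
Context {R : realType}.
Variables (alpha sigma : R).
Hypotheses (alpha1 : -1 < alpha) (sigma0 : 0 < sigma).
Local Notation leb := (@lebesgue_measure R).
Local Notation X := (measurableTypeR R).
Local Notation halfline := (`]0%R, +oo[%classic : set X).
Local Notation mu := (dw alpha).

Lemma integral_even_le (g : X -> \bar R) : measurable_fun [set: X] g ->
  (forall x, 0 <= g x)%E -> (forall x, g (- x)%R = g x) ->
  (\int[leb]_x g x = \int[leb]_(x in halfline) g x + \int[leb]_(x in halfline) g x)%E.
Proof.
move=> mg g0 ge.
have E : [set: X] = `]-oo, 0%R]%classic `|` halfline.
  by apply/seteqP; split => // x _; rewrite /= !in_itv/= andbT; case: (leP x 0); [left|right].
rewrite [in LHS]E ge0_integral_setU//=; last 2 first.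
- by rewrite -E.
- rewrite disj_set2E; apply/eqP/seteqP; split => // x []/=.
  by rewrite !in_itv/= andbT => h1 h2; move: (lt_le_trans h2 h1); rewrite ltxx.
congr (_ + _)%E.
rewrite integral_itv_obnd_cbnd; last exact: measurable_funTS.
rewrite ge0_integration_by_substitution0//.
by apply: eq_integral => x _; rewrite ge.
Qed.

Lemma heat_kernel_marginal t x : 0 < t ->
  (\int[mu]_y (heat_kernel alpha t x y)%:E <= 2%:E)%E.
Proof.
move=> t0.
have mE : measurable_fun [set: X] (fun y : X => (heat_kernel alpha t x y)%:E).
  by apply/measurable_EFinP; exact: measurable_heat_kernelr.
rewrite integral_dw//; last by move=> y _; rewrite lee_fin heat_kernel_ge0.
rewrite integral_even_le; last 3 first.
- apply: emeasurable_funM => //; apply/measurable_EFinP; exact: measurable_density.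
- by move=> y; rewrite -EFinM lee_fin mulr_ge0 ?powR_ge0 ?heat_kernel_ge0.
- by move=> y; rewrite normrN heat_kernelNr.
have -> : (\int[leb]_(y in halfline) ((heat_kernel alpha t x y)%:E * (`|y| `^ (2 * alpha + 1))%:E) = 1)%E.
  rewrite -(heat_kernel_mass x alpha1 t0); apply: eq_integral => y.
  by rewrite inE/= in_itv/= andbT => y0; rewrite gtr0_norm.
by rewrite -EFinD lee_fin.
Qed.

Lemma measurable_heat_kernel3 a : -1 < a -> measurable_fun [set: (X * X) * X]
  (fun w => heat_kernel a w.2 w.1.1 w.1.2).
Proof.
move=> a1; apply: measurable_heat_kernel => //.
- exact: (measurableT_comp measurable_fst measurable_fst).
- exact: (measurableT_comp measurable_snd measurable_fst).
Qed.

Let c1 : R := (Gamma sigma)^-1 * (1 + (alpha + 1)^-1).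
Local Notation TK := (time_kernel (fun t (x y : X) => heat_kernel alpha t x y) sigma halfline).

Let gs : 0 < (Gamma sigma)^-1. Proof. by rewrite invr_gt0 Gamma_gt0. Qed.
Let a10 : 0 < alpha + 1. Proof. by rewrite -ltrBlDr sub0r. Qed.
Let c10 : 0 < c1. Proof. by rewrite mulr_gt0// addr_gt0// invr_gt0. Qed.

Let dk (w : (X * X) * X) : R := 2^-1 * (heat_kernel alpha w.2 w.1.1 w.1.2 +
  w.1.1 * w.1.2 * heat_kernel (alpha + 1) w.2 w.1.1 w.1.2).

Let G (w : (X * X) * X) : R := expR (- w.2) * dk w * w.2 `^ (sigma - 1).

Let mG : measurable_fun [set: (X * X) * X] G.
Proof.
have a11 : -1 < alpha + 1 by rewrite (lt_trans alpha1)// ltrDl.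
apply: measurable_funM; last first.
  by apply: (measurableT_comp (measurable_powR _)); exact: measurable_snd.
apply: measurable_funM.
  apply: (measurableT_comp (@measurable_expR R)); apply: measurable_funN.
  exact: measurable_snd.
apply: measurable_funM => //; apply: measurable_funD; first exact: measurable_heat_kernel3.
apply: measurable_funM; last exact: measurable_heat_kernel3.
apply: measurable_funM.
  exact: (measurableT_comp measurable_fst measurable_fst).
exact: (measurableT_comp measurable_snd measurable_fst).
Qed.

Lemma potential_kernelE x y : x != 0 -> y != 0 ->
  (potential_kernel alpha sigma x y =
   (Gamma sigma)^-1%:E * \int[leb]_(t in halfline) (G ((x, y), t))%:E)%E.
Proof.
move=> x0 y0; rewrite /potential_kernel; congr (_ * _)%E; apply: eq_integral => t.
by rewrite inE/= in_itv/= andbT => t0; rewrite dunkl_heatE.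
Qed.

(** Off [y = 0] the kernel is the difference of the integrals of the positive and negative
    parts of its integrand, each of which depends measurably on [y]. *)
Lemma measurable_potential_kernel x : x != 0 ->
  measurable_fun [set: X] (fun y : X => potential_kernel alpha sigma x y).
Proof.
move=> x0.
pose K' (y : X) := ((Gamma sigma)^-1%:E * \int[leb]_(t in halfline) (G ((x, y), t))%:E)%E.
have -> : (fun y : X => potential_kernel alpha sigma x y) =
    (fun y => if y == 0 then potential_kernel alpha sigma x 0 else K' y).
  apply/funext => y; case: ifPn => [/eqP ->//|y0].
  by rewrite potential_kernelE.
apply: measurable_fun_ifT => //; first exact: measurable_fun_eqr.
apply: measurable_funeM.
have mGx : measurable_fun [set: X * X] (fun w => (G ((x, w.1), w.2))%:E).
  apply/measurable_EFinP; apply: (measurableT_comp mG).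
  apply: measurable_fun_pair; last exact: measurable_snd.
  by apply: measurable_fun_pair; [exact: measurable_cst|exact: measurable_fst].
pose Gx (w : X * X) : \bar R := (G ((x, w.1), w.2))%:E.
have mhl : measurable halfline by [].
have mp := measurable_integral_param leb mhl (measurable_funepos mGx)
  (fun y t _ => funepos_ge0 Gx (y, t)).
have mn := measurable_integral_param leb mhl (measurable_funeneg mGx)
  (fun y t _ => funeneg_ge0 Gx (y, t)).
have := emeasurable_funB mp mn; congr (measurable_fun _ _).
apply/funext => y; rewrite [RHS]integralE /=.
by congr (_ - _)%E; apply: eq_integral => t _; rewrite ?funeposE ?funenegE.
Qed.

Lemma abse_potential_kernel_le x y : x != 0 -> y != 0 ->
  (`|potential_kernel alpha sigma x y| <= c1%:E * TK (x, y))%E.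
Proof.
move=> x0 y0; rewrite potential_kernelE// abseM gee0_abs ?lee_fin ?(ltW gs)//.
rewrite /c1 EFinM -muleA; apply: lee_wpmul2l; first by rewrite lee_fin ltW.
have mGxy : measurable_fun halfline (fun t : X => (G ((x, y), t))%:E).
  by apply/measurable_EFinP; apply: measurable_funTS; exact: (measurable_partial1 (x, y) mG).
apply: (le_trans (le_abse_integral _ _ mGxy)) => //.
have cc : 0 <= 1 + (alpha + 1)^-1 by rewrite addr_ge0// invr_ge0 ltW.
rewrite /time_kernel -ge0_integralZl; [|by []| | |by rewrite lee_fin]; last 2 first.
- apply/measurable_EFinP; apply: measurable_funM.
    by apply: measurable_funM; [exact: measurable_powRl|exact: measurable_expRN].
  apply: measurable_funTS.
  exact: (measurable_partial1 (x, y) (measurable_heat_kernel3 alpha1)).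
- move=> t; rewrite /= in_itv/= andbT => t0.
  by rewrite lee_fin mulr_ge0 ?heat_kernel_ge0// mulr_ge0 ?powR_ge0 ?expR_ge0.
apply: le_integral_nonneg => t; first by move=> _; exact: abse_ge0.
rewrite /= in_itv/= andbT => t0; rewrite -EFinM lee_fin.
have -> : G (x, y, t) = expR (- t) * dk (x, y, t) * t `^ (sigma - 1) by [].
rewrite normrM [`|expR _ * _|]normrM.
rewrite (ger0_norm (expR_ge0 _)) (ger0_norm (powR_ge0 _ _)).
have := dunkl_heat_le alpha1 t0 x0 y0; rewrite dunkl_heatE// -/(dk ((x, y), t)).
set u := `|dk _|; set v := heat_kernel _ _ _ _ => uv.
rewrite [leRHS](_ : _ = expR (- t) * ((1 + (alpha + 1)^-1) * v) * t `^ (sigma - 1)); last by ring.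
by apply: ler_wpM2r; [exact: powR_ge0|apply: ler_wpM2l; [exact: expR_ge0|]].
Qed.

Local Notation HP := (heat_potential mu (fun t (x y : X) => heat_kernel alpha t x y) sigma).

Let hk0 t (x y : X) : 0 < t -> 0 <= heat_kernel alpha t x y.
Proof. exact: heat_kernel_ge0. Qed.

Let mhl : measurable halfline. Proof. by []. Qed.

Let mTK : measurable_fun [set: X * X] TK.
Proof. exact: (measurable_time_kernel sigma (measurable_heat_kernel3 alpha1) hk0 mhl). Qed.

Let TK0 z : (0 <= TK z)%E.
Proof. by apply: time_kernel_ge0. Qed.

Lemma integral_abse_potential_le (f : X -> R) x : measurable_fun [set: X] f -> x != 0 ->
  (\int[mu]_y `|potential_kernel alpha sigma x y * (f y)%:E| <=
   c1%:E * HP (fun y : X => `|f y|)%R x)%E.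
Proof.
move=> mf x0.
have mnf : measurable_fun [set: X] (fun y : X => `|f y|)%R by exact: measurableT_comp.
have mTf : measurable_fun [set: X] (fun y => TK (x, y) * (`|f y|)%:E)%E.
  by apply: measurable_section_mul.
rewrite /heat_potential /kernel_op -ge0_integralZl; [|exact: measurableT|exact: mTf| |]; last 2 first.
- by move=> y _; rewrite mule_ge0// lee_fin.
- by rewrite lee_fin ltW.
apply: ae_ge0_le_integral => //.
- apply: measurableT_comp => //; apply: emeasurable_funM; last exact/measurable_EFinP.
  exact: measurable_potential_kernel.
- by move=> y _; rewrite mule_ge0 ?lee_fin ?(ltW c10)// mule_ge0// lee_fin.
- exact: measurable_funeM.
exists [set 0]; split => //; first exact: dw_set1.
move=> y /= H; apply: contrapT => /eqP y0; apply: H => _.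
rewrite abseM muleA; apply: lee_wpmul2r; first exact: abse_ge0.
exact: abse_potential_kernel_le.
Qed.

Lemma dw_itv0 (rho : R) : 0 <= rho ->
  mu `]0%R, rho[ = (rho `^ (2 * alpha + 2) / (2 * alpha + 2))%:E.
Proof.
move=> r0; have a20 : 0 < 2 * alpha + 2 by rewrite (_ : _ + 2 = 2 * (alpha + 1)) ?mulr_gt0//; ring.
rewrite -(integral_powR_0 a20 r0) /dw/=; apply: eq_integral => x.
rewrite inE/= in_itv/= => /andP[x0 _]; rewrite gtr0_norm//.
by rewrite (_ : 2 * alpha + 2 - 1 = 2 * alpha + 1)//; ring.
Qed.

Lemma dw_setT_gt0 : (0 < mu [set: X])%E.
Proof.
have a20 : 0 < 2 * alpha + 2 by rewrite (_ : _ + 2 = 2 * (alpha + 1)) ?mulr_gt0//; ring.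
apply: (@lt_le_trans _ _ (mu `]0%R, 1%R[)).
  by rewrite dw_itv0// powR1 lte_fin divr_gt0.
by apply: le_measure; rewrite ?inE.
Qed.

(** The even kernel dominates the whole one, which reduces the theorem to nonnegative functions
    of norm at most [1]. To reach this case [f] is divided by numbers [N'] above its norm rather
    than by the norm, which may be [0]. Finiteness of the norm on the left makes the integral
    converge almost everywhere. *)
Lemma bounded_potential_of_heat (p q : \bar R) : (1 <= p)%E -> (1 <= q)%E ->
  (exists2 K : R, 0 <= K & forall f : X -> R, measurable_fun [set: X] f ->
     (forall x, 0 <= f x) -> ('N[mu]_p[EFin \o f] <= 1)%E -> ('N[mu]_q[HP f] <= K%:E)%E) ->
  bounded_potential alpha sigma p q.
Proof.
move=> p1 q1 [K K0 H]; exists (c1 * K) => f fL.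
have mf : measurable_fun [set: X] f by move: fL; rewrite inE => /andP[]; rewrite inE.
have Nf : ('N[mu]_p[EFin \o f] < +oo)%E.
  by move: fL; rewrite inE => /andP[_]; rewrite inE.
set N := 'N[mu]_p[EFin \o f]%E in Nf *.
have N0 : (0 <= N)%E by exact: Lnorm_ge0.
pose g y := `|f y|.
have mg : measurable_fun [set: X] g by exact: measurableT_comp.
have g0 y : 0 <= g y by exact: normr_ge0.
have mHP : measurable_fun [set: X] (HP g).
  by apply: measurable_heat_potential => //; exact: measurable_heat_kernel3.
have HP0 x : (0 <= HP g x)%E by exact: heat_potential_ge0.
have key (N' : R) : 0 < N' -> (N <= N'%:E)%E -> ('N[mu]_q[HP g] <= (K * N')%:E)%E.
  move=> N'0 NN'.
  have iN : 0 < N'^-1 by rewrite invr_gt0.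
  have := H (fun y => N'^-1 * g y).
  have -> : HP (fun y => N'^-1 * g y) = (fun x => (N'^-1)%:E * HP g x)%E.
    by apply/funext => x; apply: kernel_op_scale => //; exact: ltW.
  rewrite Lnorm_scale// muleC -lee_pdivlMr ?invr_gt0// invrK -EFinM.
  apply.
  - exact: measurable_funM.
  - by move=> y; rewrite mulr_ge0// ltW.
  rewrite (_ : EFin \o _ = (fun x => (N'^-1)%:E * (abse \o (EFin \o f)) x)%E); last first.
    by apply/funext => y /=.
  rewrite Lnorm_scale//; last by apply: measurableT_comp => //; exact/measurable_EFinP.
  by rewrite Lnorm_abse -/N lee_pdivrMl// mule1.
have NHP : ('N[mu]_q[HP g] <= K%:E * N)%E.
  have Nfin : N \is a fin_num by rewrite ge0_fin_numE.
  rewrite -(fineK Nfin) -EFinM; apply/lee_addgt0Pr => e e0.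
  have n0 : 0 <= fine N by exact: fine_ge0.
  have K1 : 0 < K + 1 by rewrite ltr_wpDl.
  have ek : 0 < e / (K + 1) by rewrite divr_gt0.
  apply: (le_trans (key (fine N + e / (K + 1)) _ _)).
  - by rewrite ltr_wpDl.
  - by rewrite -[leLHS](fineK Nfin) lee_fin lerDl ltW.
  rewrite -EFinD lee_fin mulrDr lerD2l mulrCA ler_piMr ?(ltW e0)//.
  by rewrite ler_pdivrMr// mul1r lerDl.
have fin_ae : {ae mu, forall x, (HP g x < +oo)%E}.
  apply: (@Lnorm_lty_ae _ _ _ mu (HP g) q) => //; first exact: dw_setT_gt0.
  by apply: (le_lt_trans NHP); rewrite lte_mul_pinfty.
split.
  have n0 : {ae mu, forall x : X, x != 0}.
    exists [set 0]; split => //; first exact: dw_set1.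
    by move=> x /= /negP/negPn/eqP.
  apply: filterS2 fin_ae n0 => x Hx x0; apply/integrableP; split.
    apply: emeasurable_funM; last exact/measurable_EFinP.
    exact: measurable_potential_kernel.
  apply: (le_lt_trans (integral_abse_potential_le mf x0)).
  by rewrite lte_mul_pinfty// lee_fin ltW.
apply: (@le_trans _ _ ('N[mu]_q[(fun x => c1%:E * HP g x)])%E); last first.
  rewrite Lnorm_scale// (EFinM c1 K) -muleA; apply: lee_wpmul2l => //.
  by rewrite lee_fin ltW.
apply: (@le_Lnorm_off_null _ _ _ mu _ _ q [set 0]) => //.
- exact: dw_set1.
- exact: measurable_funeM.
move=> x /eqP x0; rewrite [leRHS]gee0_abs; last by rewrite mule_ge0// lee_fin ltW.
apply: le_trans (integral_abse_potential_le mf x0).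
apply: le_abse_integral => //.
apply: emeasurable_funM; last exact/measurable_EFinP.
exact: measurable_potential_kernel.
Qed.

End operator_bound.

(** * Sufficiency *)

Section Lnorm_power.
Context {d} {T : measurableType d} {R : realType}.
Variable mu : {measure set T -> \bar R}.

Lemma integral_le1_of_Lnorm (f : T -> R) (r : R) : 1 <= r -> (forall x, 0 <= f x) ->
  ('N[mu]_r%:E[EFin \o f] <= 1)%E -> (\int[mu]_x (f x `^ r)%:E <= 1)%E.
Proof.
move=> r1 f0 N1; have r0 : 0 < r by rewrite (lt_le_trans _ r1).
have -> : (\int[mu]_x (f x `^ r)%:E = 'N[mu]_r%:E[EFin \o f] `^ r)%E.
  rewrite (poweR_Lnorm mu _ (lt0r_neq0 r0)); apply: eq_integral => x _ /=.
  by rewrite ger0_norm.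
rewrite -[leRHS](@poweR1r _ r); apply: gt0_ler_poweR => //.
- exact: (ltW r0).
- by rewrite in_itv/= leey andbT Lnorm_ge0.
- by rewrite in_itv/= leey andbT.
Qed.

Lemma Lnorm_le_of_integral (F : T -> \bar R) (s K : R) : 1 <= s -> 0 <= K ->
  (forall x, 0 <= F x)%E -> (\int[mu]_x (F x `^ s) <= K%:E)%E ->
  ('N[mu]_s%:E[F] <= (K `^ s^-1)%:E)%E.
Proof.
move=> s1 K0 F0 H; have s0 : 0 < s by rewrite (lt_le_trans _ s1).
rewrite unlock -poweR_EFin; apply: gt0_ler_poweR.
- by rewrite invr_ge0 ltW.
- by rewrite in_itv/= leey andbT; apply: integral_ge0 => x _; exact: poweR_ge0.
- by rewrite in_itv/= leey andbT lee_fin.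
by under eq_integral do rewrite gee0_abs//.
Qed.

End Lnorm_power.

Section sufficiency.
Context {R : realType}.
Variables (alpha sigma : R).
Hypotheses (alpha1 : -1 < alpha) (sigma0 : 0 < sigma).
Local Notation X := (measurableTypeR R).
Local Notation mu := (dw alpha).
Local Notation hk := (fun t (x y : X) => heat_kernel alpha t x y).

Let hk0 t (x y : X) : 0 < t -> 0 <= hk t x y.
Proof. exact: heat_kernel_ge0. Qed.

Let mhk : measurable_fun [set: (X * X) * X] (fun w => hk w.2 w.1.1 w.1.2).
Proof. exact: measurable_heat_kernel3. Qed.

Let m1 t (x : X) : 0 < t -> (\int[mu]_y (hk t x y)%:E <= 2%:E)%E.
Proof. exact: heat_kernel_marginal. Qed.

Let m2 t (y : X) : 0 < t -> (\int[mu]_x (hk t x y)%:E <= 2%:E)%E.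
Proof.
by move=> t0; under eq_integral do rewrite heat_kernelC; exact: heat_kernel_marginal.
Qed.

Let two0 : 0 < 2 :> R. Proof. by []. Qed.
Let G0 : 0 < Gamma sigma. Proof. exact: Gamma_gt0. Qed.

(** The marginals of the kernel are bounded: this settles [p = 1] and [p = +oo] directly, and
    the other exponents by interpolation. *)
Lemma bounded_potential_diag (p : \bar R) : (1 <= p)%E -> bounded_potential alpha sigma p p.
Proof.
move=> p1; apply: bounded_potential_of_heat => //.
case: p p1 => [p p1|_|//]; last first.
  exists (2 * Gamma sigma) => [|f mf f0]; first by rewrite mulr_ge0// ltW.
  rewrite unlock dw_setT_gt0// => /ess_supP f1.
  apply/ess_supP; apply: nearW => x /=.
  rewrite gee0_abs; last exact: heat_potential_ge0.
  apply: le_trans (heat_potential_marginal_y mhk hk0 m1 two0 sigma0 x).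
  rewrite /heat_potential /kernel_op.
  have mTK : measurable_fun [set: X] (fun y => time_kernel hk sigma `]0%R, +oo[ (x, y)).
    by apply: measurable_partial1; exact: measurable_time_kernel.
  have TK0 y : (0 <= time_kernel hk sigma `]0%R, +oo[ (x, y))%E by exact: time_kernel_ge0.
  apply: ae_ge0_le_integral => //.
  - by move=> y _; rewrite mule_ge0// lee_fin.
  - by apply: emeasurable_funM => //; exact/measurable_EFinP.
  apply: filterS f1 => y /= fy _.
  rewrite -[leRHS]mule1; apply: lee_wpmul2l => //.
  by rewrite (le_trans _ fy)// lee_fin ler_norm.
rewrite lee_fin in p1.
have [p2|p2] := eqVneq p 1.
  rewrite p2; exists (2 * Gamma sigma) => [|f mf f0]; first by rewrite mulr_ge0// ltW.
  rewrite !Lnorm1 => f1.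
  under eq_integral do rewrite gee0_abs ?heat_potential_ge0//.
  apply: (le_trans (heat_potential_L1 mhk hk0 m2 two0 sigma0 mf f0)).
  rewrite -[leRHS]mule1; apply: lee_wpmul2l; first by rewrite lee_fin mulr_ge0// ltW.
  apply: le_trans f1; rewrite le_eqVlt; apply/orP; left; apply/eqP.
  by apply: eq_integral => x _ /=; rewrite ger0_norm.
have {p2}p1' : 1 < p by rewrite lt_neqAle eq_sym p2.
pose K := (3 * (2 * Gamma sigma)) `^ p * (p / (p - 1)).
have K0 : 0 <= K.
  by rewrite mulr_ge0 ?powR_ge0// divr_ge0 ?subr_ge0// ltW// (lt_trans _ p1').
exists (K `^ p^-1) => [|f mf f0 Nf]; first exact: powR_ge0.
apply: Lnorm_le_of_integral => //; first by move=> x; exact: heat_potential_ge0.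
apply: (le_trans (heat_potential_Lp mhk hk0 m1 m2 two0 sigma0 p1' mf f0)).
rewrite -[leRHS]mule1; apply: lee_wpmul2l; first by rewrite lee_fin.
exact: integral_le1_of_Lnorm.
Qed.

Lemma bounded_potential_offdiag (p q : \bar R) : - 2^-1 <= alpha ->
  (1 <= p)%E -> (1 <= q)%E -> p != q ->
  (p^-1 - (sigma / (alpha + 1))%:E <= q^-1)%E -> (q^-1 <= p^-1)%E ->
  (p^-1, q^-1)%E <> ((sigma / (alpha + 1))%:E, 0%E) ->
  (p^-1, q^-1)%E <> (1%E, (1 - sigma / (alpha + 1))%:E) ->
  bounded_potential alpha sigma p q.
Proof.
move=> a2 p1 q1 pq H1 H2 H3 H4.
have D0 : 0 < alpha + 1 by rewrite -ltrBlDr sub0r.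
have C0 := heat_const_gt0 alpha1.
have hC t (x y : X) : 0 < t -> hk t x y <= heat_const alpha * t `^ (- (alpha + 1)).
  exact: heat_kernel_le.
apply: bounded_potential_of_heat => //.
case: p p1 pq H1 H2 H3 H4 => [p p1|_|//]; last first.
  case: q q1 => [q|_|//]; last by rewrite eqxx.
  rewrite lee_fin => q1 _; have q0 : 0 < q by rewrite (lt_le_trans _ q1).
  move=> _; rewrite inver invey gt_eqF// (lee_fin q^-1 0) invr_le0 => H.
  by move: (lt_le_trans q0 H); rewrite ltxx.
rewrite lee_fin in p1; have p0 : 0 < p by rewrite (lt_le_trans _ p1).
case: q q1 => [q|_|//].
  rewrite lee_fin => q1; have q0 : 0 < q by rewrite (lt_le_trans _ q1).
  rewrite eqe !inver (gt_eqF p0) (gt_eqF q0) -EFinB !lee_fin => pq H1 H2 H3 H4.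
  have {pq}pq : p < q.
    by rewrite lt_neqAle pq -lef_pV2 ?posrE.
  have [p2|p2] := eqVneq p 1.
    have H5 : 1 - sigma / (alpha + 1) < q^-1.
      rewrite lt_neqAle; apply/andP; split; last by move: H1; rewrite p2 invr1.
      by apply/eqP => E; apply: H4; rewrite p2 invr1 -E.
    rewrite p2 in pq *.
    have [K K0 HK] := heat_potential_L1Lq mhk hk0 m1 m2 two0 sigma0 C0 D0 hC pq H5.
    exists (K `^ q^-1) => [|f mf f0 Nf]; first exact: powR_ge0.
    apply: Lnorm_le_of_integral => //; first by move=> x; exact: heat_potential_ge0.
    apply: HK => //; apply: le_trans (integral_le1_of_Lnorm (lexx 1) f0 Nf).
    by under [leRHS]eq_integral do rewrite powRr1//.
  have p1' : 1 < p by rewrite lt_neqAle eq_sym p2.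
  have [K K0 HK] := heat_potential_LpLq mhk hk0 m1 m2 two0 sigma0 C0 D0 hC p1' pq H1.
  exists (K `^ q^-1) => [|f mf f0 Nf]; first exact: powR_ge0.
  apply: Lnorm_le_of_integral => //; first by move=> x; exact: heat_potential_ge0.
  by apply: HK => //; exact: integral_le1_of_Lnorm.
rewrite invey inver (gt_eqF p0) -EFinB lee_fin => _ H1 _ H3 _.
have H5 : (alpha + 1) / p < sigma.
  have H6 : p^-1 < sigma / (alpha + 1).
    rewrite lt_neqAle -subr_le0 H1 andbT; apply/eqP => E; apply: H3; by rewrite E.
  by rewrite mulrC -ltr_pdivlMr.
exists ((2 + 1) * heat_const alpha `^ p^-1 * Gamma (sigma - (alpha + 1) / p)) => [|f mf f0 Nf].
  by apply: mulr_ge0; [rewrite mulr_ge0 ?powR_ge0|apply/ltW/Gamma_gt0; rewrite subr_gt0].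
rewrite unlock dw_setT_gt0//; apply/ess_supP; apply: nearW => x /=.
rewrite gee0_abs; last exact: heat_potential_ge0.
apply: (heat_potential_Linfty mhk hk0 m1 two0 C0 hC) => //.
exact: integral_le1_of_Lnorm.
Qed.

End sufficiency.

(** * Norms of test functions and comparison of powers *)

Section Lnorm_test.
Context {d} {T : measurableType d} {R : realType}.
Variable mu : {measure set T -> \bar R}.
Implicit Types (A : set T) (p q : \bar R) (m c : R).

(** As [fine (+oo^-1) = 0], the same formula covers all exponents. *)
Lemma Lnorm_indic_le p A m : (1 <= p)%E -> measurable A -> 0 < m ->
  (mu A <= m%:E)%E -> ('N[mu]_p[EFin \o (\1_A : T -> R)] <= (m `^ fine p^-1)%:E)%E.
Proof.
case: p => [p|_|//] => [p1|] mA m0 Am.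
  rewrite lee_fin in p1; have p0 : 0 < p by rewrite (lt_le_trans _ p1).
  rewrite inver (gt_eqF p0) [fine _]/= unlock -poweR_EFin.
  apply: gt0_ler_poweR; [by rewrite invr_ge0 ltW| | |].
  - by rewrite in_itv/= leey andbT; apply: integral_ge0 => x _; rewrite lee_fin powR_ge0.
  - by rewrite in_itv/= leey andbT lee_fin (ltW m0).
  rewrite (_ : (\int[mu]_x _ = mu A)%E)//.
  rewrite -[in RHS](setIT A) -(integral_indic mu measurableT mA); apply: eq_integral => x _ /=; rewrite indicE.
  by case: (x \in A); rewrite ?normr1 ?normr0 ?powR1// powR0// gt_eqF.
rewrite invey /= powRr0 unlock; case: ifP => // _.
apply/ess_supP; apply: nearW => x /=.
by rewrite lee_fin indicE; case: (x \in A); rewrite ?normr1 ?normr0.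
Qed.

Lemma le_Lnorm_const_on (F : T -> \bar R) q A m c : (1 <= q)%E -> measurable A -> 0 < m ->
  (m%:E <= mu A)%E -> 0 <= c -> (forall x, A x -> c%:E <= `|F x|)%E ->
  ((c * m `^ fine q^-1)%:E <= 'N[mu]_q[F])%E.
Proof.
case: q => [q|_|//] => [q1|] mA m0 Am c0 FA.
  rewrite lee_fin in q1; have q0 : 0 < q by rewrite (lt_le_trans _ q1).
  rewrite inver (gt_eqF q0) /= unlock.
  have -> : c * m `^ q^-1 = (c `^ q * m) `^ q^-1.
    by rewrite powRM ?powR_ge0 ?(ltW m0)// -powRrM divff ?gt_eqF// powRr1.
  rewrite -poweR_EFin; apply: gt0_ler_poweR; rewrite ?invr_ge0 ?(ltW q0)//.
  - by rewrite in_itv/= leey andbT lee_fin mulr_ge0 ?powR_ge0 ?(ltW m0).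
  - by rewrite in_itv/= leey andbT; apply: integral_ge0 => x _; exact: poweR_ge0.
  apply: (@le_trans _ _ (\int[mu]_(x in A) (c `^ q)%:E)%E).
    by rewrite integral_cst// EFinM; apply: lee_wpmul2l; rewrite ?lee_fin ?powR_ge0.
  apply: le_integral_nonnegS => // x; first by move=> _; exact: poweR_ge0.
  move=> Ax; rewrite lee_fin powR_ge0/= -poweR_EFin.
  apply: gt0_ler_poweR; rewrite ?(ltW q0)// ?in_itv/= ?leey ?andbT ?lee_fin ?abse_ge0//.
  exact: FA.
have muA : (0 < mu A)%E by apply: (lt_le_trans _ Am); rewrite lte_fin.
rewrite invey /= powRr0 mulr1 unlock ifT; last first.
  by apply: (lt_le_trans muA); apply: le_measure; rewrite ?inE.
rewrite leNgt; apply/negP => H.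
have [N [mN N0 HN]] := ess_sup_ge mu (abse \o F).
have : (mu A <= mu N)%E.
  apply: le_measure; rewrite ?inE// => x Ax; apply: HN => /= Fx.
  by move: (le_lt_trans (le_trans (FA x Ax) Fx) H); rewrite ltxx.
by rewrite N0 leNgt muA.
Qed.

End Lnorm_test.

Section growth.
Context {R : realType}.
Implicit Types a b c C L : R.

Lemma powR_growth a b c C L0 : 0 < c -> 0 < L0 ->
  (forall L, L0 <= L -> c * L `^ a <= C * L `^ b) -> a <= b.
Proof.
move=> c0 L00 H; rewrite leNgt; apply/negP => ba.
have dd : 0 < a - b by rewrite subr_gt0.
have C0 : 0 < C.
  have := H L0 (lexx _); have := powR_gt0 a L00; have := powR_gt0 b L00.
  move=> h1 h2 h3; rewrite -(pmulr_lgt0 _ h1).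
  by apply: lt_le_trans h3; rewrite mulr_gt0.
pose L := Num.max L0 ((2 * C / c) `^ (a - b)^-1).
have k0 : 0 < 2 * C / c by rewrite divr_gt0// mulr_gt0.
have L0L : L0 <= L by rewrite le_max lexx.
have Lp : 0 < L by rewrite (lt_le_trans L00).
have := H L L0L; rewrite -{1}(subrK b a) (powRD_gt0 _ _ Lp) mulrA ler_pM2r ?powR_gt0//.
apply/negP; rewrite -ltNge.
have : 2 * C / c <= L `^ (a - b).
  have -> : 2 * C / c = ((2 * C / c) `^ (a - b)^-1) `^ (a - b).
    by rewrite -powRrM mulVf ?lt0r_neq0// powRr1 ?(ltW k0).
  rewrite ge0_ler_powR ?nnegrE ?powR_ge0 ?(ltW dd) ?(ltW Lp)//.
  by rewrite le_max lexx orbT.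
rewrite ler_pdivrMr// [leRHS]mulrC => h; apply: lt_le_trans h.
by rewrite ltr_pMl// ltr1n.
Qed.

Lemma integral_inv a b : 0 < a -> a < b ->
  (\int[lebesgue_measure]_(y in `[a, b]) (y `^ (-1))%:E = (ln b - ln a)%:E)%E.
Proof.
move=> a0 ab.
have pos y : a <= y -> 0 < y by exact: lt_le_trans.
have dl (y : R) : a <= y -> is_derive y 1 (@ln R) y^-1 by move=> /pos; exact: is_derive1_ln.
rewrite (@continuous_FTC2 R (fun y => y `^ (-1)) (@ln R) a b)//.
- apply: continuous_in_subspaceT => y; rewrite inE/= in_itv/= => /andP[ay _].
  exact: continuous_powR (pos _ ay).
- split.
  + by move=> y; rewrite in_itv/= => /andP[/ltW ay _]; have [] := dl _ ay.
  + apply: cvg_at_right_filter; exact: continuous_ln.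
  + apply: cvg_at_left_filter; apply: continuous_ln; exact: lt_trans ab.
- move=> y; rewrite in_itv/= => /andP[/ltW ay _].
  rewrite derive1E (@derive_val _ _ _ _ _ _ _ (dl _ ay)).
  by rewrite powR_inv1// (ltW (pos _ ay)).
Qed.

End growth.

(** * Lower bounds for the potential kernel *)

Section lower_bounds.
Context {R : realType}.
Variables (alpha sigma : R).
Hypotheses (alpha1 : -1 < alpha) (sigma0 : 0 < sigma).
Local Notation X := (measurableTypeR R).
Local Notation leb := (@lebesgue_measure R).
Local Notation mu := (dw alpha).
Local Notation hk := (fun t (x y : X) => heat_kernel alpha t x y).
Local Notation halfline := (`]0%R, +oo[%classic : set X).
Local Notation pk := (potential_kernel alpha sigma).
Local Notation TK E x y := (time_kernel hk sigma E (x, y)).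

Let g0 : 0 < (2 * Gamma sigma)^-1. Proof. by rewrite invr_gt0 mulr_gt0// Gamma_gt0. Qed.

Let hk0 t (x y : X) : 0 < t -> 0 <= hk t x y.
Proof. exact: heat_kernel_ge0. Qed.

Lemma potential_kernel_ge (E : set X) x y : measurable E -> E `<=` halfline ->
  0 < x -> 0 < y -> ((2 * Gamma sigma)^-1%:E * TK E x y <= pk x y)%E.
Proof.
move=> mE E0 x0 y0; have Et t : E t -> 0 < t by move=> /E0; rewrite /= in_itv/= andbT.
rewrite /potential_kernel invfM mulrC EFinM -muleA; apply: lee_wpmul2l.
  by rewrite lee_fin invr_ge0 ltW// Gamma_gt0.
rewrite /time_kernel -ge0_integralZl; [|by []| | |by rewrite lee_fin]; last 2 first.
- apply/measurable_EFinP; apply: measurable_funM.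
    apply: measurable_funM; first exact: measurable_powRl.
    by apply: measurable_funTS; exact: measurable_expRN.
  apply: measurable_funTS.
  exact: (measurable_partial1 (x, y) (measurable_heat_kernel3 alpha1)).
- by move=> t /Et t0; rewrite lee_fin mulr_ge0 ?heat_kernel_ge0// mulr_ge0 ?powR_ge0 ?expR_ge0.
have D t : 0 < t -> 0 <= 2^-1 * heat_kernel alpha t x y <= dunkl_heat alpha t x y.
  by move=> t0; rewrite mulr_ge0 ?heat_kernel_ge0//= dunkl_heat_ge.
apply: le_integral_nonnegS => // t.
  rewrite /= in_itv/= andbT => t0; have /andP[h1 h2] := D t t0.
  by rewrite lee_fin mulr_ge0 ?powR_ge0// mulr_ge0 ?expR_ge0// (le_trans h1).
move=> /Et t0; have /andP[h1 h2] := D t t0.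
rewrite -EFinM !lee_fin; apply/andP; split.
  apply: mulr_ge0 => //; apply: mulr_ge0; last exact: hk0.
  by rewrite mulr_ge0 ?powR_ge0 ?expR_ge0.
rewrite [leLHS](_ : _ = expR (- t) * (2^-1 * heat_kernel alpha t x y) * t `^ (sigma - 1)); last by ring.
by apply: ler_wpM2r; [exact: powR_ge0|apply: ler_wpM2l; [exact: expR_ge0|]].
Qed.

Lemma potential_kernel_ge0 x y : 0 < x -> 0 < y -> (0 <= pk x y)%E.
Proof.
move=> x0 y0; apply: le_trans (@potential_kernel_ge halfline _ _ _ _ x0 y0) => //.
by rewrite mule_ge0 ?lee_fin ?(ltW g0)//; exact: time_kernel_ge0.
Qed.

(** The kernel is nonnegative on the open quadrant, so any part of the integral may be
    discarded. *)
Lemma potential_ge (f : X -> R) (g : X -> \bar R) (E : set X) x : 0 < x ->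
  (forall y, 0 <= f y) -> (forall y, y <= 0 -> f y = 0) ->
  (forall y, E y -> 0 <= g y <= pk x y * (f y)%:E)%E ->
  (\int[mu]_(y in E) g y <= potential alpha sigma f x)%E.
Proof.
move=> x0 f0 fs gE; apply: le_integral_nonnegS => // y _.
have [y0|y0] := leP y 0; first by rewrite fs// mule0.
by rewrite mule_ge0 ?lee_fin// potential_kernel_ge0.
Qed.

Let gamma : R := sigma - (alpha + 1).
(* At times [r ^+ 2 <= t <= 2] the Gaussian factor is at least [expR (- 1)] for [x, y <= r], and
   [expR (- t)] is at least [expR (- 2)]. *)
Let k0 : R := heat_const alpha * expR (- 3).
Let k00 : 0 < k0. Proof. by rewrite mulr_gt0 ?expR_gt0// heat_const_gt0. Qed.

Let time_density_ge r t x y : 0 < r -> r <= 1 -> 0 < x -> x <= r -> 0 < y -> y <= r ->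
  r ^+ 2 <= t -> t <= 2 ->
  k0 * t `^ (gamma - 1) <= t `^ (sigma - 1) * expR (- t) * hk t x y.
Proof.
move=> r0 r1 x0 xr y0 yr rt t2; have t0 : 0 < t by rewrite (lt_le_trans _ rt)// exprn_gt0.
have := heat_kernel_ge x y alpha1 t0 => /(ler_wpM2l _) H.
apply: le_trans (H (t `^ (sigma - 1) * expR (- t)) _); last first.
  by rewrite mulr_ge0 ?powR_ge0 ?expR_ge0.
have -> : gamma - 1 = (sigma - 1) + (- (alpha + 1)) by rewrite /gamma; ring.
rewrite (powRD_gt0 _ _ t0) /k0.
rewrite [leRHS](_ : _ = heat_const alpha * expR (- t + - ((x ^+ 2 + y ^+ 2) / (4 * t))) *
  (t `^ (sigma - 1) * t `^ (- (alpha + 1)))); last by rewrite expRD; ring.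
rewrite ler_wpM2r ?mulr_ge0 ?powR_ge0// ler_wpM2l ?(ltW (heat_const_gt0 alpha1))// ler_expR.
rewrite -opprD lerN2 (_ : 3 = 2 + 1 :> R); last by ring.
apply: lerD => //; rewrite ler_pdivrMr ?mulr_gt0// mul1r.
have h1 : x ^+ 2 <= r ^+ 2 by rewrite ler_pXn2r ?nnegrE ?(ltW x0) ?(ltW r0).
have h2 : y ^+ 2 <= r ^+ 2 by rewrite ler_pXn2r ?nnegrE ?(ltW y0) ?(ltW r0).
by lra.
Qed.

Let time_kernel_near_ge r b x y : 0 < r -> r <= 1 -> 0 < x -> x <= r -> 0 < y -> y <= r ->
  b <= 2 ->
  (k0%:E * \int[leb]_(t in `[(r ^+ 2)%R, b]) (t `^ (gamma - 1))%:E <=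
   TK `[(r ^+ 2)%R, b] x y)%E.
Proof.
move=> r0 r1 x0 xr y0 yr b2; rewrite -ge0_integralZl//; last 3 first.
- by apply/measurable_EFinP; exact: measurable_powRl.
- by move=> t _; rewrite lee_fin powR_ge0.
- by rewrite lee_fin ltW.
apply: le_integral_nonneg => t; rewrite /= in_itv/= => /andP[rt tb].
  by rewrite -EFinM lee_fin mulr_ge0 ?powR_ge0 ?(ltW k00).
by rewrite -EFinM lee_fin; apply: (@time_density_ge r) => //; exact: le_trans tb b2.
Qed.

Let sub_halfline (r b : R) : 0 < r -> `[r ^+ 2, b]%classic `<=` halfline.
Proof.
move=> r0 t; rewrite /= !in_itv/= andbT => /andP[rt _].
by rewrite (lt_le_trans _ rt)// exprn_gt0.
Qed.

(** Only the times between [r ^+ 2] and [2 * r ^+ 2] are used: for them the heat kernel is of the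
    order of [r `^ (- (2 * (alpha + 1)))]. *)
Lemma potential_kernel_near_ge : exists2 c : R, 0 < c & forall r x y,
  0 < r -> r <= 1 -> 0 < x -> x <= r -> 0 < y -> y <= r ->
  ((c * r `^ (2 * gamma))%:E <= pk x y)%E.
Proof.
pose m : R := 2 `^ (- `|gamma - 1|).
have m0 : 0 < m by exact: powR_gt0.
exists ((2 * Gamma sigma)^-1 * (k0 * m)) => [|r x y r0 r1 x0 xr y0 yr].
  by rewrite mulr_gt0// mulr_gt0.
have r20 : 0 < r ^+ 2 by rewrite exprn_gt0.
apply: le_trans (potential_kernel_ge _ (@sub_halfline r (2 * r ^+ 2) r0) x0 y0); last by [].
rewrite -mulrA EFinM; apply: lee_wpmul2l; first by rewrite lee_fin ltW.
apply: le_trans (time_kernel_near_ge _ _ _ _ _ _ _) => //; last first.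
  by rewrite ler_piMr// exprn_ile1// ltW.
rewrite -mulrA EFinM; apply: lee_wpmul2l; first by rewrite lee_fin ltW.
have -> : r `^ (2 * gamma) = (r ^+ 2) `^ (gamma - 1) * r ^+ 2.
  rewrite -(powR_mulrn _ (ltW r0)) -powRrM -powRD_gt0//; congr (_ `^ _); ring.
apply: (@le_trans _ _ (\int[leb]_(t in `[(r ^+ 2)%R, (2 * r ^+ 2)%R]) (m * (r ^+ 2) `^ (gamma - 1))%:E)%E).
  rewrite integral_cst//.
  have lm : leb `[(r ^+ 2)%R, (2 * r ^+ 2)%R]%classic = (r ^+ 2)%:E.
    rewrite lebesgue_measure_itv/= lte_fin ltr_pMl// ltr1n -EFinB.
    by congr EFin; ring.
  by rewrite [X in (_ * X)%E]lm -EFinM lee_fin mulrA.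
apply: le_integral_nonneg => t; first by rewrite lee_fin mulr_ge0 ?powR_ge0// ltW.
rewrite /= in_itv/= lee_fin => /andP[rt tr].
have q1 : 1 <= t / r ^+ 2 by rewrite ler_pdivlMr// mul1r.
have q2 : t / r ^+ 2 <= 2 by rewrite ler_pdivrMr.
have -> : t = (t / r ^+ 2) * r ^+ 2 by rewrite divfK// gt_eqF.
have q0 : 0 < t / r ^+ 2 by rewrite (lt_le_trans _ q1).
rewrite (powRM _ (ltW q0) (ltW r20)) ler_wpM2r ?powR_ge0// /m.
apply: (@le_trans _ _ ((t / r ^+ 2) `^ (- `|gamma - 1|))).
  by apply: ler_powR_neg; rewrite ?oppr_le0.
by apply: ler_powR => //; rewrite lerNl -normrN ler_norm.
Qed.

(** In the critical case the density in time is [t `^ (- 1)], and the times between [r ^+ 2] and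
    [1] add up to a logarithm. *)
Lemma potential_kernel_log_ge : sigma = alpha + 1 -> exists2 c : R, 0 < c & forall r x y,
  0 < r -> r < 1 -> 0 < x -> x <= r -> 0 < y -> y <= r ->
  ((c * ln r^-1)%:E <= pk x y)%E.
Proof.
move=> cr; exists ((2 * Gamma sigma)^-1 * (k0 * 2)) => [|r x y r0 r1 x0 xr y0 yr].
  by rewrite mulr_gt0// mulr_gt0.
have r20 : 0 < r ^+ 2 by rewrite exprn_gt0.
have r21 : r ^+ 2 < 1 by rewrite exprn_ilt1 ?ltW.
apply: le_trans (potential_kernel_ge _ (@sub_halfline r 1 r0) x0 y0); last by [].
rewrite -mulrA EFinM; apply: lee_wpmul2l; first by rewrite lee_fin ltW.
apply: le_trans (time_kernel_near_ge _ _ _ _ _ _ _) => //; last 2 first.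
- by rewrite ltW.
- by rewrite ler1n.
rewrite -mulrA EFinM; apply: lee_wpmul2l; first by rewrite lee_fin ltW.
rewrite /gamma cr subrr sub0r integral_inv// ln1 sub0r lee_fin lnV ?posrE//.
by rewrite lnXn// mulr2n; lra.
Qed.

End lower_bounds.

(** * Measures of intervals and localization *)

Section necessity.
Context {R : realType}.
Variables (alpha sigma : R).
Hypotheses (alpha1 : -1 < alpha) (sigma0 : 0 < sigma).
Local Notation X := (measurableTypeR R).
Local Notation leb := (@lebesgue_measure R).
Local Notation mu := (dw alpha).
Local Notation hk := (fun t (x y : X) => heat_kernel alpha t x y).
Local Notation halfline := (`]0%R, +oo[%classic : set X).
Local Notation TK E x y := (time_kernel hk sigma E (x, y)).
Local Notation D := (2 * alpha + 2).

Lemma dim_gt0 : 0 < D.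
Proof. by rewrite (_ : D = 2 * (alpha + 1)); [rewrite mulr_gt0// -ltrBlDr sub0r|ring]. Qed.

Let hk0 t (x y : X) : 0 < t -> 0 <= hk t x y.
Proof. exact: heat_kernel_ge0. Qed.

Lemma integral_dw_pos (E : set X) (f : X -> R) : measurable E -> E `<=` halfline ->
  measurable_fun E f -> (forall x, E x -> 0 <= f x) ->
  (\int[mu]_(x in E) (f x)%:E = \int[leb]_(x in E) (f x * x `^ (2 * alpha + 1))%:E)%E.
Proof.
move=> mE E0 mf f0; rewrite integral_dw; [|exact: mE|exact/measurable_EFinP|by move=> x Ex; rewrite lee_fin f0].
apply: eq_integral => x /set_mem /E0; rewrite /= in_itv/= andbT => x0.
by rewrite -EFinM gtr0_norm.
Qed.

Lemma dw_pos (E : set X) : measurable E -> E `<=` halfline ->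
  (mu E = \int[leb]_(x in E) (x `^ (2 * alpha + 1))%:E)%E.
Proof.
move=> mE E0; rewrite /dw/=; apply: eq_integral => x /set_mem /E0.
by rewrite /= in_itv/= andbT => x0; rewrite gtr0_norm.
Qed.

Lemma itvcc_sub_halfline a b : 0 < a -> `[a, b]%classic `<=` halfline.
Proof.
by move=> a0 x; rewrite /= !in_itv/= andbT => /andP[ax _]; exact: lt_le_trans ax.
Qed.

Lemma dw_itvcc a b : 0 < a -> a < b -> mu `[a, b]%classic = ((b `^ D - a `^ D) / D)%:E.
Proof.
move=> a0 ab; rewrite dw_pos//; last exact: itvcc_sub_halfline.
rewrite -(integral_powR_cc (lt0r_neq0 dim_gt0) a0 ab).
by apply: eq_integral => x _; congr (_ `^ _)%:E; ring.
Qed.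

Lemma dw_itv_scale u v : 0 < u -> u < v -> exists2 k : R, 0 < k &
  forall L, 0 < L -> mu `[u * L, v * L]%classic = (k * L `^ D)%:E.
Proof.
have D0 := dim_gt0; move=> u0 uv; have v0 : 0 < v by exact: lt_trans uv.
exists ((v `^ D - u `^ D) / D) => [|L L0].
  rewrite divr_gt0// subr_gt0; apply: gt0_ltr_powR => //; rewrite nnegrE ltW//.
rewrite dw_itvcc ?mulr_gt0 ?ltr_pM2r//; congr EFin.
rewrite !powRM ?(ltW u0) ?(ltW v0) ?(ltW L0)//; field.
exact: (lt0r_neq0 dim_gt0).
Qed.

Lemma dw_itv_half : exists2 k : R, 0 < k &
  forall L, 0 < L -> mu `[2^-1 * L, 1 * L]%classic = (k * L `^ D)%:E.
Proof. by apply: dw_itv_scale; rewrite ?invr_gt0// invf_lt1// ltr1n. Qed.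

Lemma dw_itv_le a b M : 0 < a -> a < b -> (forall x, a <= x -> x <= b -> x `^ (2 * alpha + 1) <= M) ->
  (mu `[a, b]%classic <= (M * (b - a))%:E)%E.
Proof.
move=> a0 ab H; rewrite dw_pos//; last exact: itvcc_sub_halfline.
have lm : leb `[a, b]%classic = (b - a)%:E by rewrite lebesgue_measure_itv/= lte_fin ab.
apply: (@le_trans _ _ (\int[leb]_(x in `[a, b]) M%:E)%E); last first.
  by rewrite integral_cst// [X in (_ * X)%E]lm.
apply: le_integral_nonneg => x; first by rewrite lee_fin powR_ge0.
by rewrite /= in_itv/= lee_fin => /andP[]; exact: H.
Qed.

Lemma dw_itv_ge a b M : 0 < a -> a < b -> 0 <= M ->
  (forall x, a <= x -> x <= b -> M <= x `^ (2 * alpha + 1)) ->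
  ((M * (b - a))%:E <= mu `[a, b]%classic)%E.
Proof.
move=> a0 ab M0 H; rewrite dw_pos//; last exact: itvcc_sub_halfline.
have lm : leb `[a, b]%classic = (b - a)%:E by rewrite lebesgue_measure_itv/= lte_fin ab.
apply: (@le_trans _ _ (\int[leb]_(x in `[a, b]) M%:E)%E).
  by rewrite integral_cst// [X in (_ * X)%E]lm.
apply: le_integral_nonneg => x; first by rewrite lee_fin.
by rewrite /= in_itv/= lee_fin => /andP[]; exact: H.
Qed.

(** Small times alone give a bound that is uniform in [x], since for them the mass of the heat
    kernel stays near [x]. *)
Lemma potential_localization : exists2 c : R, 0 < c & forall (A : set X) x,
  measurable A -> A `<=` halfline -> 1 <= x -> `](x - 4^-1)%R, (x + 4^-1)%R[ `<=` A ->
  (c%:E <= potential alpha sigma (\1_A : X -> R) x)%E.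
Proof.
have [t0 t00 H] := heat_kernel_localization alpha1.
pose s0 : R := 2^-1 * (expR (- t0) * (t0 `^ sigma / sigma)).
have e00 : 0 <= 2^-1 * expR (- t0) by rewrite mulr_ge0 ?expR_ge0// invr_ge0.
have s00 : 0 < s0 by rewrite mulr_gt0// mulr_gt0 ?expR_gt0// divr_gt0// powR_gt0.
have G0 : 0 < (2 * Gamma sigma)^-1 by rewrite invr_gt0 mulr_gt0// Gamma_gt0.
exists ((2 * Gamma sigma)^-1 * s0) => [|A x mA A0 x1 BA]; first by rewrite mulr_gt0.
have x0 : 0 < x by rewrite (lt_le_trans _ x1).
pose E : set X := `]0%R, t0]%classic.
have E0 : E `<=` halfline by move=> t; rewrite /E/= !in_itv/= andbT => /andP[].
have mE : measurable E by exact: measurable_itv.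
have indic0 y : 0 <= (\1_A : X -> R) y by [].
apply: (@le_trans _ _ (\int[mu]_y ((2 * Gamma sigma)^-1%:E * (TK E x y * (\1_A y : R)%:E)))%E); last first.
  have TK0 y : (0 <= TK E x y)%E by apply: time_kernel_ge0.
  apply: (@potential_ge _ _ _ alpha1 sigma0 _ _ _ x x0 indic0) => [y y0|y _].
    by rewrite indicE memNset// => /A0; rewrite /= in_itv/= andbT ltNge y0.
  rewrite mule_ge0 ?mule_ge0 ?lee_fin ?(ltW G0)//= muleA.
  rewrite indicE; case: (boolP (y \in A)) => [|_]; last by rewrite !mule0.
  move=> /set_mem /A0; rewrite /= in_itv/= andbT => y0.
  by rewrite !mule1 potential_kernel_ge.
have mTK : measurable_fun [set: X * X] (fun z => time_kernel hk sigma E z).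
  by apply: measurable_time_kernel => //; exact: measurable_heat_kernel3.
rewrite ge0_integralZl; last 4 first.
- exact: measurableT.
- apply: emeasurable_funM; first exact: (measurable_partial1 x mTK).
  by apply/measurable_EFinP; exact: measurable_indic.
- by move=> y _; rewrite mule_ge0 ?lee_fin//; exact: time_kernel_ge0.
- by rewrite lee_fin ltW.
rewrite EFinM; apply: lee_wpmul2l; first by rewrite lee_fin ltW.
rewrite (@time_integral_fubini _ _ _ mu sigma E (fun t y => hk t x y) (\1_A))//; last 2 first.
- exact: (measurable_slice_y (measurable_heat_kernel3 alpha1) x).
- by move=> t y; exact: hk0.
apply: (@le_trans _ _ (\int[leb]_(t in E) ((2^-1 * expR (- t0)) * t `^ (sigma - 1))%:E)%E).
  under eq_integral do rewrite EFinM.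
  rewrite ge0_integralZl; [|exact: mE|by apply/measurable_EFinP; exact: measurable_powRl
    |by move=> t _; rewrite lee_fin powR_ge0|by rewrite lee_fin].
  have -> : s0 = (2^-1 * expR (- t0)) * (t0 `^ sigma / sigma) by rewrite /s0 -[RHS]mulrA.
  rewrite [leLHS]EFinM; apply: lee_wpmul2l; first by rewrite lee_fin.
  rewrite -(integral_powR_0 sigma0 (ltW t00)); apply: le_integral_nonnegS => // t.
  - by rewrite /E/= !in_itv/= => /andP[-> /ltW ->].
  - by move=> _; rewrite lee_fin powR_ge0.
  - by move=> _; rewrite lee_fin powR_ge0 lexx.
apply: le_integral_nonneg => t.
  by rewrite lee_fin mulr_ge0 ?powR_ge0.
rewrite /E/= in_itv/= => /andP[tp tt].
apply: (@le_trans _ _ ((t `^ (sigma - 1) * expR (- t))%:E * 2^-1%:E)%E).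
  rewrite -EFinM lee_fin [leRHS](_ : _ = 2^-1 * expR (- t) * t `^ (sigma - 1)); last by ring.
  by rewrite ler_wpM2r ?powR_ge0// ler_wpM2l// ler_expR lerN2.
apply: lee_wpmul2l; first by rewrite lee_fin mulr_ge0 ?powR_ge0 ?expR_ge0.
apply: (le_trans (H t x tp tt x1)).
have B0 : `](x - 4^-1)%R, (x + 4^-1)%R[ `<=` halfline by exact: subset_trans BA A0.
rewrite -integral_dw_pos//; last 2 first.
- exact: measurable_heat_kernelr.
- by move=> y _; exact: hk0.
apply: le_integral_nonnegS => // y; first by move=> _; rewrite lee_fin mulr_ge0// hk0.
move=> By; rewrite lee_fin hk0//= lee_fin indicE mem_set ?mulr1//; exact: BA.
Qed.

End necessity.

(** * Necessary conditions *)

Section necessary_conditions.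
Context {R : realType}.
Variables (alpha sigma : R).
Hypotheses (alpha1 : -1 < alpha) (sigma0 : 0 < sigma).
Local Notation X := (measurableTypeR R).
Local Notation mu := (dw alpha).
Local Notation halfline := (`]0%R, +oo[%classic : set X).
Local Notation pk := (potential_kernel alpha sigma).
Local Notation D := (2 * alpha + 2).
Variables (p q : \bar R).
Hypotheses (p1 : (1 <= p)%E) (q1 : (1 <= q)%E).
Hypothesis bounded : bounded_potential alpha sigma p q.

Let D0 : 0 < D. Proof. exact: dim_gt0. Qed.

Lemma bounded_potential_test : exists2 C : R, 0 <= C & forall (f : X -> R) (M : R),
  measurable_fun [set: X] f -> ('N[mu]_p[EFin \o f] <= M%:E)%E ->
  ('N[mu]_q[potential alpha sigma f] <= (C * M)%:E)%E.
Proof.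
have [C H] := bounded; exists `|C| => // f M mf fM.
have fL : f \in Lfun mu p.
  by rewrite inE; apply/andP; split; rewrite inE//=; exact: le_lt_trans fM (ltry _).
have [_ /le_trans] := H f fL; apply.
rewrite EFinM; apply: (@le_trans _ _ (`|C|%:E * 'N[mu]_p[EFin \o f])%E).
  by apply: lee_wpmul2r; [exact: Lnorm_ge0|rewrite lee_fin ler_norm].
exact: lee_wpmul2l.
Qed.

Lemma bounded_potential_indic : exists C : R, forall (A B : set X) (mA mB c : R),
  measurable A -> measurable B -> 0 < mA -> (mu A <= mA%:E)%E ->
  0 < mB -> (mB%:E <= mu B)%E -> 0 <= c ->
  (forall x, B x -> c%:E <= potential alpha sigma (\1_A : X -> R) x)%E ->
  c * mB `^ fine q^-1 <= C * mA `^ fine p^-1.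
Proof.
have [C C0 H] := bounded_potential_test; exists C => A B mA mB c msA msB mA0 AmA mB0 BmB c0 cB.
rewrite -lee_fin; apply: le_trans (H _ _ _ (Lnorm_indic_le p1 msA mA0 AmA)); last first.
  exact: measurable_indic.
apply: (@le_Lnorm_const_on _ _ _ mu _ q B mB c q1 msB mB0 BmB c0) => x Bx.
apply: (le_trans (cB x Bx)).
by case: (potential _ _ _ _) => // r; rewrite abse_EFin lee_fin ler_norm.
Qed.

(** Homogeneity of the measure: testing at scale [L]. *)
Let scaled (k L r : R) : 0 < k -> 0 < L -> (k * L `^ D) `^ r = k `^ r * L `^ (D * r).
Proof. by move=> k0 L0; rewrite powRM ?powR_ge0 ?(ltW k0)// powRrM. Qed.

(** Intervals of length comparable to their distance [L] from the origin, with [L] large: the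
    operator is bounded below on them, so it does not improve the decay at infinity. *)
Lemma necessary_q_ge_p : fine q^-1 <= fine p^-1.
Proof.
have [C H] := bounded_potential_indic.
have [c c0 loc] := potential_localization alpha1 sigma0.
have u0 : (0 : R) < 4^-1 by rewrite invr_gt0.
have uv : (4^-1 : R) < 1 by rewrite invf_lt1// ltr1n.
have u'0 : (0 : R) < 2^-1 by rewrite invr_gt0.
have uv' : (2^-1 : R) < 3 / 4 by lra.
have [kA kA0 HA] := dw_itv_scale alpha1 u0 uv.
have [kB kB0 HB] := dw_itv_scale alpha1 u'0 uv'.
have : D * fine q^-1 <= D * fine p^-1; last by rewrite ler_pM2l.
apply: (@powR_growth _ _ _ (c * kB `^ fine q^-1) (C * kA `^ fine p^-1) 4) => //.
  by rewrite mulr_gt0// powR_gt0.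
move=> L L4; have L0 : 0 < L by rewrite (lt_le_trans _ L4).
rewrite -!mulrA -!scaled//.
apply: (H `[4^-1 * L, 1 * L]%classic `[2^-1 * L, 3 / 4 * L]%classic) => //.
- by rewrite mulr_gt0// powR_gt0.
- by rewrite HA.
- by rewrite mulr_gt0// powR_gt0.
- by rewrite HB.
- exact: ltW.
move=> x; rewrite /= in_itv/= => /andP[x1 x2].
apply: loc => //; first by apply: itvcc_sub_halfline; rewrite mulr_gt0// invr_gt0.
  by lra.
by move=> y; rewrite /= !in_itv/= => /andP[y1 y2]; apply/andP; split; lra.
Qed.

(** The interval [[L, L + 1]] has measure of the order of [L `^ (2 * alpha + 1)], which now tends
    to [0]: sets that are small by lying far away on the line rule out a gain of
    integrability. *)
Lemma necessary_p_ge_q_of_small_alpha : alpha < - 2^-1 -> fine p^-1 <= fine q^-1.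
Proof.
move=> a2; have [C H] := bounded_potential_indic.
have [c c0 loc] := potential_localization alpha1 sigma0.
pose e := 2 * alpha + 1; have e0 : e < 0 by rewrite /e; lra.
have m0 : 0 < 2 `^ e / 2 by rewrite divr_gt0// powR_gt0.
have : e * fine q^-1 <= e * fine p^-1; last by rewrite ler_nM2l.
apply: (@powR_growth _ _ _ (c * (2 `^ e / 2) `^ fine q^-1) C 1) => //.
  by rewrite mulr_gt0// powR_gt0.
move=> L L1; have L0 : 0 < L by rewrite (lt_le_trans _ L1).
rewrite -!mulrA !powRrM -powRM ?powR_ge0 ?(ltW m0)//.
have uL : L < L + 1 by lra.
have vL : L + 4^-1 < L + 3 / 4 by lra.
apply: (H `[L, L + 1]%classic `[L + 4^-1, L + 3 / 4]%classic) => //.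
- exact: powR_gt0.
- rewrite (_ : L `^ e = L `^ e * (L + 1 - L)); last by ring.
  by apply: dw_itv_le => // x Lx _; apply: ler_powR_neg => //; exact: ltW.
- by rewrite mulr_gt0// powR_gt0.
- rewrite (_ : 2 `^ e / 2 * L `^ e = (2 * L) `^ e * (L + 3 / 4 - (L + 4^-1))); last first.
    by rewrite powRM ?(ltW L0)//; field.
  apply: dw_itv_ge => //; [by lra|exact: powR_ge0|move=> x x1 x2].
  by apply: ler_powR_neg; [exact: ltW|lra|lra].
- exact: ltW.
move=> x; rewrite /= in_itv/= => /andP[x1 x2].
apply: loc => //; first exact: itvcc_sub_halfline.
  by lra.
by move=> y; rewrite /= !in_itv/= => /andP[y1 y2]; apply/andP; split; lra.
Qed.

(** On a set near the origin where the kernel is bounded below, so is the potential of its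
    indicator. *)
Lemma potential_indic_ge (A : set X) (m c x : R) : measurable A -> A `<=` halfline ->
  (mu A = m%:E)%E -> 0 < x -> 0 <= c -> (forall y, A y -> c%:E <= pk x y)%E ->
  ((c * m)%:E <= potential alpha sigma (\1_A : X -> R) x)%E.
Proof.
move=> mA A0 Am x0 c0 cA; rewrite EFinM -Am -integral_cst//.
apply: (@potential_ge _ _ _ alpha1 sigma0 (\1_A) _ _ _ x0) => [y|y y0|y Ay]; first by [].
  by rewrite indicE memNset// => /A0; rewrite /= in_itv/= andbT ltNge y0.
by rewrite lee_fin c0/= indicE mem_set// mule1; exact: cA.
Qed.

(** Testing on [[r / 2, r]] for small [r = L^-1]: the potential is there at least of the order of
    [r `^ (2 * sigma)]. *)
Lemma necessary_scaling : fine p^-1 - sigma / (alpha + 1) <= fine q^-1.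
Proof.
have [C H] := bounded_potential_indic.
have [c c0 near] := potential_kernel_near_ge alpha1 sigma0.
have [k kk0 Hk] := dw_itv_half alpha1.
have a10 : 0 < alpha + 1 by rewrite -ltrBlDr sub0r.
suff : - (2 * sigma + D * fine q^-1) <= - (D * fine p^-1).
  rewrite lerN2 => h; rewrite lerBlDr -(ler_pM2l D0); apply: (le_trans h).
  rewrite le_eqVlt; apply/orP; left; apply/eqP; field.
  exact: lt0r_neq0.
apply: (@powR_growth _ _ _ (c * k * k `^ fine q^-1) (C * k `^ fine p^-1) 1) => //.
  by rewrite !mulr_gt0// powR_gt0.
move=> L L1; have L0 : 0 < L by rewrite (lt_le_trans _ L1).
pose r := L^-1; have r0 : 0 < r by rewrite invr_gt0.
have r1 : r <= 1 by rewrite invf_le1.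
have Lr s : L `^ (- s) = r `^ s by rewrite powRN /r -(powR_inv1 (ltW L0)) -powRrM mulN1r powRN.
rewrite !Lr powRD_gt0//.
have -> : 2 * sigma = 2 * (sigma - (alpha + 1)) + D by ring.
rewrite powRD_gt0// -[leRHS]mulrA -scaled//.
rewrite [leLHS](_ : _ = c * r `^ (2 * (sigma - (alpha + 1))) * (k * r `^ D) *
  (k `^ fine q^-1 * r `^ (D * fine q^-1))); last by ring.
rewrite -scaled//.
have Ar := Hk r r0.
have m0 : 0 < k * r `^ D by rewrite mulr_gt0// powR_gt0.
have cr : 0 <= c * r `^ (2 * (sigma - (alpha + 1))) by rewrite mulr_ge0 ?powR_ge0// ltW.
have A0 : `[2^-1 * r, 1 * r]%classic `<=` halfline by apply: itvcc_sub_halfline; rewrite mulr_gt0// invr_gt0.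
apply: (H `[2^-1 * r, 1 * r]%classic `[2^-1 * r, 1 * r]%classic) => //.
- by rewrite Ar.
- by rewrite Ar.
- by rewrite mulr_ge0// ltW.
move=> x Ax; have x0 : 0 < x by move: (A0 x Ax); rewrite /= in_itv/= andbT.
apply: potential_indic_ge => // y Ay.
have y0 : 0 < y by move: (A0 y Ay); rewrite /= in_itv/= andbT.
move: Ax Ay; rewrite /= !in_itv/= !mul1r => /andP[_ xr] /andP[_ yr].
exact: near.
Qed.

End necessary_conditions.

(** * The excluded endpoints *)

Section endpoints.
Context {R : realType}.
Variables (alpha sigma : R).
Hypotheses (alpha1 : -1 < alpha) (sigma0 : 0 < sigma).
Local Notation X := (measurableTypeR R).
Local Notation mu := (dw alpha).
Local Notation halfline := (`]0%R, +oo[%classic : set X).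
Local Notation D := (2 * alpha + 2).



Let a10 : 0 < alpha + 1. Proof. by rewrite -ltrBlDr sub0r. Qed.

(** The logarithm is the scale variable at the critical exponents. *)
Let small (L : R) : 1 <= L -> [/\ 0 < expR (- L), expR (- L) < 1 & ln (expR (- L))^-1 = L].
Proof.
move=> L1; rewrite expR_gt0 expR_lt1 oppr_lt0 -expRN opprK expRK; split => //.
exact: lt_le_trans L1.
Qed.

(** The kernel is at least a multiple of [L = ln r^-1] on [[r / 2, r]], and the potential of the
    indicator of this interval exceeds its [L1] norm by this factor. *)
Lemma not_bounded_L1_Linfty_critical : sigma = alpha + 1 ->
  ~ bounded_potential alpha sigma 1 +oo.
Proof.
move=> cr bd.
have [C H] := bounded_potential_indic (lexx 1%E) (leey _) bd.
have [c c0 near] := potential_kernel_log_ge alpha1 sigma0 cr.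
have [k kk0 Hk] := dw_itv_half alpha1.
have : (1 : R) <= 0; last by rewrite ler10.
apply: (@powR_growth _ _ _ c C 1) => // L L1; have [r0 r1 lr] := small L1.
set r := expR (- L) in r0 r1 lr; have L0 : 0 < L by rewrite (lt_le_trans _ L1).
rewrite powRr1 ?(ltW L0)// powRr0 mulr1.
have m0 : 0 < k * r `^ D by rewrite mulr_gt0// powR_gt0.
have A0 : `[2^-1 * r, 1 * r]%classic `<=` halfline by apply: itvcc_sub_halfline; rewrite mulr_gt0// invr_gt0.
have cL : 0 <= c * L by rewrite mulr_ge0// ltW.
have := H `[2^-1 * r, 1 * r]%classic `[2^-1 * r, 1 * r]%classic (k * r `^ D) (k * r `^ D)
  (c * L * (k * r `^ D)).
rewrite invey inve1 /= powRr0 mulr1 powRr1 ?(ltW m0)// ler_pM2r//; apply => //.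
- by rewrite Hk.
- by rewrite Hk.
- by rewrite mulr_ge0// ltW.
move=> x Ax; have x0 : 0 < x by move: (A0 x Ax); rewrite /= in_itv/= andbT.
apply: potential_indic_ge => //; first exact: Hk.
move=> y Ay; have y0 : 0 < y by move: (A0 y Ay); rewrite /= in_itv/= andbT.
move: Ax Ay; rewrite /= !in_itv/= !mul1r => /andP[_ xr] /andP[_ yr].
by rewrite -lr; exact: near.
Qed.

(** For [L = ln r^-1], the function [y `^ (- (2 * sigma))] on [[r, 1]] has norm [L `^ p^-1],
    while its potential at points below [r] is at least a multiple of [L]. *)
Lemma not_bounded_Lp_Linfty_critical (p : R) : 1 < p -> p^-1 = sigma / (alpha + 1) ->
  ~ bounded_potential alpha sigma p%:E +oo.
Proof.
move=> p1 cr bd; have p0 : 0 < p by rewrite (lt_trans _ p1).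
have p1' : (1 <= p%:E)%E by rewrite lee_fin ltW.
have [C C0 H] := bounded_potential_test bd.
have [c c0 near] := potential_kernel_near_ge alpha1 sigma0.
have [k kk0 Hk] := dw_itv_half alpha1.
have : (1 : R) <= p^-1; last by rewrite leNgt invf_lt1// p1.
apply: (@powR_growth _ _ _ c C 1) => // L L1; have [r0 r1 lr] := small L1.
set r := expR (- L) in r0 r1 lr; have L0 : 0 < L by rewrite (lt_le_trans _ L1).
have logr : ln 1 - ln r = L by rewrite ln1 sub0r -lnV.
rewrite powRr1 ?(ltW L0)//.
pose A : set X := `[r, 1]%classic.
have mA : measurable A by exact: measurable_itv.
have A0 : A `<=` halfline by exact: itvcc_sub_halfline.
have Apos y : A y -> 0 < y by move=> /A0; rewrite /= in_itv/= andbT.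
pose f (y : X) : R := y `^ (- (2 * sigma)) * \1_A y.
have f0 y : 0 <= f y by rewrite mulr_ge0 ?powR_ge0.
have fA y : A y -> f y = y `^ (- (2 * sigma)) by move=> Ay; rewrite /f indicE mem_set// mulr1.
have fN y : ~ A y -> f y = 0 by move=> Ay; rewrite /f indicE memNset// mulr0.
have mf : measurable_fun [set: X] f.
  by apply: measurable_funM; [exact: measurable_powRl|exact: measurable_indic].
have If : (\int[mu]_x (f x `^ p)%:E <= L%:E)%E.
  rewrite -logr -(integral_inv r0 r1).
  have -> : (\int[mu]_x (f x `^ p)%:E = \int[mu]_(x in A) (f x `^ p)%:E)%E.
    rewrite [RHS]integral_mkcond; apply: eq_integral => x _; rewrite patchE.
    case: ifPn => // /negP Ax; rewrite fN ?powR0 ?gt_eqF// => Ax'; apply: Ax; exact: mem_set.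
  rewrite integral_dw_pos//; last 2 first.
  - by apply: measurable_funTS; exact: (measurableT_comp (measurable_powR _) mf).
  - by move=> x _; exact: powR_ge0.
  rewrite le_eqVlt; apply/orP; left; apply/eqP; apply: eq_integral => x /set_mem Ax.
  rewrite fA// -powRrM -powRD_gt0 ?Apos//; congr (_ `^ _)%:E.
  have -> : sigma = p^-1 * (alpha + 1) by rewrite cr divfK// gt_eqF.
  by field; exact: lt0r_neq0.
have Nf : ('N[mu]_p%:E[EFin \o f] <= (L `^ p^-1)%:E)%E.
  by apply: Lnorm_le_of_integral => //; rewrite ?(ltW L0) ?(ltW p1).
have := H f _ mf Nf; rewrite -(lee_fin (c * L)); apply: le_trans.
pose B : set X := `[2^-1 * r, 1 * r]%classic.
have B0 : B `<=` halfline by apply: itvcc_sub_halfline; rewrite mulr_gt0// invr_gt0.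
have m0 : 0 < k * r `^ D by rewrite mulr_gt0// powR_gt0.
have := @le_Lnorm_const_on _ _ _ mu (potential alpha sigma f) +oo%E B (k * r `^ D) (c * L) (leey _).
rewrite invey /= powRr0 mulr1; apply => //.
- exact: measurable_itv.
- by rewrite Hk.
- by rewrite mulr_ge0// ltW.
move=> x Bx; have x0 : 0 < x by move: (B0 x Bx); rewrite /= in_itv/= andbT.
move: Bx; rewrite /B/= in_itv/= mul1r => /andP[_ xr].
have H1 : ((c * L)%:E <= potential alpha sigma f x)%E.
  have g0 y : A y -> 0 <= c * y `^ (- D) by move=> Ay; rewrite mulr_ge0 ?powR_ge0// ltW.
  have mg (E : set X) : measurable_fun E (fun y : X => c * y `^ (- D)).
    by apply: measurable_funM => //; exact: measurable_powRl.
  apply: le_trans (@potential_ge _ _ _ alpha1 sigma0 f (fun y => (c * y `^ (- D))%:E) A x x0 f0 _ _).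
  - rewrite integral_dw_pos// -logr EFinM -(integral_inv r0 r1).
    rewrite -ge0_integralZl; [|exact: mA|by apply/measurable_EFinP; exact: measurable_powRl
      |by move=> y _; rewrite lee_fin powR_ge0|by rewrite lee_fin ltW].
    rewrite le_eqVlt; apply/orP; left; apply/eqP; apply: eq_integral => y /set_mem Ay.
    rewrite -EFinM -mulrA -powRD_gt0 ?Apos//; congr (_ * _ `^ _)%:E; ring.
  - by move=> y y0; apply: fN => /Apos; rewrite ltNge y0.
  move=> y Ay; have y0 := Apos y Ay; rewrite lee_fin g0//=.
  move: (Ay); rewrite /A/= in_itv/= => /andP[ry y1].
  have := near y x y y0 y1 x0 (le_trans xr ry) y0 (lexx y).
  move=> /(lee_wpmul2r _) h; apply: le_trans (h (f y)%:E _); last by rewrite lee_fin.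
  rewrite fA// -EFinM lee_fin -mulrA -powRD_gt0//.
  by rewrite (_ : 2 * (sigma - (alpha + 1)) + - (2 * sigma) = - D)//; ring.
by rewrite gee0_abs// (le_trans _ H1)// lee_fin mulr_ge0// ltW.
Qed.

(** On [[r, 1]] the potential of the indicator of [[r / 2, r]] is at least its [L1] norm times
    [x `^ (2 * sigma - D)], whose [q]-th power has density [x^-1] against the measure; a factor
    [(ln r^-1) `^ q^-1] remains. *)
Lemma not_bounded_L1_Lq_critical (q : R) : 1 <= q -> q^-1 = 1 - sigma / (alpha + 1) ->
  ~ bounded_potential alpha sigma 1 q%:E.
Proof.
move=> q1 cr bd; have q0 : 0 < q by rewrite (lt_le_trans _ q1).
have [C C0 H] := bounded_potential_test bd.
have [c c0 near] := potential_kernel_near_ge alpha1 sigma0.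
have [k kk0 Hk] := dw_itv_half alpha1.
have : q^-1 <= 0; last by rewrite leNgt invr_gt0 q0.
apply: (@powR_growth _ _ _ c C 1) => // L L1; have [r0 r1 lr] := small L1.
set r := expR (- L) in r0 r1 lr; have L0 : 0 < L by rewrite (lt_le_trans _ L1).
have logr : ln 1 - ln r = L by rewrite ln1 sub0r -lnV.
rewrite powRr0 mulr1.
pose A : set X := `[2^-1 * r, 1 * r]%classic.
have mA : measurable A by exact: measurable_itv.
have A0 : A `<=` halfline by apply: itvcc_sub_halfline; rewrite mulr_gt0// invr_gt0.
have m0 : 0 < k * r `^ D by rewrite mulr_gt0// powR_gt0.
set m := k * r `^ D in m0.
have Am : mu A = m%:E by exact: Hk.
have Nf : ('N[mu]_1[EFin \o (\1_A : X -> R)] <= m%:E)%E.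
  have := @Lnorm_indic_le _ _ _ mu 1%E A m (lexx _) mA m0.
  by rewrite inve1 /= powRr1 ?(ltW m0)//; apply; rewrite Am.
have {H Nf} := H _ _ (measurable_indic mA) Nf.
set g := c * m * L `^ q^-1.
suff : (g%:E <= 'N[mu]_q%:E[potential alpha sigma \1_A])%E.
  by move=> /le_trans h /h; rewrite lee_fin /g mulrAC ler_pM2r.
pose B : set X := `[r, 1]%classic.
have mB : measurable B by exact: measurable_itv.
have B0 : B `<=` halfline by exact: itvcc_sub_halfline.
have Bpos y : B y -> 0 < y by move=> /B0; rewrite /= in_itv/= andbT.
have cm0 : 0 < c * m by rewrite mulr_gt0.
have -> : g = ((c * m) `^ q * L) `^ q^-1.
  by rewrite powRM ?powR_ge0 ?(ltW L0)// -powRrM divff ?gt_eqF// powRr1 ?(ltW cm0).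
rewrite unlock -poweR_EFin; apply: gt0_ler_poweR.
- by rewrite invr_ge0 ltW.
- by rewrite in_itv/= leey andbT lee_fin mulr_ge0 ?powR_ge0 ?(ltW L0).
- by rewrite in_itv/= leey andbT; apply: integral_ge0 => x _; exact: poweR_ge0.
have gx0 x : 0 <= c * x `^ (2 * (sigma - (alpha + 1))) * m.
  by rewrite mulr_ge0 ?(ltW m0)// mulr_ge0 ?powR_ge0// ltW.
pose G (x : X) : R := (c * x `^ (2 * (sigma - (alpha + 1))) * m) `^ q.
have mG (E : set X) : measurable_fun E G.
  apply: measurable_funTS; apply: (measurableT_comp (measurable_powR _)).
  by apply: measurable_funM => //; apply: measurable_funM => //; exact: measurable_powRl.
apply: (@le_trans _ _ (\int[mu]_(x in B) (G x)%:E)%E).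
  rewrite integral_dw_pos//; last by move=> x _; exact: powR_ge0.
  rewrite -logr EFinM -(integral_inv r0 r1).
  rewrite -ge0_integralZl; [|exact: mB|by apply/measurable_EFinP; exact: measurable_powRl
    |by move=> y _; rewrite lee_fin powR_ge0|by rewrite lee_fin powR_ge0].
  rewrite le_eqVlt; apply/orP; left; apply/eqP; apply: eq_integral => x /set_mem /Bpos x0.
  rewrite -EFinM /G [c * _ * m]mulrAC (powRM q (ltW cm0) (powR_ge0 _ _)) -powRrM -mulrA -powRD_gt0//.
  congr (_ * _ `^ _)%:E.
  have -> : 2 * (sigma - (alpha + 1)) = - (D * q^-1).
    by rewrite cr; field; exact: lt0r_neq0.
  by rewrite mulNr -mulrA mulVf ?lt0r_neq0//; ring.
apply: le_integral_nonnegS => // x; first by move=> _; exact: poweR_ge0.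
move=> Bx; have x0 := Bpos x Bx; rewrite lee_fin powR_ge0/= /G -poweR_EFin.
apply: gt0_ler_poweR; rewrite ?(ltW q0)// ?in_itv/= ?leey ?andbT ?lee_fin ?abse_ge0//.
have h : ((c * x `^ (2 * (sigma - (alpha + 1))) * m)%:E <= potential alpha sigma \1_A x)%E.
  apply: potential_indic_ge => //; first by rewrite mulr_ge0 ?powR_ge0// ltW.
  move=> y; rewrite /A/= in_itv/= mul1r => /andP[ry yr].
  have y0 : 0 < y by apply: lt_le_trans ry; rewrite mulr_gt0.
  move: Bx; rewrite /B/= in_itv/= => /andP[rx xl].
  by apply: near => //; exact: le_trans yr rx.
by rewrite gee0_abs// (le_trans _ h)// lee_fin.
Qed.

End endpoints.

(** * The theorem *)

Lemma inve_fine (R : realType) (p : \bar R) : (1 <= p)%E -> p^-1%E = (fine p^-1)%:E.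
Proof.
case: p => [r|_|//]; last by rewrite invey.
by rewrite lee_fin => r1; rewrite inver gt_eqF ?(lt_le_trans _ r1).
Qed.

Theorem theorem2p19 (R : realType) (alpha sigma : R) (p q : \bar R)
    (halpha : -1 < alpha) (hsigma : 0 < sigma)
    (hp : (1 <= p)%E) (hq : (1 <= q)%E) :
  (- 2^-1 <= alpha ->
     (bounded_potential alpha sigma p q <->
        [/\ (p^-1 - (sigma / (alpha + 1))%:E <= q^-1)%E,
            (q^-1 <= p^-1)%E,
            (p^-1, q^-1)%E <> ((sigma / (alpha + 1))%:E, 0%E) &
            (p^-1, q^-1)%E <> (1%E, (1 - sigma / (alpha + 1))%:E)])) /\
  (alpha < - 2^-1 -> (bounded_potential alpha sigma p q <-> p = q)).
Proof.
have a10 : 0 < alpha + 1 by rewrite -ltrBlDr sub0r.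
have inv_eq (e : \bar R) : (1 <= e)%E -> forall r : R, 0 < r -> e^-1%E = r^-1%:E -> e = r%:E.
  move=> e1 r r0 er; apply: constructive_ereal.invr_inj.
  by rewrite er inver gt_eqF.
have inv0 (e : \bar R) : (1 <= e)%E -> e^-1%E = 0%E -> e = +oo%E.
  by move=> e1 er; apply: constructive_ereal.invr_inj; rewrite er invey.
split=> [a2|a2].
  split=> [bd|[H1 H2 H3 H4]]; last first.
    have [<-|pq] := eqVneq p q; first exact: bounded_potential_diag.
    exact: bounded_potential_offdiag.
  split.
  - rewrite (inve_fine hp) (inve_fine hq) -EFinB lee_fin.
    exact: (necessary_scaling halpha hsigma hp hq bd).
  - rewrite (inve_fine hp) (inve_fine hq) lee_fin.
    exact: (necessary_q_ge_p halpha hsigma hp hq bd).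
  - case=> pE qE; have qoo := inv0 q hq qE.
    have s0 : 0 < sigma / (alpha + 1) by rewrite divr_gt0.
    have pE' : p = ((sigma / (alpha + 1))^-1)%:E.
      by apply: inv_eq => //; rewrite ?invr_gt0// invrK.
    have [r1|r1] := eqVneq (sigma / (alpha + 1))^-1 1.
      have cr : sigma = alpha + 1.
        by apply: divr1_eq; rewrite -[LHS]invrK r1 invr1.
      by move: bd; rewrite pE' qoo r1; exact: not_bounded_L1_Linfty_critical.
    move: bd; rewrite pE' qoo; apply: not_bounded_Lp_Linfty_critical => //.
      by rewrite lt_neqAle eq_sym r1 -lee_fin -pE'.
    by rewrite invrK.
  - case=> pE qE; have p1 : p = 1%E by apply: constructive_ereal.invr_inj; rewrite pE inve1.
    have [s1|s1] := eqVneq (1 - sigma / (alpha + 1)) 0.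
      have qoo : q = +oo%E by apply: inv0 => //; rewrite qE s1.
      have cr : sigma = alpha + 1.
        by move/eqP: s1; rewrite subr_eq0 eq_sym => /eqP/divr1_eq.
      by move: bd; rewrite p1 qoo; exact: not_bounded_L1_Linfty_critical.
    case: q hq bd qE {inv_eq inv0} => [r r1|_ _|//]; last first.
      by rewrite invey => -[] E; rewrite -E eqxx in s1.
    rewrite lee_fin in r1; have r0 : 0 < r by rewrite (lt_le_trans _ r1).
    rewrite inver gt_eqF// p1 => bd [qE].
    exact: (not_bounded_L1_Lq_critical halpha hsigma r1 qE bd).
split=> [bd|<-]; last exact: bounded_potential_diag.
apply: constructive_ereal.invr_inj; rewrite (inve_fine hp) (inve_fine hq); congr EFin; apply/eqP.
rewrite eq_le (necessary_q_ge_p halpha hsigma hp hq bd) andbT.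
exact: (necessary_p_ge_q_of_small_alpha halpha hsigma hp hq bd a2).
Qed.
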